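(* Let $(Z_n)_{n\ge 0}$ be a branching process in an i.i.d. random environment with $\mathbb{E}[X]>0$. Assume that there exists $s>0$ such that $\mathbb{E}[e^{-sX}]<\infty$ and that $\mathbb{P}(X<0)>0$. Then for every sequence $(k_n)$ with $k_n\to\infty$ and $k_n/e^{\eta n}\to0$ for every $\eta>0$, and every $i\in Cl(\mathcal{I})$, $$\lim_{n\to\infty}\tfrac1n\log\mathbb{P}_i(1\le Z_n\le k_n)=-\varrho .$$ Assume in addition that $\mathbb{P}(X\in r\mathbb{Z})<1$ for every $r>0$, that there exists a constant $0<d<\infty$ such that $M_Q\le d\,[m_Q+(m_Q)^2]$ a.s., and that $\mathbb{E}_1[Z_1\log^+(Z_1)]<\infty$. Then for every $\theta\in(0,\mathbb{E}[X]]$ and every $i\in Cl(\mathcal{I})$, $$\limsup_{n\to\infty}\tfrac1n\log\mathbb{P}_i(1\le Z_n\le e^{\theta n})=-\chi(\theta,\varrho,\Lambda).$$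
   Context: Branching process in random environment: let $\Delta$ be the set of probability measures on $\mathbb{N}_0=\{0,1,2,\dots\}$, let $Q$ be a $\Delta$-valued random variable (write $q(k)=q(\{k\})$, $m_q=\sum_k k\,q(k)$ and $M_q=\sum_k k^2q(k)$ for $q\in\Delta$), and let $\mathcal{E}=(Q_1,Q_2,\dots)$ be i.i.d. copies of $Q$. The process $(Z_n)_{n\ge0}$ takes values in $\mathbb{N}_0$, $Z_0$ is independent of $\mathcal{E}$, and for $n\ge 1$ the conditional law of $Z_n$ given $\mathcal{E},Z_0,\dots,Z_{n-1}$ is the $Z_{n-1}$-fold convolution $Q_n^{*Z_{n-1}}$ a.s. $\mathbb{P}_z$ (expectation $\mathbb{E}_z$) denotes the law given $Z_0=z$. $X=\log m_Q$. Rate function of the associated random walk: $\Lambda(\theta)=\sup_{\lambda\le 0}\{\lambda\theta-\log\mathbb{E}[e^{\lambda X}]\}\in[0,\infty]$ (supremum over $\lambda\le0$ only). For $\theta,x\ge0$ and a nonnegative function $H$: $\chi(\theta,x,H)=\inf_{t\in[0,1]}\{tx+(1-t)H(\theta/(1-t))\}$, with the convention $0\cdot\infty=0$ (so $t=1$ contributes the value $x$). $\mathcal{I}=\{j\ge1:\mathbb{P}(Q(j)>0,\,Q(0)>0)>0\}$ and $Cl(\mathcal{I})=\{k\ge1:\exists n\ge0,\ \exists j\in\mathcal{I}\text{ with }\mathbb{P}_j(Z_n=k)>0\}$. Definition of $\varrho$: when $\mathbb{E}[X]>0$ and $\mathbb{P}_1(Z_1=0)>0$ (the latter being implied by $\mathbb{P}(X<0)>0$),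 it is known that the limit $\varrho:=-\lim_{n\to\infty}\frac1n\log\mathbb{P}_k(Z_n=j)$ exists, belongs to $[0,\infty)$ and is the same for all $k,j\in Cl(\mathcal{I})$. *)

(* Defs.v *)
From HB Require Import structures.
From mathcomp Require Import all_boot all_order all_algebra.
From mathcomp Require Import all_classical all_reals all_analysis.

Set Implicit Arguments.
Unset Strict Implicit.
Unset Printing Implicit Defensive.

Import Order.TTheory GRing.Theory Num.Theory.
Import numFieldNormedType.Exports.

Local Open Scope classical_set_scope.
Local Open Scope ring_scope.
Local Open Scope ereal_scope.

(* The set Delta of probability measures on the natural numbers; its
   sigma-algebra is generated by the evaluations q |-> q A. *)
Notation offspring_law R := (pprobability nat R).

Section OffspringLaw.
Context {R : realType}.
Implicit Type q : offspring_law R.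

Definition pmf q (k : nat) : \bar R := q [set k].

Definition mean q : \bar R := \sum_(0 <= k <oo) (k%:R)%:E * pmf q k.

Definition second_moment q : \bar R :=
  \sum_(0 <= k <oo) ((k ^ 2)%:R)%:E * pmf q k.

(* [lne 0 = -oo] and [lne +oo = +oo], so X is extended-real valued. *)
Definition logmean q : \bar R := lne (mean q).

Fixpoint conv_pow q (m k : nat) : \bar R :=
  if m is m'.+1 then \sum_(i < k.+1) pmf q i * conv_pow q m' (k - i)
  else (k == 0%N)%:R%:E.

End OffspringLaw.

Section Process.
Context {R : realType} {d0 d : measure_display}.
Context {Omega0 : measurableType d0} (P0 : probability Omega0 R).
Context (Q : {mfun Omega0 >-> offspring_law R}).
Context {Omega : measurableType d}.
Context (E : nat -> {mfun Omega >-> offspring_law R}).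
Context (Z : nat -> {mfun Omega >-> nat}).

Definition env_events : set (set Omega) :=
  [set B | exists m (A : set (offspring_law R)),
     measurable A /\ B = E m @^-1` A].

Definition sigma_env : set (set Omega) := <<s env_events >>.

Definition sigma_past (n : nat) : set (set Omega) :=
  <<s env_events `|`
      [set B | exists l (A : set nat), (l <= n)%N /\ B = Z l @^-1` A] >>.

(* [E n] is the environment of the step from generation n to n + 1, i.e. the
   variable usually written Q_{n+1}. *)
Record is_bpre (P : probability Omega R) : Prop := IsBPRE {
  env_same_law : forall n (A : set (offspring_law R)), measurable A ->
    P (E n @^-1` A) = P0 (Q @^-1` A) ;
  env_independent : forall (s : seq nat) (A : nat -> set (offspring_law R)),
    uniq s -> (forall n, measurable (A n)) ->
    P (\bigcap_(n in [set` s]) (E n @^-1` A n)) =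
    \prod_(n <- s) P (E n @^-1` A n) ;
  init_independent : forall (B : set Omega) (z : nat), sigma_env B ->
    P (B `&` [set w | Z 0%N w = z]) = P B * P [set w | Z 0%N w = z] ;
  (* conditional law of Z_{n+1} given the environment and Z_0, ..., Z_n *)
  offspring_step : forall (n k : nat) (B : set Omega), sigma_past n B ->
    P (B `&` [set w | Z n.+1 w = k]) =
    \int[P]_(w in B) conv_pow (E n w) (Z n w) k
}.

(* [PP z] is the law of the environment and the process started from z. *)
Definition bpre_family (PP : nat -> probability Omega R) : Prop :=
  forall z, is_bpre (PP z) /\ PP z [set w | Z 0%N w = z] = 1.

Definition X (w : Omega0) : \bar R := logmean (Q w).

(* A value [+oo - oo] evaluates to [-oo]; thus [0 < mean_X] entails that the
   expectation of X is well defined. *)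
Definition mean_X : \bar R := \int[P0]_w X w.

Definition mgf_X (lambda : R) : \bar R := \int[P0]_w expeR (lambda%:E * X w).

Definition Lambda (theta : R) : \bar R :=
  ereal_sup [set (lambda * theta)%:E - lne (mgf_X lambda)
            | lambda in [set l : R | (l <= 0)%R]].

Context (PP : nat -> probability Omega R).

Definition indexI : set nat :=
  [set j | (1 <= j)%N /\
    0 < P0 [set w | 0 < pmf (Q w) j /\ 0 < pmf (Q w) 0%N]].

Definition ClI : set nat :=
  [set k | (1 <= k)%N /\
    exists n j, indexI j /\ 0 < PP j [set w | Z n w = k]].

Definition is_varrho (r : R) : Prop :=
  (0 <= r)%R /\ forall k j, ClI k -> ClI j ->
    - ((n%:R^-1)%:E * lne (PP k [set w | Z n w = j])) @[n --> \oo] --> r%:E.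

(* The number characterized by [is_varrho]; its existence is not assumed, and
   the value is the default 0 if there is none. *)
Definition varrho : R := xget 0%R is_varrho.

End Process.

(* At t = 1 the library conventions [theta / 0 = 0] and [0 * y = 0] for every
   extended real y yield the value x. *)
Definition chi {R : realType} (theta x : R) (H : R -> \bar R) : \bar R :=
  ereal_inf [set (t * x)%:E + (1 - t)%:E * H (theta / (1 - t))%R
            | t in `[0%R, 1%R]].

(* Main.v *)
(* Conditioning on the environment of the first step turns E_z[g(Z_n)] into the
   n-th iterate of the positive operator P g(z) = E[sum_k Q^{*z}(k) g(k)].

   Small values.  In an environment with mean at most exp(-delta) and with Q(0)
   and Q(j) bounded below, the functions z s^(z-1) are mapped, up to a constant,
   above z s'^(z-1) with 1 - s' = exp(-delta) (1 - s).  Thus a population of size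
   at most a can be reduced to one individual in O(ln a) generations at a cost
   polynomial in a, whence P_i(1 <= Z_n <= a) <= C a^C exp(-varrho n); with
   subexponential a this is the first claim.

   Upper bound.  Cut at the last time before which Z is below exp(eps n): up to
   then the cost is exp(-varrho tau), afterwards Z stays large and, by a lower
   tail estimate based on M <= d (m + m^2), z^lambda with lambda <= 0 is
   multiplied by about E[exp(lambda X)] at each step.  Finitely many lambda
   suffice for all values of tau / n.

   Lower bound.  Spend t n generations returning to i, then follow a typical
   word of windows of X under the tilt exp(lambda X), where lambda <= 0
   minimizes E[exp(lambda (X - theta'))].  The tilted mean is positive, so the
   quenched survival probability decays subexponentially, and it is at most
   theta', so the first moment keeps Z below exp(theta n).  Passing from finitely
   many windows to the law of X uses the compactness of the set of minimizers. *)

Require Import Defs.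
From HB Require Import structures.
From mathcomp Require Import all_boot all_order all_algebra.
From mathcomp Require Import all_classical all_reals all_analysis.
From mathcomp Require Import measurable_realfun zify ring lra.

Set Implicit Arguments.
Unset Strict Implicit.
Unset Printing Implicit Defensive.

Import Order.TTheory GRing.Theory Num.Theory.
Import numFieldNormedType.Exports.

Local Open Scope classical_set_scope.
Local Open Scope ring_scope.
Local Open Scope ereal_scope.

Local Notation pmf := Defs.pmf.


(** * Sums against convolution powers *)

(** Why [z s^(z-1)]: if [f] is the generating function of an environment, derivatives turn this
    function into [z f(s)^(z-1) f'(s)]. Convexity gives [f(s) >= 1 - m (1 - s)], which drives [s] to
    1 geometrically when [m < 1], and [f'(s)] is bounded below by its term of index [j]. Why the
    threshold [exp(eps n)] in the upper bound: a lower tail started above [b] fails with probability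
    [exp(- kap b)]. For [b = exp(eps n)] this beats every exponential rate, while the polynomial
    price of values below [b] is only [exp(C eps n)]. In the lower bound, survival and smallness
    come from the same word through [1{Z > 0} <= 1{0 < Z <= a} + Z / a]: the survival term decays
    subexponentially, the first-moment term exponentially. Finitely many windows give the tilted law
    a finite variance, so Chebyshev suffices. Its mean is positive by complementary slackness:
    either it equals the target slope, or [lam = 0] and the law is the untilted one, normalized.
    Probabilities of the process enter only through the iterates [popn]; all estimates are then
    inequalities between functions on the integers. *)

Lemma nneseriesZr (R : realType) (f : nat -> \bar R) (c : \bar R) :
  (forall i, 0 <= f i) -> 0 <= c ->
  \sum_(i <oo) f i * c = (\sum_(i <oo) f i) * c.
Proof.
move=> f0 c0; rewrite -!ge0_integral_count //; last by move=> i; rewrite mule_ge0.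
by rewrite ge0_integralZr.
Qed.

Section OffspringSums.
Context {R : realType}.
Implicit Types (q : offspring_law R) (g h : nat -> \bar R) (z : nat).

Definition csum q z g : \bar R := \sum_(k <oo) conv_pow q z k * g k.

Lemma opmf_ge0 q k : 0 <= pmf q k.
Proof. exact: measure_ge0. Qed.

Lemma pmf_fin q k : pmf q k \is a fin_num.
Proof. exact: fin_num_measure. Qed.

Lemma conv_pow_ge0 q z k : 0 <= conv_pow q z k.
Proof.
elim: z k => [|z IH] k /=; first by rewrite lee_fin ler0n.
by apply: sume_ge0 => i _; rewrite mule_ge0 ?measure_ge0.
Qed.

Lemma csum_ge0 q z g : (forall k, 0 <= g k) -> 0 <= csum q z g.
Proof. by move=> g0; apply: nneseries_ge0 => k _ _; rewrite mule_ge0 ?conv_pow_ge0. Qed.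

Lemma le_csum q z g h : (forall k, 0 <= g k) -> (forall k, g k <= h k) ->
  csum q z g <= csum q z h.
Proof.
move=> g0 gh; apply: lee_nneseries => k *.
  by rewrite mule_ge0 ?conv_pow_ge0.
by rewrite lee_wpmul2l ?conv_pow_ge0.
Qed.

Lemma csumD q z g h : (forall k, 0 <= g k) -> (forall k, 0 <= h k) ->
  csum q z (fun k => g k + h k) = csum q z g + csum q z h.
Proof.
move=> g0 h0; rewrite /csum -nneseriesD; last 2 first.
- by move=> *; rewrite mule_ge0 ?conv_pow_ge0.
- by move=> *; rewrite mule_ge0 ?conv_pow_ge0.
by apply: eq_eseriesr => k _; rewrite ge0_muleDr.
Qed.

Lemma csumZ q z g (c : R) : (forall k, 0 <= g k) ->
  csum q z (fun k => c%:E * g k) = c%:E * csum q z g.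
Proof.
move=> g0; rewrite /csum -nneseriesZl.
  by apply: eq_eseriesr => k _; rewrite muleCA.
by move=> k _; rewrite mule_ge0 ?conv_pow_ge0.
Qed.

Lemma csum0 q g : (forall k, 0 <= g k) -> csum q 0 g = g 0%N.
Proof.
move=> g0; rewrite /csum nneseries_recl//=; last first.
  by move=> k _; rewrite mule_ge0 // lee_fin ler0n.
rewrite mul1e eseries0 ?adde0 // => -[//|i] _ _ /=.
by rewrite mul0e.
Qed.

Lemma nneseries_addn_mkcond (f : nat -> \bar R) i : (forall k, 0 <= f k) ->
  \sum_(k <oo) f k = \sum_(k <oo) (if (i <= k)%N then f (k - i)%N else 0).
Proof.
move=> f0.
set h := fun k => if (i <= k)%N then f (k - i)%N else 0.
have h0 k : 0 <= h k by rewrite /h; case: ifP.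
rewrite [RHS](@nneseries_split _ h 0%N i) // add0n.
rewrite big_nat big1 ?add0e => [|k /andP[_ ki]]; last by rewrite /h leqNgt ki.
rewrite -(nneseries_addn i h0); apply: eq_eseriesr => k _.
by rewrite /h leq_addl addnK.
Qed.

(* Conditioning on the offspring number [i] of the first individual. *)
Lemma csumS q z g : (forall k, 0 <= g k) ->
  csum q z.+1 g = \sum_(i <oo) pmf q i * csum q z (fun k => g (i + k)%N).
Proof.
move=> g0; rewrite /csum /=.
transitivity (\sum_(k <oo) \sum_(i <oo) if (i <= k)%N then
    pmf q i * (conv_pow q z (k - i) * g k) else 0).
  apply: eq_eseriesr => k _.
  rewrite (@nneseries_split _ _ 0%N k.+1); last first.
    by move=> i _; case: ifP => // _; rewrite !mule_ge0 ?measure_ge0 ?conv_pow_ge0.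
  rewrite add0n [X in _ = _ + X]eseries0 ?adde0; last first.
    by move=> i ki _; rewrite leqNgt ki.
  rewrite ge0_sume_distrl; last first.
    by move=> i _; rewrite !mule_ge0 ?measure_ge0 ?conv_pow_ge0.
  rewrite big_mkord; apply: eq_bigr => i _.
  by rewrite -ltnS ltn_ord muleA.
rewrite nneseries_interchange; last first.
  by move=> k i; case: ifP => // _; rewrite !mule_ge0 ?measure_ge0 ?conv_pow_ge0.
apply: eq_eseriesr => i _.
have -> : conv_pow q z = fun k => conv_pow q z k by [].
rewrite -[pmf q i](fineK (pmf_fin q i)) -nneseriesZl; last first.
  by move=> k _; rewrite mule_ge0 ?conv_pow_ge0.
rewrite [RHS](@nneseries_addn_mkcond _ i); last first.
  by move=> k; rewrite !mule_ge0 ?conv_pow_ge0 ?fine_ge0 ?lee_fin ?fine_ge0 ?measure_ge0.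
by apply: eq_eseriesr => k _; case: ifP => // ik; rewrite subnKC.
Qed.

Lemma sum_pmf q : \sum_(k <oo) pmf q k = 1.
Proof.
rewrite -(@probability_setT _ _ _ q).
rewrite (_ : setT = \bigcup_k [set k]); last first.
  by apply/seteqP; split => // k _; exists k.
rewrite measure_bigcup //=; first by apply: eq_eseriesl => k; apply/esym; exact: in_setT.
by move=> i j _ _ [x [/= <- <-]].
Qed.

Lemma csum_cst q z (c : R) : (0 <= c)%R -> csum q z (fun=> c%:E) = c%:E.
Proof.
move=> c0; elim: z => [|z IH]; first by rewrite csum0.
rewrite csumS // (eq_eseriesr (g := fun i => c%:E * pmf q i)).
  by rewrite nneseriesZl ?sum_pmf ?mule1 // => i _; exact: opmf_ge0.
by move=> i _; rewrite IH muleC.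
Qed.

Definition gf q (s : R) : \bar R := \sum_(k <oo) pmf q k * (s ^+ k)%:E.

Lemma gf_ge0 q s : (0 <= s)%R -> 0 <= gf q s.
Proof.
move=> s0; apply: nneseries_ge0 => k _ _.
by rewrite mule_ge0 ?measure_ge0 // lee_fin exprn_ge0.
Qed.


(** Integrates a quadratic inequality against [q]. The negative linear term stands on the left as
    [b * k] so that every series has nonnegative terms; it is subtracted only once the sums are
    known to be finite. *)
Lemma pointwise_pmf_le q (phi : nat -> R) (m v a b c1 c2 : R) :
  mean q = m%:E -> second_moment q = v%:E ->
  (0 <= a)%R -> (0 <= b)%R -> (0 <= c1)%R -> (0 <= c2)%R ->
  (forall k, 0 <= phi k)%R ->
  (forall k, phi k + b * k%:R <= a + c1 * k%:R + c2 * k%:R ^+ 2)%R ->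
  \sum_(k <oo) pmf q k * (phi k)%:E <= (a - b * m + c1 * m + c2 * v)%:E.
Proof.
move=> qm qv a0 b0 c10 c20 phi0 le_phi.
have E1 : \sum_(k <oo) pmf q k * (phi k + b * k%:R)%:E =
    \sum_(k <oo) pmf q k * (phi k)%:E + (b * m)%:E.
  rewrite EFinM -qm /mean -nneseriesZl; last first.
    by move=> i _; rewrite mule_ge0 ?measure_ge0.
  rewrite -nneseriesD; last 2 first.
  - by move=> *; rewrite mule_ge0 ?measure_ge0 // lee_fin.
  - by move=> *; rewrite !mule_ge0 ?measure_ge0 // lee_fin.
  apply: eq_eseriesr => k _.
  rewrite EFinD ge0_muleDr ?lee_fin ?mulr_ge0 //.
  by rewrite EFinM muleCA [pmf q k * k%:R%:E]muleC.
have E2 : \sum_(k <oo) pmf q k * (a + c1 * k%:R + c2 * k%:R ^+ 2)%:E =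
    (a + c1 * m + c2 * v)%:E.
  rewrite !EFinD !EFinM -qm -qv /mean /second_moment.
  rewrite -[a%:E]mule1 -(sum_pmf q) -!nneseriesZl; last first.
  - by move=> i _; rewrite opmf_ge0.
  - by move=> i _; rewrite mule_ge0 ?measure_ge0.
  - by move=> i _; rewrite mule_ge0 ?measure_ge0 // lee_fin.
  rewrite -!nneseriesD //; do ? by move=> *; rewrite ?adde_ge0 ?mule_ge0 ?measure_ge0 // lee_fin.
  apply: eq_eseriesr => k _.
  rewrite !EFinD !ge0_muleDr ?lee_fin ?addr_ge0 ?mulr_ge0 ?exprn_ge0 //.
  congr (_ + _ + _); first by rewrite muleC.
    by rewrite EFinM muleCA [pmf q k * k%:R%:E]muleC.
  by rewrite EFinM muleCA [pmf q k * (_)%:E]muleC natrX.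
have : \sum_(k <oo) pmf q k * (phi k + b * k%:R)%:E <= (a + c1 * m + c2 * v)%:E.
  rewrite -E2; apply: lee_nneseries => k *.
    by rewrite mule_ge0 ?measure_ge0 // lee_fin addr_ge0 ?mulr_ge0.
  by rewrite lee_wpmul2l ?measure_ge0 // lee_fin.
rewrite E1 -leeBrDr // -EFinB => /le_trans; apply.
by rewrite lee_fin; lra.
Qed.

Lemma csum_exp q z (s : R) : (0 <= s)%R ->
  csum q z.+1 (fun k => (s ^+ k)%:E) = gf q s * csum q z (fun k => (s ^+ k)%:E).
Proof.
move=> s0; have sk0 k : 0 <= (s ^+ k)%:E by rewrite lee_fin exprn_ge0.
rewrite csumS //.
rewrite (eq_eseriesr (g := fun i => pmf q i * (s ^+ i)%:E *
   csum q z (fun k => (s ^+ k)%:E))); last first.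
  move=> i _; rewrite -muleA -csumZ //; congr (_ * csum _ _ _).
  by apply/funext => k; rewrite exprD EFinM.
by rewrite nneseriesZr ?csum_ge0 // => i; rewrite mule_ge0 ?measure_ge0.
Qed.

Lemma csum_exp_ge q z (s t : R) : (0 <= s)%R -> (0 <= t)%R -> t%:E <= gf q s ->
  (t ^+ z)%:E <= csum q z (fun k => (s ^+ k)%:E).
Proof.
move=> s0 t0 tg; elim: z => [|z IH].
  by rewrite csum0 // => k; rewrite lee_fin exprn_ge0.
by rewrite csum_exp // exprS EFinM lee_pmul // lee_fin ?exprn_ge0.
Qed.

Lemma csum_exp_le q z (s t : R) : (0 <= s)%R -> (0 <= t)%R -> gf q s <= t%:E ->
  csum q z (fun k => (s ^+ k)%:E) <= (t ^+ z)%:E.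
Proof.
move=> s0 t0 tg; have sk0 k : 0 <= (s ^+ k)%:E by rewrite lee_fin exprn_ge0.
elim: z => [|z IH]; first by rewrite csum0.
by rewrite csum_exp // exprS EFinM lee_pmul ?gf_ge0 ?csum_ge0.
Qed.

Lemma csum_id q z (m : R) : mean q = m%:E ->
  csum q z (fun k => (k%:R)%:E) = (z%:R * m)%:E.
Proof.
move=> qm; have m0 : (0 <= m)%R.
  rewrite -lee_fin -qm; apply: nneseries_ge0 => k _ _.
  by rewrite mule_ge0 ?measure_ge0 // lee_fin.
elim: z => [|z IH]; first by rewrite csum0 ?mul0r.
rewrite csumS; last by move=> k; rewrite lee_fin.
rewrite (eq_eseriesr (g := fun i => i%:R%:E * pmf q i +
    (z%:R * m)%:E * pmf q i)); last first.
  move=> i _; rewrite -IH [X in _ * X](_ : _ = i%:R%:E + csum q z (fun k => k%:R%:E)).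
    by rewrite ge0_muleDr ?csum_ge0 // muleC [X in _ + X]muleC.
  rewrite -[in RHS](@csum_cst q z i%:R) // -csumD //.
  by congr csum; apply/funext => k; rewrite natrD EFinD.
rewrite nneseriesD; last 2 first.
- by move=> *; rewrite mule_ge0 ?measure_ge0 // lee_fin.
- by move=> *; rewrite mule_ge0 ?measure_ge0 // lee_fin mulr_ge0.
rewrite nneseriesZl ?sum_pmf ?mule1; last by move=> *; exact: opmf_ge0.
by rewrite -/(mean q) qm -EFinD; congr EFin; rewrite -natr1; ring.
Qed.

(* The right-hand side is [z f^(z-1) f'] at [s], where [f] is the generating
   function of [q]. *)
Lemma csum_deriv_ge q z (s t c : R) : (0 <= s)%R -> (0 <= t)%R -> (0 <= c)%R ->
  t%:E <= gf q s -> c%:E <= \sum_(k <oo) pmf q k * (k%:R * s ^+ k.-1)%:E ->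
  (z%:R * c * t ^+ z.-1)%:E <= csum q z (fun k => (k%:R * s ^+ k.-1)%:E).
Proof.
move=> s0 t0 c0 tg cg.
have G0 k : (0 <= (k%:R * s ^+ k.-1)%:E) by rewrite lee_fin mulr_ge0 ?exprn_ge0.
have sk0 k : 0 <= (s ^+ k)%:E by rewrite lee_fin exprn_ge0.
elim: z => [|z IH]; first by rewrite csum0 // !mul0r.
rewrite csumS //.
have H i : pmf q i * csum q z (fun k => ((i + k)%:R * s ^+ (i + k).-1)%:E) =
    pmf q i * (i%:R * s ^+ i.-1)%:E * csum q z (fun k => (s ^+ k)%:E) +
    pmf q i * (s ^+ i)%:E * csum q z (fun k => (k%:R * s ^+ k.-1)%:E).
  rewrite -!muleA -ge0_muleDr; last 2 first.
  - by rewrite mule_ge0 ?csum_ge0.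
  - by rewrite mule_ge0 ?csum_ge0.
  congr (_ * _); rewrite -!csumZ // -csumD; last 2 first.
  - by move=> k; rewrite mule_ge0.
  - by move=> k; rewrite mule_ge0.
  congr csum; apply/funext => k.
  rewrite -!EFinM -EFinD; congr EFin.
  case: i k => [|i] [|k] /=; rewrite ?addn0 ?add0n ?mul0r ?expr0 ?mulr1 ?mul1r ?add0r ?mulr0 ?addr0 //.
  by rewrite natrD mulrDl exprD !exprS; ring.
under eq_eseriesr do rewrite H.
have -> : (z.+1%:R * c * t ^+ z.+1.-1)%:E =
    c%:E * (t ^+ z)%:E + t%:E * (z%:R * c * t ^+ z.-1)%:E.
  rewrite -!EFinM -EFinD; congr EFin; case: z {IH H} => [|z] /=; first by ring.
  by rewrite exprS -natr1; ring.
rewrite nneseriesD; last 2 first.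
- by move=> *; rewrite mule_ge0 ?csum_ge0 // mule_ge0 ?measure_ge0.
- by move=> *; rewrite mule_ge0 ?csum_ge0 // mule_ge0 ?measure_ge0.
have pG0 k : 0 <= pmf q k * (k%:R * s ^+ k.-1)%:E by rewrite mule_ge0 ?measure_ge0.
have ps0 k : 0 <= pmf q k * (s ^+ k)%:E by rewrite mule_ge0 ?measure_ge0.
rewrite !nneseriesZr ?csum_ge0 //; apply: leeD; apply: lee_pmul => //.
- by rewrite lee_fin exprn_ge0.
- exact: csum_exp_ge.
- by rewrite lee_fin !mulr_ge0 ?exprn_ge0.
Qed.

(** [1 - (1 - u) ^+ k] is the probability that at least one of [k] independent lines survives, each
    with probability [u]. The bound is [csum_exp_le] read on complements, the total mass being 1. *)
Lemma csum_survival q z (u u' : R) : (0 <= u <= 1)%R -> (0 <= u' <= 1)%R ->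
  gf q (1 - u)%R <= (1 - u')%:E ->
  (1 - (1 - u') ^+ z)%:E <= csum q z (fun k => (1 - (1 - u) ^+ k)%:E).
Proof.
move=> /andP[u0 u1] /andP[u'0 u'1] gu.
have le1 (x : R) k : (0 <= x <= 1)%R -> (0 <= x ^+ k <= 1)%R.
  by move=> /andP[x0 x1]; rewrite exprn_ge0 // exprn_ile1.
have pk k : (0 <= (1 - u) ^+ k <= 1)%R by apply: le1; lra.
have h0 k : 0 <= (1 - (1 - u) ^+ k)%:E by rewrite lee_fin; have := pk k; lra.
have h1 k : 0 <= ((1 - u) ^+ k)%:E by rewrite lee_fin; have := pk k; lra.
have := @csum_cst q z 1 ler01.
rewrite (_ : (fun=> 1%:E) = (fun k : nat => (1 - (1 - u) ^+ k)%:E + ((1 - u) ^+ k)%:E)); last first.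
  by apply/funext => k; rewrite -EFinD; congr EFin; ring.
rewrite csumD // => e1.
have le2 : csum q z (fun k => ((1 - u) ^+ k)%:E) <= ((1 - u') ^+ z)%:E.
  by apply: csum_exp_le => //; lra.
rewrite EFinB leeBlDr // -e1; apply: leeD => //.
Qed.

Lemma onem_exp_le_inv (u : R) k : (0 <= u <= 1)%R ->
  ((1 - u) ^+ k * (1 + k%:R * u) <= 1)%R.
Proof.
move=> /andP[u0 u1]; elim: k => [|k IH]; first by rewrite expr0 mul1r mul0r addr0.
apply: le_trans IH; rewrite exprS -mulrA mulrCA; apply: ler_wpM2l.
  by rewrite exprn_ge0 // subr_ge0.
by rewrite -natr1; have : (0 <= k%:R :> R)%R by []; nra.
Qed.

(** With [w = k u], the bound [(1 - u)^k <= 1 / (1 + w)] is at most [1 - 2 a w + a^2 w (1 + w)],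
    because [w (1 - a (1 + w))^2 >= 0]; the latter is quadratic in [k] and integrates to the two
    moments. The parameter [a] is left free and optimized later. *)
Lemma gf_survival_le q (m v a u : R) : mean q = m%:E ->
  second_moment q = v%:E -> (0 <= u <= 1)%R -> (0 <= a)%R ->
  gf q (1 - u)%R <= (1 - 2 * a * u * m + a ^+ 2 * (u * m + u ^+ 2 * v))%:E.
Proof.
move=> qm qv u01 a0; have /andP[u0 u1] := u01.
have := @pointwise_pmf_le q (fun k => (1 - u) ^+ k)%R m v 1 (2 * a * u)%R
  (a ^+ 2 * u)%R (a ^+ 2 * u ^+ 2)%R qm qv.
move=> /(_ ler01) H; apply: le_trans (H _ _ _ _ _) _.
- by rewrite !mulr_ge0.
- by rewrite mulr_ge0 ?exprn_ge0.
- by rewrite mulr_ge0 ?exprn_ge0.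
- by move=> k; rewrite exprn_ge0 // subr_ge0.
- move=> k; have := onem_exp_le_inv k u01.
  set y := ((1 - u) ^+ k)%R; set x := (k%:R)%R => yx.
  have x0 : (0 <= x)%R by rewrite /x.
  have y0 : (0 <= y)%R by rewrite exprn_ge0 // subr_ge0.
  set w := (x * u)%R; have w0 : (0 <= w)%R by rewrite mulr_ge0.
  have w1 : (0 < 1 + w)%R by lra.
  rewrite -(ler_pM2r w1).
  have yw : (y * (1 + w) <= 1)%R by rewrite /w.
  have -> : ((y + 2 * a * u * x) * (1 + w) = y * (1 + w) + 2 * a * w * (1 + w))%R.
    by rewrite /w; ring.
  have -> : ((1 + a ^+ 2 * u * x + a ^+ 2 * u ^+ 2 * x ^+ 2) * (1 + w) =
      1 + w + a ^+ 2 * w * (1 + w) ^+ 2)%R by rewrite /w; ring.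
  have : (0 <= w * (1 - a * (1 + w)) ^+ 2)%R by rewrite mulr_ge0 ?sqr_ge0.
  by lra.
- by rewrite lee_fin; lra.
Qed.

(** Through [1 / (1 + x)], since [(1 + x) (1 - x + x^2) = 1 + x^3]. *)
Lemma expRN_le_quadratic (x : R) : (0 <= x)%R -> (expR (- x) <= 1 - x + x ^+ 2)%R.
Proof.
move=> x0; rewrite expRN.
have x1 : (0 < 1 + x)%R by lra.
apply: (@le_trans _ _ (1 + x)^-1%R).
  by rewrite lef_pV2 ?posrE ?expR_gt0 // expR_ge1Dx.
rewrite -[leLHS]mul1r ler_pdivrMr //.
by have : (0 <= x ^+ 3)%R by [rewrite exprn_ge0]; lra.
Qed.

Lemma gf_exp_le q (m v r : R) : mean q = m%:E ->
  second_moment q = v%:E -> (0 <= r)%R ->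
  gf q (expR (- r)) <= (expR (- (r * m) + r ^+ 2 * v))%:E.
Proof.
move=> qm qv r0.
have := @pointwise_pmf_le q (fun k => expR (- r) ^+ k)%R m v 1 r 0 (r ^+ 2)%R qm qv.
move=> /(_ ler01 r0 (lexx _)) H; apply: le_trans (H _ _ _) _.
- by rewrite exprn_ge0.
- by move=> k; rewrite exprn_ge0 // expR_ge0.
- move=> k; rewrite -expRM_natl mulrN.
  have := @expRN_le_quadratic (k%:R * r)%R; rewrite mulr_ge0 // => /(_ isT).
  by rewrite exprMn; lra.
- rewrite lee_fin; apply: le_trans (expR_ge1Dx _).
  by lra.
Qed.

(** Chernoff's bound, from [1{k <= x} <= exp(r x) exp(- r k)]. For a lower tail two moments control
    the exponential transform at every [r >= 0]. *)
Lemma csum_lower_tail q z (m v r x : R) : mean q = m%:E ->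
  second_moment q = v%:E -> (0 <= r)%R ->
  csum q z (fun k => ((k%:R <= x)%R%:R)%:E) <=
    (expR (r * x + z%:R * (- (r * m) + r ^+ 2 * v)))%:E.
Proof.
move=> qm qv r0.
apply: (@le_trans _ _ ((expR (r * x))%:E * csum q z (fun k => (expR (- r) ^+ k)%:E))).
  rewrite -csumZ; last by move=> k; rewrite lee_fin exprn_ge0 // expR_ge0.
  apply: le_csum => k; first by rewrite lee_fin.
  rewrite -EFinM lee_fin -expRM_natl -expRD.
  case: (leP k%:R x) => kx /=; last exact: expR_ge0.
  rewrite -[leLHS]expR0 ler_expR.
  by have := ler_wpM2l r0 kx; lra.
rewrite expRD EFinM lee_wpmul2l ?lee_fin ?expR_ge0 // expRM_natl.
by apply: csum_exp_le; rewrite ?expR_ge0 //; exact: gf_exp_le.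
Qed.

End OffspringSums.


(** * Measurability in the environment and a change of variables *)

Section Measurability.
Context {R : realType}.
Implicit Types (g : nat -> \bar R).

Lemma measurable_pmf k :
  measurable_fun setT (fun q : offspring_law R => pmf q k : \bar R).
Proof.
exact: (measurable_kernel (kprobability (@measurable_id _ (offspring_law R) setT)) [set k] I).
Qed.

Lemma measurable_conv_pow z k :
  measurable_fun setT (fun q : offspring_law R => conv_pow q z k : \bar R).
Proof.
elim: z k => [|z IH] k /=; first exact: measurable_cst.
apply: emeasurable_sum => i; apply: emeasurable_funM; last exact: IH.
exact: measurable_pmf.
Qed.

Lemma measurable_csum z g : (forall k, 0 <= g k) ->
  measurable_fun setT (fun q : offspring_law R => csum q z g : \bar R).
Proof.
move=> g0; apply: ge0_emeasurable_sum => k *.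
  by rewrite mule_ge0 ?conv_pow_ge0.
by apply: emeasurable_funM => //; exact: measurable_conv_pow.
Qed.

Lemma measurable_mean : measurable_fun setT (fun q : offspring_law R => mean q : \bar R).
Proof.
apply: ge0_emeasurable_sum => k *.
  by rewrite mule_ge0 ?measure_ge0 // lee_fin.
by apply: emeasurable_funM => //; exact: measurable_pmf.
Qed.

Lemma measurable_second_moment :
  measurable_fun setT (fun q : offspring_law R => second_moment q : \bar R).
Proof.
apply: ge0_emeasurable_sum => k *.
  by rewrite mule_ge0 ?measure_ge0 // lee_fin.
by apply: emeasurable_funM => //; exact: measurable_pmf.
Qed.

End Measurability.

Section RestrictedIntegral.
Context d d' (T : measurableType d) (U : measurableType d') (R : realType).

(** The image under [f] of [P] restricted to [D] is [c] times the law of [h]; both integrals are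
    rewritten on [U]. It is used with [D] an event independent of the next environment. *)
Lemma integral_indep_event d0 (T0 : measurableType d0)
  (P : probability T R) (P0 : probability T0 R)
  (f : {mfun T >-> U}) (h : {mfun T0 >-> U}) (D : set T) (c : R)
  (g : U -> \bar R) :
  measurable D -> (0 <= c)%R ->
  (forall A, measurable A -> P (D `&` f @^-1` A) = c%:E * P0 (h @^-1` A)) ->
  measurable_fun setT g -> (forall u, 0 <= g u) ->
  \int[P]_(w in D) g (f w) = c%:E * \int[P0]_w g (h w).
Proof.
move=> mD c0 Hc mg g0.
have mgf : measurable_fun setT (g \o f) by exact: measurableT_comp.
have mgh : measurable_fun setT (g \o h) by exact: measurableT_comp.
pose PD := mrestr P mD.
have e1 : \int[P]_(w in D) g (f w) = \int[PD]_(w in D) g (f w).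
  apply: eq_measure_integral => A mA AD.
  by rewrite /PD /= /mrestr setIidl.
have e2 : \int[PD]_w g (f w) = \int[PD]_(w in D) g (f w).
  rewrite (@ge0_negligible_integral _ _ _ PD setT (~` D)) //.
  - by rewrite setTD setCK.
  - exact: measurableC.
  - by rewrite /PD /= /mrestr setICl measure0.
rewrite e1 -e2.
pose c' := NngNum c0.
have push1 : \int[PD]_w g (f w) = \int[pushforward PD f]_u g u.
  by rewrite ge0_integral_pushforward // => u _.
have push2 : \int[P0]_w g (h w) = \int[pushforward P0 h]_u g u.
  by rewrite ge0_integral_pushforward // => u _.
rewrite push1 push2.
have -> : c%:E = c'%:num%:E by [].
rewrite -ge0_integral_mscale //.
apply: eq_measure_integral => A mA _.
by rewrite /= /mscale /pushforward /PD /= /mrestr setIC Hc.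
Qed.

End RestrictedIntegral.


(** * The annealed operator *)

Definition ind {R : realType} (A : pred nat) (k : nat) : \bar R := (A k)%:R%:E.

Lemma ind_ge0 {R : realType} A k : 0 <= ind A k :> \bar R.
Proof. by rewrite /ind lee_fin. Qed.

Section OneStep.
Context {R : realType} {d0 : measure_display} {Omega0 : measurableType d0}.
Context (P0 : probability Omega0 R) (Q : {mfun Omega0 >-> offspring_law R}).
Implicit Types (g h : nat -> \bar R) (z n : nat) (B : set Omega0).

(* The annealed one-step operator, restricted to environments in [Q @` B]. *)
Definition pop B g z : \bar R := \int[P0]_(w in B) csum (Q w) z g.

Lemma measurable_csumQ z g B : (forall k, 0 <= g k) ->
  measurable_fun B (fun w => csum (Q w) z g).
Proof.
move=> g0; apply: measurable_funTS.
exact: (measurableT_comp (measurable_csum z g0) (measurable_funPT Q)).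
Qed.

Lemma pop_ge0 B g z : (forall k, 0 <= g k) -> 0 <= pop B g z.
Proof. by move=> g0; apply: integral_ge0 => w _; exact: csum_ge0. Qed.

Lemma le_pop B g h z : measurable B -> (forall k, 0 <= g k) ->
  (forall k, g k <= h k) -> pop B g z <= pop B h z.
Proof.
move=> mB g0 gh; have h0 k : 0 <= h k := le_trans (g0 k) (gh k).
by apply: ge0_le_integral => //; do ?[exact: measurable_csumQ | move=> w _;
  by [exact: csum_ge0 | exact: le_csum]].
Qed.

Lemma popD B g h z : measurable B -> (forall k, 0 <= g k) ->
  (forall k, 0 <= h k) -> pop B (fun k => g k + h k) z = pop B g z + pop B h z.
Proof.
move=> mB g0 h0; rewrite /pop; under eq_integral do rewrite csumD //.
by rewrite ge0_integralD //; do ?[by move=> w _; exact: csum_ge0 | exact: measurable_csumQ].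
Qed.

Lemma popZ B g z (c : R) : measurable B -> (0 <= c)%R -> (forall k, 0 <= g k) ->
  pop B (fun k => c%:E * g k) z = c%:E * pop B g z.
Proof.
move=> mB c0 g0; rewrite /pop; under eq_integral do rewrite csumZ //.
by rewrite ge0_integralZl_EFin //; do ?[by move=> w _; exact: csum_ge0 | exact: measurable_csumQ].
Qed.

Lemma pop_subset B B' g z : measurable B -> measurable B' -> B `<=` B' ->
  (forall k, 0 <= g k) -> pop B g z <= pop B' g z.
Proof.
move=> mB mB' BB' g0; apply: ge0_subset_integral => //.
- exact: measurable_csumQ.
- by move=> w _; exact: csum_ge0.
Qed.

Lemma pop_sum (I : eqType) (s : seq I) (B : I -> set Omega0) g z :
  (forall i, measurable (B i)) -> uniq s -> trivIset [set` s] B ->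
  (forall k, 0 <= g k) -> \sum_(i <- s) pop (B i) g z <= pop setT g z.
Proof.
move=> mB us tB g0; rewrite /pop -ge0_integral_bigsetU //.
- by apply: pop_subset => //; exact: bigsetU_measurable.
- exact: measurable_csumQ.
- by move=> w _; exact: csum_ge0.
Qed.

Lemma pop_ge_cst B g z (c : R) : measurable B -> (forall k, 0 <= g k) ->
  (0 <= c)%R -> (forall w, B w -> c%:E <= csum (Q w) z g) ->
  c%:E * P0 B <= pop B g z.
Proof.
move=> mB g0 c0 Hc; rewrite -integral_cst //; by apply: ge0_le_integral => //; do ?[exact: measurable_csumQ | move=> w _;
  exact: csum_ge0].
Qed.

Lemma pop_cst z (c : R) : (0 <= c)%R -> pop setT (fun=> c%:E) z = c%:E.
Proof.
move=> c0; rewrite /pop; under eq_integral do rewrite csum_cst //.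
rewrite integral_cst //.
exact: (etrans (congr1 (mule c%:E) (@probability_setT _ _ _ P0)) (mule1 _)).
Qed.

Definition popn n g : nat -> \bar R := iter n (pop setT) g.

Lemma popnS n g z : popn n.+1 g z = pop setT (popn n g) z.
Proof. by []. Qed.

Lemma popn_ge0 n g z : (forall k, 0 <= g k) -> 0 <= popn n g z.
Proof. by move=> g0; elim: n z => [//|n IH] z; exact: pop_ge0. Qed.

Lemma le_popn n g h z : (forall k, 0 <= g k) -> (forall k, g k <= h k) ->
  popn n g z <= popn n h z.
Proof.
move=> g0 gh; elim: n z => [//|n IH] z; apply: le_pop => // k.
exact: popn_ge0.
Qed.

Lemma popnZ n g z (c : R) : (0 <= c)%R -> (forall k, 0 <= g k) ->
  popn n (fun k => c%:E * g k) z = c%:E * popn n g z.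
Proof.
move=> c0 g0; elim: n z => [//|n IH] z; rewrite !popnS.
rewrite (_ : popn n _ = fun k => c%:E * popn n g k); last exact/funext.
by apply: popZ => // k; exact: popn_ge0.
Qed.

Lemma popnD n m g z : popn (n + m) g z = popn n (popn m g) z.
Proof. by rewrite /popn iterD. Qed.

Lemma popn_cst n z (c : R) : (0 <= c)%R -> popn n (fun=> c%:E) z = c%:E.
Proof.
move=> c0; elim: n z => [//|n IH] z.
by rewrite popnS (_ : popn n _ = fun=> c%:E) ?pop_cst //; apply/funext.
Qed.

Lemma popn_ind_le1 n A z : popn n (ind A) z <= 1.
Proof.
rewrite -(@popn_cst n z 1) //; apply: le_popn; first exact: ind_ge0.
by move=> k; rewrite /ind lee_fin lern1 leq_b1.
Qed.

(** Transition probabilities of the Markov chain that [Z] becomes once the environment is averaged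
    out. *)
Definition tker j k : \bar R := \int[P0]_w conv_pow (Q w) j k.

Lemma pop_tker g j : (forall k, 0 <= g k) ->
  pop setT g j = \sum_(k <oo) tker j k * g k.
Proof.
move=> g0; rewrite /pop /csum.
have mc k : measurable_fun setT (fun w => conv_pow (Q w) j k).
  exact: (measurableT_comp (measurable_conv_pow j k) (measurable_funPT Q)).
rewrite integral_nneseries //.
- apply: eq_eseriesr => k _; rewrite ge0_integralZr // => w _.
  exact: conv_pow_ge0.
- by move=> k; exact: emeasurable_funM.
- by move=> k w _; rewrite mule_ge0 ?conv_pow_ge0.
Qed.

End OneStep.

(** * The law of the process through the annealed operator *)

Section Markov.
Context {R : realType} {d0 d : measure_display} {Omega0 : measurableType d0}.
Context (P0 : probability Omega0 R) (Q : {mfun Omega0 >-> offspring_law R}).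
Context {Omega : measurableType d} (E : nat -> {mfun Omega >-> offspring_law R}).
Context (Z : nat -> {mfun Omega >-> nat}) (P : probability Omega R).
Hypothesis bpreP : is_bpre P0 Q E Z P.

Let envcap (s : seq nat) (A : nat -> set (offspring_law R)) : set Omega :=
  \bigcap_(i in [set` s]) (E i @^-1` A i).

Let measurable_preZ n (A : set nat) : measurable (Z n @^-1` A).
Proof. by rewrite -[X in measurable X]setTI; exact: measurable_funPT. Qed.

Let measurable_preE n (A : set (offspring_law R)) : measurable A ->
  measurable (E n @^-1` A).
Proof. by move=> mA; rewrite -[X in measurable X]setTI; exact: measurable_funPT. Qed.

Let measurable_envcap s A : (forall i, measurable (A i)) ->
  measurable (envcap s A).
Proof.
by move=> mA; apply: fin_bigcap_measurable => // i _; exact: measurable_preE.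
Qed.

Let sigma_env_envcap s A : (forall i, measurable (A i)) ->
  sigma_env E (envcap s A).
Proof.
move=> mA; apply: (@fin_bigcap_measurable _ (g_sigma_algebraType (env_events E))) => // i _.
by apply: sub_sigma_algebra; exists i, (A i).
Qed.

Let sigma_past_envcap n s A : (forall i, measurable (A i)) ->
  sigma_past E Z n (envcap s A).
Proof.
move=> mA; apply: (sub_sigma_algebra2 _ (sigma_env_envcap s mA)).
by move=> B HB; left.
Qed.

Let integral_step n j k (s : seq nat) A :
  (forall i, measurable (A i)) ->
  (forall A0, measurable A0 ->
    P ((envcap s A `&` (Z n @^-1` [set j])) `&` E n @^-1` A0) =
    P (Z n @^-1` [set j]) * \prod_(i <- s) P0 (Q @^-1` A i) * P0 (Q @^-1` A0)) ->
  \int[P]_(w in envcap s A `&` (Z n @^-1` [set j])) conv_pow (E n w) (Z n w) k =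
  P (Z n @^-1` [set j]) * \prod_(i <- s) P0 (Q @^-1` A i) * tker P0 Q j k.
Proof.
move=> mA H.
set D := (X in \int[P]_(w in X) _); set c := _ * \prod_(i <- s) _.
have cfin : c \is a fin_num.
  rewrite fin_numM ?fin_num_measure // prode_fin_num // => i _.
  by rewrite fin_num_measure // -[X in measurable X]setTI; exact: measurable_funPT.
have c0 : 0 <= c by rewrite mule_ge0 ?prode_ge0.
rewrite (eq_integral (fun w => conv_pow (E n w) j k)); last first.
  by move=> w; rewrite inE => -[_ /= ->].
rewrite -[c](fineK cfin) /tker.
apply: (@integral_indep_event _ _ _ _ _ _ _ P P0 (E n) Q D (fine c) (fun q => conv_pow q j k)) => //.
- by apply: measurableI => //; exact: measurable_envcap.
- by rewrite fine_ge0.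
- by move=> A0 mA0; rewrite fineK // H.
- exact: measurable_conv_pow.
- by move=> q; exact: conv_pow_ge0.
Qed.

(** The invariant that makes the annealed chain Markov: [Z n] is independent of the environments
    from [n] on. It needs a proof, because [is_bpre] conditions on the whole environment, future
    included. *)
Let indep_at n := forall j (s : seq nat) A, uniq s ->
  (forall i, i \in s -> (n <= i)%N) -> (forall i, measurable (A i)) ->
  P (envcap s A `&` (Z n @^-1` [set j])) =
    P (Z n @^-1` [set j]) * \prod_(i <- s) P0 (Q @^-1` A i).

(** An event on later environments belongs to [sigma_past n], so [offspring_step] applies to it.
    After cutting along the values of [Z n], only the environment of step [n] is integrated and the
    later ones factor out. *)
Let env_future_step n s' A' k : indep_at n ->
   uniq s' -> (forall i, i \in s' -> (n < i)%N) ->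
   (forall i, measurable (A' i)) ->
   P (envcap s' A' `&` (Z n.+1 @^-1` [set k])) =
   \sum_(l <oo) (P (Z n @^-1` [set l]) * tker P0 Q l k) *
     \prod_(i <- s') P0 (Q @^-1` A' i).
Proof.
move=> IH us' sn' mA'.
rewrite (offspring_step bpreP); last exact: sigma_past_envcap.
rewrite [X in \int[P]_(w in X) _](_ : _ = \bigcup_l (envcap s' A' `&` (Z n @^-1` [set l]))); last first.
  rewrite -setI_bigcupr -preimage_bigcup [X in Z n @^-1` X](_ : _ = setT) ?preimage_setT ?setIT //.
  by apply/seteqP; split => // l _; exists l.
have mS l : measurable (envcap s' A' `&` (Z n @^-1` [set l])).
  by apply: measurableI => //; exact: measurable_envcap.
rewrite ge0_integral_bigcup; last 4 first.
- exact: mS.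
- apply/(measurable_fun_bigcup _ mS) => l.
  apply: (@eq_measurable_fun _ _ _ _ _ (fun w => conv_pow (E n w) l k)).
    by move=> w; rewrite inE => -[_ /= ->].
  apply: measurable_funTS.
  exact: (measurableT_comp (measurable_conv_pow l k) (measurable_funPT (E n))).
- by move=> w _; exact: conv_pow_ge0.
- by move=> a b _ _ [w [[_ /= <-] [_ /= <-]]].
apply: eq_eseriesr => l _.
rewrite integral_step //; first by rewrite muleAC.
(* The event on the environment of step [n] is adjoined to the later ones, so that the invariant can
   be used with the index list [n :: s']. *)
move=> A0 mA0; pose A'' i := if i == n then A0 else A' i.
have ns : n \notin s' by apply/negP => /sn'; rewrite ltnn.
have ne i : i \in s' -> (i == n) = false.
  by move=> /sn'; rewrite ltnNge => /negbTE; case: eqP => // ->; rewrite leqnn.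
have /= := IH l (n :: s') A''; rewrite ns us' => /(_ isT) H.
have {H} := H _ _; rewrite big_cons /A'' eqxx => H.
rewrite -muleA [\prod_(i <- s') _ * _]muleC.
have -> : \prod_(i <- s') P0 (Q @^-1` A' i) =
    \prod_(i <- s') P0 (Q @^-1` (if i == n then A0 else A' i)).
  by apply: eq_big_seq => i /ne ->.
rewrite -H; last 2 first.
- by move=> i; rewrite inE => /predU1P[->//|/sn' /ltnW].
- by move=> i; case: ifP.
congr (P _); rewrite setIAC; congr (_ `&` _).
apply/seteqP; split => w /=.
  move=> [Hs Hn] i /=; rewrite inE => /predU1P[->|si]; first by rewrite eqxx.
  by rewrite ne //; exact: Hs.
move=> H'; split.
  move=> i /= si; have := H' i; rewrite /= inE si orbT ne // => /(_ isT).
  exact.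
by have := H' n; rewrite /= inE !eqxx => /(_ isT).
Qed.

Let envcap0 A : envcap [::] A = setT.
Proof. by apply/seteqP; split => // w _ i. Qed.

Let env_future_step0 n k : indep_at n ->
   P (Z n.+1 @^-1` [set k]) = \sum_(l <oo) P (Z n @^-1` [set l]) * tker P0 Q l k.
Proof.
move=> IH; have := @env_future_step n [::] (fun=> setT) k IH isT.
rewrite envcap0 setTI => -> //.
by apply: eq_eseriesr => l _; rewrite big_nil mule1.
Qed.

Let env_future_independent n : indep_at n.
Proof.
elim: n => [|n IH] j s A us sn mA.
  rewrite (init_independent bpreP); last exact: sigma_env_envcap.
  rewrite (env_independent bpreP) // muleC; congr (_ * _).
  by apply: eq_bigr => i _; rewrite (env_same_law bpreP).
rewrite env_future_step // env_future_step0 // -nneseriesZr //.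
- by move=> l; rewrite mule_ge0 //; apply: integral_ge0 => w _; exact: conv_pow_ge0.
- exact: prode_ge0.
Qed.

Lemma law_step n k :
   P (Z n.+1 @^-1` [set k]) = \sum_(l <oo) P (Z n @^-1` [set l]) * tker P0 Q l k.
Proof. by apply: env_future_step0; exact: env_future_independent. Qed.

(** Each induction step moves the last transition from the law to the test function, by exchanging
    two nonnegative sums. *)
Lemma expect_popn n g : (forall k, 0 <= g k) ->
  \sum_(k <oo) P (Z n @^-1` [set k]) * g k =
  \sum_(k <oo) P (Z 0%N @^-1` [set k]) * popn P0 Q n g k.
Proof.
elim: n g => [//|n IH] g g0.
rewrite /popn iterSr -/(popn _ _ _ _) -IH; last by move=> k; exact: pop_ge0.
have tk0 l k : 0 <= tker P0 Q l k.
  by apply: integral_ge0 => w _; exact: conv_pow_ge0.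
transitivity (\sum_(k <oo) \sum_(l <oo) P (Z n @^-1` [set l]) * (tker P0 Q l k * g k)).
  apply: eq_eseriesr => k _; rewrite law_step -nneseriesZr //; last first.
    by move=> l; rewrite mule_ge0.
  by apply: eq_eseriesr => l _; rewrite muleA.
rewrite nneseries_interchange; last by move=> *; rewrite !mule_ge0.
apply: eq_eseriesr => l _; rewrite pop_tker //.
have /fineK <- : P (Z n @^-1` [set l]) \is a fin_num by rewrite fin_num_measure.
by rewrite nneseriesZl // => k _; rewrite mule_ge0.
Qed.

Lemma prob_popn n (A : pred nat) z : P [set w | Z 0%N w = z] = 1 ->
  P [set w | A (Z n w)] = popn P0 Q n (ind A) z.
Proof.
move=> Pz.
have sumP (B : pred nat) : \sum_(k <oo) P (Z n @^-1` [set k]) * ind B k = P [set w | B (Z n w)].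
  rewrite (_ : [set w | B (Z n w)] = \bigcup_(k in [set k | B k]) Z n @^-1` [set k]); last first.
    by apply/seteqP; split => [w /= Bw|w [k /= Bk Zk]]; [exists (Z n w)|rewrite Zk].
  rewrite measure_bigcup //; last by move=> a b _ _ [w [/= <- <-]].
  rewrite [RHS]eseries_mkcond; apply: eq_eseriesr => k _.
  rewrite /ind; case: ifPn => [/set_mem Bk|].
    have -> : B k = true by exact: Bk.
    by rewrite mule1.
  by rewrite notin_setE /= => /negP/negbTE ->; rewrite mule0.
have Pne k : k != z -> P (Z 0%N @^-1` [set k]) = 0.
  move=> kz; apply/eqP; rewrite eq_le measure_ge0 andbT.
  have -> : 0 = P (~` [set w | Z 0%N w = z]).
    rewrite probability_setC ?Pz ?subee //.
    exact: (measurable_preZ 0 [set z]).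
  apply: le_measure; rewrite ?inE //.
  - by apply: measurableC; exact: (measurable_preZ 0 [set z]).
  - by move=> w /= Zk Zz; move: kz; rewrite -Zk -Zz eqxx.
rewrite -sumP expect_popn; last exact: ind_ge0.
rewrite (@nneseriesD1 _ _ z xpredT) //=; last first.
  by move=> k _; rewrite mule_ge0 //; apply: popn_ge0; exact: ind_ge0.
rewrite [P _]Pz mul1e eseries0 ?adde0 // => k _ kz.
by rewrite Pne // mul0e.
Qed.

End Markov.


(** * Descent in a bad environment *)

Lemma bernoulli_ge {R : realType} (x : R) n : (0 <= x <= 1)%R ->
  (1 - n%:R * x <= (1 - x) ^+ n)%R.
Proof.
move=> /andP[x0 x1]; elim: n => [|n IH]; first by rewrite expr0 mul0r subr0.
rewrite exprS; apply: (@le_trans _ _ ((1 - x) * (1 - n%:R * x))%R).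
  have : (0 <= n%:R :> R)%R by []; rewrite -natr1; nra.
by rewrite ler_wpM2l // subr_ge0.
Qed.

Section PositiveMeasure.
Context d (T : measurableType d) (R : realType) (mu : {measure set T -> \bar R}).

Lemma measure_bigcup_gt0 (B : (set T)^nat) : (forall n, measurable (B n)) ->
  0 < mu (\bigcup_n B n) -> exists n, 0 < mu (B n).
Proof.
move=> mB; apply: contraPP => /forallNP H; apply/negP.
rewrite -leNgt le_eqVlt; apply/orP; left; apply/eqP.
apply/(measure_negligible (bigcup_measurable _)) => [k _|]; first exact: mB.
apply: negligible_bigcup => k; exists (B k); split => //.
by apply/eqP; rewrite eq_le measure_ge0 andbT leNgt; apply/negP/H.
Qed.

Lemma integral_gt0 (B : set T) (f : T -> \bar R) : measurable B ->
  measurable_fun B f -> (forall x, B x -> 0 < f x) -> 0 < mu B ->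
  0 < \int[mu]_(x in B) f x.
Proof.
move=> mB mf f0 B0.
pose C n := B `&` [set x | (n.+1%:R^-1)%:E <= f x].
have mC n : measurable (C n) by exact: emeasurable_fun_c_infty.
have BC : B = \bigcup_n C n.
  apply/seteqP; split => [x Bx|x [n _ []]//].
  have := f0 _ Bx; case E : (f x) => [r| |] //; rewrite ?lte_fin => r0.
    have [n nr] := ltr_add_invr r0; rewrite add0r in nr.
    by exists n => //; split => //=; rewrite E lee_fin ltW.
  by exists 0%N => //; split => //=; rewrite E leey.
have [|n Cn] := @measure_bigcup_gt0 C mC; first by rewrite -BC.
apply: (@lt_le_trans _ _ ((n.+1%:R^-1)%:E * mu (C n))).
  by rewrite mule_gt0 // lte_fin invr_gt0.
apply: (@le_trans _ _ (\int[mu]_(x in C n) f x)); last first.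
  by apply: ge0_subset_integral => // [x Bx|x []//]; exact/ltW/f0.
rewrite -integral_cst //; apply: ge0_le_integral => //; do ?[by move=> x [Bx _]; exact/ltW/f0 |
  by apply: (measurable_funS mB) => // x [] | by move=> x []].
by move=> x _; rewrite lee_fin invr_ge0.
Qed.

End PositiveMeasure.

Section MeasurableExtendedLog.
Context {R : realType}.

Lemma measurable_lne : measurable_fun setT (@lne R).
Proof.
apply: (measurability _ (ErealGenInftyO.measurableE R)) => _ /= -[_ [r ->] <-].
rewrite setTI preimage_itvNyo (_ : [set x | _] = [set x | x < (expR r)%:E]).
  by rewrite -[X in measurable X]setTI; exact: emeasurable_fun_infty_o.
apply/seteqP; split => -[x| |] //=; rewrite ?ltNyr //; case: ifPn => //.
- by move=> /le_lt_trans xr _; rewrite lte_fin xr // expR_gt0.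
- rewrite -ltNge => x0; rewrite !lte_fin => xr.
  by rewrite -[ltLHS](lnK x0) ltr_expR.
- by move=> _ _; rewrite ltNyr.
- rewrite -ltNge => x0; rewrite !lte_fin => xr.
  by rewrite -ltr_expR lnK.
Qed.

Lemma measurable_expeR : measurable_fun setT (@expeR R).
Proof.
apply: (measurability _ (ErealGenInftyO.measurableE R)) => _ /= -[_ [r ->] <-].
rewrite setTI preimage_itvNyo; have [r0|r0] := leP r 0%R.
  rewrite (_ : [set x | _] = set0) //; apply/seteqP; split => // x /=.
  by rewrite ltNge (le_trans _ (expeR_ge0 _)) // lee_fin.
rewrite (_ : [set x | _] = [set x | x < (ln r)%:E]).
  by rewrite -[X in measurable X]setTI; exact: emeasurable_fun_infty_o.
have rE : r%:E = expeR (ln r)%:E by rewrite /= lnK.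
by apply/seteqP; split => x /=; rewrite rE lte_expeR.
Qed.

End MeasurableExtendedLog.

Section Descent.
Context {R : realType} {d0 : measure_display} {Omega0 : measurableType d0}.
Context (P0 : probability Omega0 R) (Q : {mfun Omega0 >-> offspring_law R}).

Lemma csum_ind1 (q : offspring_law R) z j : csum q z (ind (pred1 j)) = conv_pow q z j.
Proof.
rewrite /csum (@nneseriesD1 _ _ j xpredT) //=; last first.
  by move=> k _; rewrite mule_ge0 ?conv_pow_ge0 ?ind_ge0.
rewrite /ind /= eqxx mule1 eseries0 ?adde0 // => k _ /negbTE /= ->.
by rewrite mule0.
Qed.

Lemma conv_pow_0 (q : offspring_law R) z : conv_pow q z 0%N = pmf q 0%N ^+ z.
Proof. by elim: z => [//|z IH] /=; rewrite big_ord_recl big_ord0 adde0 IH; case: z {IH}; rewrite ?mule1. Qed.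

(** Keeps the event that the first individual has [j] children and the others none. *)
Lemma conv_pow_ge1 (q : offspring_law R) z j : (0 < j)%N ->
  pmf q j * pmf q 0%N ^+ z <= conv_pow q z.+1 j.
Proof.
by move=> j0; rewrite /= big_ord_recr /= subnn conv_pow_0 leeDr // sume_ge0 // => i _;
  rewrite mule_ge0 ?measure_ge0 ?conv_pow_ge0.
Qed.

(** Any one of the [z] individuals may be the one with [j] children; these events are disjoint
    because [j > 0]. The factor [z] is what makes the bound comparable with [z s^(z-1)]. *)
Lemma conv_pow_ge (q : offspring_law R) z j (e : R) : (0 < j)%N -> (0 <= e)%R ->
  e%:E <= pmf q j -> e%:E <= pmf q 0%N -> (z%:R * e ^+ z)%:E <= conv_pow q z j.
Proof.
move=> j0 e0 ej ez; elim: z => [|z IH]; first by rewrite mul0r conv_pow_ge0.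
rewrite /= (bigD1 ord0) //= subn0 (bigD1 ord_max) /=; last first.
  by rewrite -val_eqE /= -lt0n.
rewrite subnn conv_pow_0 addeA.
have ez' : (e ^+ z)%:E <= pmf q 0%N ^+ z.
  elim: (z) => [//|n IHn]; rewrite exprS EFinM expeS lee_pmul // lee_fin.
  exact: exprn_ge0.
have -> : (z.+1%:R * e ^+ z.+1)%:E = e%:E * (z%:R * e ^+ z)%:E + e%:E * (e ^+ z)%:E.
  by rewrite -!EFinM -EFinD; congr EFin; rewrite -natr1 exprS; ring.
apply: (@le_trans _ _ (pmf q 0 * conv_pow q z j + pmf q j * pmf q 0 ^+ z)).
  apply: leeD; apply: lee_pmul => //; rewrite lee_fin ?exprn_ge0 //.
  by rewrite mulr_ge0 // exprn_ge0.
by rewrite leeDl // sume_ge0 // => i _; rewrite mule_ge0 ?measure_ge0 ?conv_pow_ge0.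
Qed.

(** Bernoulli's inequality [s^k >= 1 - k (1 - s)], summed against [q]. *)
Lemma gf_ge_mean (q : offspring_law R) (m s : R) : mean q <= m%:E ->
  (0 <= s <= 1)%R -> (1 - m * (1 - s))%:E <= gf q s.
Proof.
move=> qm /andP[s0 s1].
have m0 : (0 <= m)%R.
  rewrite -lee_fin; apply: le_trans qm; apply: nneseries_ge0 => k _ _.
  by rewrite mule_ge0 ?measure_ge0 // lee_fin.
rewrite EFinB leeBlDr //.
apply: (@le_trans _ _ (gf q s + (1 - s)%:E * mean q)); last first.
  by rewrite leeD2l // EFinM muleC lee_wpmul2r // lee_fin subr_ge0.
rewrite -(sum_pmf q) /gf /mean -nneseriesZl; last first.
  by move=> k _; rewrite mule_ge0 ?measure_ge0 // lee_fin.
have e1 k : 0 <= pmf q k * (s ^+ k)%:E by rewrite mule_ge0 ?measure_ge0 // lee_fin exprn_ge0.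
have e2 k : 0 <= (1 - s)%:E * (k%:R%:E * pmf q k).
  by rewrite !mule_ge0 ?measure_ge0 // lee_fin // subr_ge0.
rewrite -nneseriesD //; apply: lee_nneseries => [k _ _|k _]; first exact: opmf_ge0.
have -> : (1 - s)%:E * (k%:R%:E * pmf q k) = pmf q k * ((1 - s) * k%:R)%:E.
  by rewrite muleA EFinM muleC.
rewrite -ge0_muleDr ?lee_fin ?exprn_ge0 ?mulr_ge0 ?subr_ge0 //.
rewrite -[leLHS]mule1 lee_wpmul2l ?measure_ge0 // -EFinD lee_fin.
have := @bernoulli_ge _ (1 - s)%R k; rewrite opprB addrCA subrr addr0.
by rewrite subr_ge0 s1 gerBl s0 => /(_ isT); lra.
Qed.

(** Where the mean vanishes, [X] is [-oo] and the integrand of [mgf_X] at [- s] is [+oo], so such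
    environments must have measure zero. *)
Lemma mean_gt0_ae : (exists s : R, (0 < s)%R /\ mgf_X P0 Q (- s)%R < +oo) ->
  P0 [set w | mean (Q w) <= 0] = 0.
Proof.
move=> [s [s0 mgfs]].
have mX : measurable_fun setT (fun w => mean (Q w)).
  exact: (measurableT_comp measurable_mean (measurable_funPT Q)).
set N := [set w | mean (Q w) <= 0].
have mN : measurable N by rewrite -[N]setTI; exact: emeasurable_fun_infty_c.
have mXX : measurable_fun setT (fun w => expeR ((- s)%:E * X Q w)).
  apply: (measurableT_comp measurable_expeR); apply: measurable_funeM.
  exact: (measurableT_comp measurable_lne).
apply/eqP; apply: contraTT mgfs => PN; rewrite -leNgt.
have PN0 : 0 < P0 N by rewrite lt_neqAle eq_sym PN measure_ge0.
apply: (@le_trans _ _ (\int[P0]_(w in N) expeR ((- s)%:E * X Q w))); last first.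
  apply: ge0_subset_integral => // w _; exact: expeR_ge0.
rewrite (eq_integral (cst +oo)); last first.
  move=> w; rewrite inE => /= Nw.
  rewrite /X /logmean le0_lneNy // mulrNy.
  by rewrite ltr0_sg ?oppr_lt0 // mulN1e.
by rewrite integral_cst // gt0_mulye.
Qed.

(** Strict inequalities become uniform by countable exhaustion, three times: for the mean together
    with [Q(0)], for the choice of [j], and for the size of [Q(j)]. *)
Lemma bad_environment :
  (exists s : R, (0 < s)%R /\ mgf_X P0 Q (- s)%R < +oo) ->
  0 < P0 [set w | X Q w < 0] ->
  exists (B : set Omega0) (j : nat) (e rho : R), [/\ measurable B, 0 < P0 B,
    (0 < j)%N, (0 < e < 1)%R /\ (0 < rho < 1)%R & forall w, B w -> [/\ mean (Q w) <= rho%:E,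
      e%:E <= pmf (Q w) 0%N & e%:E <= pmf (Q w) j]].
Proof.
move=> hexp Xneg; have N0 := mean_gt0_ae hexp.
have mX : measurable_fun setT (fun w => mean (Q w)).
  exact: (measurableT_comp measurable_mean (measurable_funPT Q)).
have mp k : measurable_fun setT (fun w => pmf (Q w) k).
  exact: (measurableT_comp (measurable_pmf k) (measurable_funPT Q)).
have mean_ge0 w : 0 <= mean (Q w).
  by apply: nneseries_ge0 => k _ _; rewrite mule_ge0 ?measure_ge0 // lee_fin.
set N := [set w | mean (Q w) <= 0] in N0.
have mN : measurable N by rewrite -[N]setTI; exact: emeasurable_fun_infty_c.
pose D n := [set w | mean (Q w) <= (1 - n.+2%:R^-1)%:E] `&`
   ([set w | n.+2%:R^-1%:E <= pmf (Q w) 0%N] `&` ~` N).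
have mD n : measurable (D n).
  apply: measurableI; last apply: measurableI; last exact: measurableC.
    by rewrite -[X in measurable X]setTI; exact: emeasurable_fun_infty_c.
  by rewrite -[X in measurable X]setTI; exact: emeasurable_fun_c_infty.
have [n Dn] : exists n, 0 < P0 (D n).
  apply: measure_bigcup_gt0 => //; apply: (lt_le_trans Xneg).
  have mneg : measurable [set w | X Q w < 0].
    rewrite -[X in measurable X]setTI; apply: emeasurable_fun_infty_o => //.
    exact: (measurableT_comp measurable_lne).
  apply: (@le_trans _ _ (P0 ([set w | X Q w < 0] `\` N))).
    rewrite [leLHS](measureDI _ mneg mN) -[leRHS]adde0 leeD2l //.
    apply: (@le_trans _ _ (P0 N)); last by rewrite N0.
    by apply: le_measure; rewrite ?inE //; exact: measurableI.
  apply: le_measure; rewrite ?inE //; first exact: measurableD.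
    exact: bigcup_measurable.
  move=> w [/=]; rewrite /X /logmean lne_lt0 => m1 /negP.
  rewrite /N /= -ltNge => m0.
  have mfin : mean (Q w) \is a fin_num by rewrite ge0_fin_numE // (lt_trans m1) // ltry.
  have mE : mean (Q w) = (fine (mean (Q w)))%:E by rewrite fineK.
  move: m1; rewrite mE lte_fin -subr_gt0 => /ltr_add_invr[n]; rewrite add0r => nm.
  have nn : (n.+2%:R^-1 <= 1 - fine (mean (Q w)))%R.
    by apply: le_trans (ltW nm); rewrite lef_pV2 ?posrE // ler_nat.
  exists n => //; split; last split => //=; last by apply/negP; rewrite -ltNge.
    by rewrite /= mE lee_fin lerBrDr addrC -lerBrDr.
  (* At [s = 0] the generating function is [Q(0)], so a mean below 1 gives [Q(0) >= 1 - mean]. *)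
  have := @gf_ge_mean (Q w) (fine (mean (Q w))) 0; rewrite (fineK mfin).
  have c01 : (0 <= (0 : R) <= 1)%R by rewrite lexx ler01.
  move=> /(_ (lexx _) c01); rewrite subr0 mulr1 => gf0.
  apply: le_trans (_ : (1 - fine (mean (Q w)))%:E <= _); first by rewrite lee_fin.
  apply: (le_trans gf0); rewrite /gf nneseries_recl //; last first.
    by move=> k _; rewrite mule_ge0 ?measure_ge0 // lee_fin exprn_ge0.
  by rewrite expr0 mule1 eseries0 ?adde0 // => -[//|k] _ _; rewrite expr0n mule0.
pose C k := D n `&` [set w | 0 < pmf (Q w) k.+1].
have mC k : measurable (C k).
  by rewrite /C -[X in _ `&` X]setTI; apply: measurableI => //; exact: emeasurable_fun_o_infty.
(* On [D n] the mean is positive, so some [Q(k + 1)] is positive too. *)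
have [k Ck] : exists k, 0 < P0 (C k).
  apply: measure_bigcup_gt0 => //; apply: (lt_le_trans Dn).
  apply: le_measure; rewrite ?inE //; first exact: bigcup_measurable.
  move=> w Dw; apply: contrapT => H.
  have pk0 k : pmf (Q w) k.+1 = 0.
    apply/eqP; rewrite eq_le measure_ge0 andbT leNgt; apply/negP => pk.
    by apply: H; exists k.
  case: Dw => _ [_] []; rewrite /N /= /mean eseries0 // => -[|i] _ _.
    by rewrite mul0e.
  by rewrite pk0 mule0.
pose F l := C k `&` [set w | (n + l).+2%:R^-1%:E <= pmf (Q w) k.+1].
have mF l : measurable (F l).
  by rewrite /F -[X in _ `&` X]setTI; apply: measurableI => //; exact: emeasurable_fun_c_infty.
have [l Fl] : exists l, 0 < P0 (F l).
  apply: measure_bigcup_gt0 => //; apply: (lt_le_trans Ck).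
  apply: le_measure; rewrite ?inE //; first exact: bigcup_measurable.
  move=> w [Dw pk]; have pfin := @pmf_fin _ (Q w) k.+1.
  move: (pk); rewrite /= -(fineK pfin) lte_fin => /ltr_add_invr[l]; rewrite add0r => pl.
  exists l => //; split => //=; rewrite -(fineK pfin) lee_fin.
  by apply: le_trans (ltW pl); rewrite lef_pV2 ?posrE // ler_nat ltnS leqW // leq_addl.
have inv01 m : (0 < (m.+2%:R^-1 : R) < 1)%R.
  by rewrite invr_gt0 ltr0n invf_lt1 ?ltr1n.
exists (F l), k.+1, (n + l).+2%:R^-1%R, (1 - n.+2%:R^-1)%R; split => //.
- split; first exact: inv01.
  by have /andP[i0 i1] := inv01 n; rewrite subr_gt0 i1 gtrBl.
- move=> w [[[mw [p0 _]] _] pk]; split => //.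
  by apply: le_trans p0; rewrite lee_fin lef_pV2 ?posrE // ler_nat !ltnS leq_addr.
Qed.

Context (B : set Omega0) (j : nat) (e rho : R).
Hypotheses (mB : measurable B) (B0 : 0 < P0 B) (j0 : (0 < j)%N).
Hypotheses (e01 : (0 < e < 1)%R) (rho01 : (0 < rho < 1)%R).
Hypothesis HB : forall w, B w -> [/\ mean (Q w) <= rho%:E,
      e%:E <= pmf (Q w) 0%N & e%:E <= pmf (Q w) j].

Let b : R := fine (P0 B).

Let bE : P0 B = b%:E.
Proof. by rewrite /b fineK // fin_num_measure. Qed.

Let b_gt0 : (0 < b)%R.
Proof. by rewrite -lte_fin -bE. Qed.

Lemma pop_descent z : (b * (z%:R * e ^+ z))%:E <= pop P0 Q setT (ind (pred1 j)) z.
Proof.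
have [e0 e1] := andP e01.
apply: (@le_trans _ _ (pop P0 Q B (ind (pred1 j)) z)); last first.
  by apply: pop_subset => // k; exact: ind_ge0.
rewrite EFinM muleC -bE; apply: pop_ge_cst => //; first by move=> k; exact: ind_ge0.
  by rewrite mulr_ge0 // exprn_ge0 // ltW.
by move=> w /HB[_ e0' ej]; rewrite csum_ind1 conv_pow_ge // ltW.
Qed.

Let G (s : R) k : \bar R := (k%:R * s ^+ k.-1)%:E.

(** The loss per generation: the probability of [B] times a lower bound of [f'(s)] for [s >= e],
    keeping only the term of index [j]. *)
Let kappa : R := (b * (e * e ^+ j.-1))%R.

Let kappa_gt0 : (0 < kappa)%R.
Proof. by have [e0 _] := andP e01; rewrite !mulr_gt0 // exprn_gt0. Qed.

(** [csum_deriv_ge] on the environments in [B], whose generating functions satisfy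
    [f(s) >= 1 - rho (1 - s)]. The condition [e <= s] keeps [f'(s)] bounded below, and it is
    preserved by the step. *)
Let pop_G s z : (e <= s <= 1)%R ->
  kappa%:E * G (1 - rho * (1 - s)) z <= pop P0 Q setT (G s) z.
Proof.
move=> /andP[es s1]; have [e0 e1] := andP e01; have [r0 r1] := andP rho01.
have s0 : (0 <= s)%R by lra.
have G0 k : 0 <= G s k by rewrite /G lee_fin mulr_ge0 ?exprn_ge0.
apply: (@le_trans _ _ (pop P0 Q B (G s) z)); last exact: pop_subset.
have t0 : (0 <= 1 - rho * (1 - s))%R by nra.
have -> : kappa%:E * G (1 - rho * (1 - s)) z =
    (z%:R * (e * e ^+ j.-1) * (1 - rho * (1 - s)) ^+ z.-1)%:E * P0 B.
  by rewrite bE -!EFinM /kappa; congr EFin; ring.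
have c0 : (0 <= e * e ^+ j.-1)%R by rewrite mulr_ge0 ?exprn_ge0 // ltW.
apply: pop_ge_cst => //; first by rewrite !mulr_ge0 ?exprn_ge0 // ltW.
move=> w /HB[mw e0' ej]; apply: csum_deriv_ge => //.
  by apply: gf_ge_mean => //; rewrite s0.
apply: (@le_trans _ _ (pmf (Q w) j * (j%:R * s ^+ j.-1)%:E)).
  rewrite EFinM; apply: lee_pmul => //; rewrite lee_fin ?exprn_ge0 ?(ltW e0) //.
  apply: (@le_trans _ _ (s ^+ j.-1)%R); first by rewrite lerXn2r // nnegrE // ltW.
  by rewrite ler_peMl ?exprn_ge0 // ler1n.
rewrite (@nneseriesD1 _ _ j xpredT) //=; last first.
  by move=> k _; rewrite mule_ge0 ?measure_ge0 //; exact: G0.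
rewrite leeDl //; apply: nneseries_ge0 => k _ _.
by rewrite mule_ge0 ?measure_ge0 //; exact: G0.
Qed.

(** The last generation contributes the function [z e^z], which is [e * G e]. The preceding [l]
    generations replace [e] by [1 - rho^l (1 - e)], and Bernoulli's inequality bounds the resulting
    power by [1 - z rho^l]. *)
Lemma popn_descent l z : (0 < z)%N ->
  (b * e * kappa ^+ l * (1 - z%:R * rho ^+ l))%:E <=
  popn P0 Q l.+1 (ind (pred1 j)) z.
Proof.
move=> z0; have [e0 e1] := andP e01; have [r0 r1] := andP rho01.
have rl l' : (0 <= rho ^+ l' <= 1)%R.
  by rewrite exprn_ge0 ?exprn_ile1 ?(ltW r0) ?(ltW r1).
have G0 s k : (0 <= s)%R -> 0 <= G s k.
  by move=> s0; rewrite /G lee_fin mulr_ge0 ?exprn_ge0.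
have H l' z' : (kappa ^+ l')%:E * G (1 - rho ^+ l' * (1 - e)) z' <= popn P0 Q l' (G e) z'.
  elim: l' z' => [|l' IH] z'.
    by rewrite !expr0 mul1e mul1r /G (_ : 1 - (1 - e) = e)%R //; ring.
  have t0 : (e <= 1 - rho ^+ l' * (1 - e) <= 1)%R by have := rl l'; nra.
  rewrite popnS; apply: (@le_trans _ _ (pop P0 Q setT (fun k =>
    (kappa ^+ l')%:E * G (1 - rho ^+ l' * (1 - e)) k) z')); last first.
    apply: le_pop => // k; rewrite mule_ge0 ?lee_fin ?exprn_ge0 ?(ltW kappa_gt0) //.
    by apply: G0; lra.
  rewrite popZ //; last 2 first.
  - by rewrite exprn_ge0 // ltW.
  - by move=> k; apply: G0; lra.
  rewrite exprSr EFinM -muleA lee_wpmul2l ?lee_fin ?exprn_ge0 ?(ltW kappa_gt0) //.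
  have -> : (1 - rho ^+ l'.+1 * (1 - e) = 1 - rho * (1 - (1 - rho ^+ l' * (1 - e))))%R.
    by rewrite exprS; ring.
  exact: pop_G.
apply: (@le_trans _ _ (popn P0 Q l (fun k => (b * e)%:E * G e k) z)); last first.
  rewrite -addn1 popnD; apply: le_popn => k.
    by rewrite mule_ge0 ?G0 ?(ltW e0) // lee_fin mulr_ge0 // ltW.
  apply: le_trans (pop_descent k).
  rewrite /G -EFinM lee_fin -mulrA ler_wpM2l ?(ltW b_gt0) // mulrCA.
  by case: k => [|k]; rewrite ?mul0r // exprS.
rewrite popnZ; last 2 first.
- by rewrite mulr_ge0 // ltW.
- by move=> k; apply: G0; exact: ltW.
rewrite -mulrA EFinM lee_wpmul2l ?lee_fin ?mulr_ge0 ?(ltW e0) ?(ltW b_gt0) //.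
apply: le_trans (H _ _).
rewrite EFinM lee_wpmul2l ?lee_fin ?exprn_ge0 ?(ltW kappa_gt0) // /G.
set x := (rho ^+ l)%R; have := rl l; rewrite -/x => /andP[x0 x1].
have b1 := @bernoulli_ge _ (x * (1 - e))%R z.-1.
have /b1 {}b1 : (0 <= x * (1 - e) <= 1)%R by nra.
apply: (@le_trans _ _ ((1 - x * (1 - e)) ^+ z.-1)%R); last first.
  by rewrite ler_peMl ?exprn_ge0 ?ler1n // subr_ge0; nra.
apply: le_trans b1.
have zz : (z.-1%:R + 1 = z%:R :> R)%R by rewrite natr1 prednK.
have z1 : (0 <= z.-1%:R :> R)%R by [].
have : (z.-1%:R * (x * (1 - e)) <= z%:R * x)%R; last by lra.
rewrite -zz; have : (0 <= z.-1%:R * (x * e))%R by rewrite !mulr_ge0 // ltW.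
by lra.
Qed.

End Descent.


(** * Subadditive sequences and logarithmic rates *)

Section RealSequences.
Context {R : realType}.

(** The limit is the infimum of [u n / n], hence the lower bound [r n <= u n] holds for every [n]
    without error. This is what later gives a multiplicative constant, rather than a subexponential
    factor, in the upper bounds. *)
Lemma fekete (u : nat -> R) : u 0%N = 0%R -> (forall n, 0 <= u n)%R ->
  (forall n m, u (n + m)%N <= u n + u m)%R ->
  exists r : R, [/\ (0 <= r)%R, forall n, (r * n%:R <= u n)%R &
   forall eps : R, (0 < eps)%R -> exists N, forall n, (N <= n)%N ->
     (u n <= (r + eps) * n%:R)%R].
Proof.
move=> u00 u0 uD.
pose S := [set (u n.+1 / n.+1%:R)%R | n in setT].
have S0 : S !=set0 by exists (u 1%N / 1%R)%R; exists 0%N.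
have lbS : lbound S 0%R by move=> _ [n _ <-]; rewrite divr_ge0.
have infS : has_inf S by split => //; exists 0%R.
have r0 : (0 <= inf S)%R by exact: lb_le_inf.
exists (inf S); split => //.
  move=> [|n]; first by rewrite mulr0.
  rewrite -ler_pdivlMr //; apply: (inf_lbound infS.2); first by exists n.
move=> eps e0; have e20 : (0 < eps / 2)%R by rewrite divr_gt0.
have [_ [m _ <-] um] := @inf_adherent _ S _ e20 infS.
have uq q k : (u (q * k)%N <= q%:R * u k)%R.
  elim: q => [|q IH]; first by rewrite mul0n mul0r u00.
  rewrite mulSn; apply: (le_trans (uD _ _)).
  by rewrite -natr1 mulrDl mul1r addrC lerD2r.
(* From [N] on, the remainder of the division by [m + 1] costs at most [eps / 2] per unit of
   time. *)
have [N HN] : exists N : nat, (m.+1%:R * u 1%N <= eps / 2 * N%:R)%R.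
  exists (Num.bound (m.+1%:R * u 1%N / (eps / 2)))%R.
  rewrite [leRHS]mulrC -ler_pdivrMr //; apply/ltW/archi_boundP.
  by rewrite divr_ge0 ?mulr_ge0 // ltW.
exists N => n Nn; rewrite (divn_eq n m.+1).
set q := (n %/ m.+1)%N; set s := (n %% m.+1)%N.
have sm : (s <= m.+1)%N by rewrite ltnW // ltn_mod.
apply: (le_trans (uD _ _)).
have h1 : (u (q * m.+1)%N <= (inf S + eps / 2) * (q * m.+1)%:R)%R.
  apply: (le_trans (uq _ _)); rewrite natrM [leRHS]mulrC -mulrA.
  by rewrite ler_wpM2l // mulrC -ler_pdivrMr // ltW.
have h2 : (u s <= eps / 2 * n%:R)%R.
  rewrite -[s]muln1; apply: (le_trans (uq _ _)).
  apply: (@le_trans _ _ (m.+1%:R * u 1%N)%R); first by rewrite ler_wpM2r // ler_nat.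
  by apply: (le_trans HN); rewrite ler_wpM2l ?ler_nat // ltW.
have h3 : ((inf S + eps / 2) * (q * m.+1)%:R <= (inf S + eps / 2) * n%:R)%R.
  by rewrite ler_wpM2l ?ler_nat ?leq_trunc_div //; lra.
rewrite -divn_eq; lra.
Qed.

Lemma cvg_log_rate (a : nat -> \bar R) (r : R) :
  (forall eps : R, (0 < eps)%R -> \forall n \near \oo,
     (expR (- (r + eps) * n%:R))%:E <= a n <= (expR (- (r - eps) * n%:R))%:E) ->
  (n%:R^-1)%:E * lne (a n) @[n --> \oo] --> (- r)%:E.
Proof.
move=> H.
pose x n : R := fine ((n%:R^-1)%:E * lne (a n)).
have Hx eps : (0 < eps)%R -> \forall n \near \oo,
    (n%:R^-1)%:E * lne (a n) = (x n)%:E /\ (`|- r - x n| <= eps)%R.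
  move=> e0; near=> n.
  have n0 : (0 < n%:R :> R)%R by rewrite ltr0n; near: n; exact: nbhs_infty_gt.
  have /andP[l1 l2] : (expR (- (r + eps) * n%:R))%:E <= a n <= (expR (- (r - eps) * n%:R))%:E.
    by near: n; exact: H.
  have afin : a n \is a fin_num.
    by rewrite fin_numE; case: (a n) l1 l2.
  move: l1 l2; rewrite /x -(fineK afin); set y := fine (a n) => l1 l2.
  have y0 : (0 < y)%R by rewrite -lte_fin (lt_le_trans _ l1) // lte_fin expR_gt0.
  rewrite lne_EFin // -EFinM; split => //=.
  rewrite !lee_fin in l1 l2.
  have k1 : (- (r + eps) * n%:R <= ln y)%R by rewrite -ler_expR lnK.
  have k2 : (ln y <= - (r - eps) * n%:R)%R by rewrite -ler_expR lnK.
  have k3 : (- (r + eps) <= n%:R^-1 * ln y)%R by rewrite ler_pdivlMl // mulrC.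
  have k4 : (n%:R^-1 * ln y <= - (r - eps))%R by rewrite ler_pdivrMl // mulrC.
  by rewrite ler_norml; apply/andP; split; lra.
apply/fine_cvgP; split.
  by near=> n; have [|-> _] := near (Hx 1%R ltr01) n.
apply/cvgrPdist_le => eps e0; near=> n.
by have [|_] := near (Hx eps e0) n.
Unshelve. all: by end_near. Qed.

End RealSequences.


(** * The rate varrho and small values *)

Lemma near_le_expR {R : realType} (c eps : R) : (0 < eps)%R ->
  \forall n \near \oo, (c <= expR (eps * n%:R))%R.
Proof.
move=> e0; near=> n.
apply: le_trans (expR_ge1Dx _).
have : (c / eps <= n%:R)%R by near: n; exact: nbhs_infty_ger.
by rewrite ler_pdivrMr // mulrC; lra.
Unshelve. all: by end_near. Qed.

Lemma split_steps N n n2 : (N + (1 + n2) <= n)%N ->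
  exists m, [/\ n = (1 + (m + n2))%N, (N <= m)%N & (m <= n)%N].
Proof. by move=> H; exists (n - (1 + n2))%N; split; lia. Qed.

Section Rate.
Context {R : realType} {d0 d : measure_display} {Omega0 : measurableType d0}.
Context (P0 : probability Omega0 R) (Q : {mfun Omega0 >-> offspring_law R}).
Context {Omega : measurableType d} (E : nat -> {mfun Omega >-> offspring_law R}).
Context (Z : nat -> {mfun Omega >-> nat}) (PP : nat -> probability Omega R).
Hypothesis hbpre : bpre_family P0 Q E Z PP.
Hypothesis hexp : exists s : R, (0 < s)%R /\ mgf_X P0 Q (- s)%R < +oo.
Hypothesis hneg : 0 < P0 [set w | X Q w < 0].

Lemma PP_popn n (A : pred nat) i :
  PP i [set w | A (Z n w)] = popn P0 Q n (ind A) i.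
Proof. by have [H1 H2] := hbpre i; exact: (prob_popn H1 n A H2). Qed.

Lemma PP_popn1 n i j : PP i [set w | Z n w = j] = popn P0 Q n (ind (pred1 j)) i.
Proof.
rewrite -PP_popn; congr (PP i _).
by apply/seteqP; split => w /= /eqP.
Qed.

Lemma popn_ind_fin n A i : popn P0 Q n (ind A) i \is a fin_num.
Proof.
rewrite ge0_fin_numE; first exact: le_lt_trans (popn_ind_le1 _ _ _ _ _) (ltry _).
by apply: popn_ge0; exact: ind_ge0.
Qed.

Lemma popn_chain n m A l k :
  popn P0 Q n (ind (pred1 l)) k * popn P0 Q m (ind A) l <=
  popn P0 Q (n + m) (ind A) k.
Proof.
have c0 : (0 <= fine (popn P0 Q m (ind A) l))%R.
  by rewrite fine_ge0 // popn_ge0 // => *; exact: ind_ge0.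
rewrite popnD -(fineK (popn_ind_fin m A l)) muleC -popnZ //; last exact: ind_ge0.
apply: le_popn => z; first by rewrite mule_ge0 ?ind_ge0.
rewrite /ind /=; case: eqP => [->|_]; first by rewrite mule1 fineK // popn_ind_fin.
by rewrite mule0 popn_ge0 // => *; exact: ind_ge0.
Qed.

(** In an environment with [Q(i) > 0] and [Q(0) > 0], one individual has [i] children and the others
    have none. So every positive population reaches [i] in a single step. *)
Lemma indexI_reachable i z : indexI P0 Q i -> (0 < z)%N ->
  0 < popn P0 Q 1 (ind (pred1 i)) z.
Proof.
move=> [i0 Pi]; case: z => // z _.
have mp k : measurable_fun setT (fun w => pmf (Q w) k).
  exact: (measurableT_comp (measurable_pmf k) (measurable_funPT Q)).
set B := [set w | _] in Pi.
have mB : measurable B.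
  rewrite (_ : B = [set w | 0 < pmf (Q w) i] `&` [set w | 0 < pmf (Q w) 0%N]) //.
  by apply: measurableI; rewrite -[X in measurable X]setTI; exact: emeasurable_fun_o_infty.
apply: (@lt_le_trans _ _ (pop P0 Q B (ind (pred1 i)) z.+1)); last first.
  by apply: pop_subset => //; exact: ind_ge0.
apply: integral_gt0 => //; first by apply: measurable_csumQ; exact: ind_ge0.
move=> w [pi p0]; rewrite csum_ind1; apply: lt_le_trans (conv_pow_ge1 _ _ _) => //.
by rewrite mule_gt0 // expe_gt0.
Qed.

Lemma ClI_reachable k z : ClI P0 Q Z PP k -> (0 < z)%N ->
  exists n, 0 < popn P0 Q n (ind (pred1 k)) z.
Proof.
move=> [k0 [n [j [Ij]]]]; rewrite PP_popn1 => Pn z0.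
exists (1 + n)%N; apply: lt_le_trans (popn_chain _ _ _ j _).
by rewrite mule_gt0 //; exact: indexI_reachable.
Qed.

Lemma indexI_ClI j : indexI P0 Q j -> ClI P0 Q Z PP j.
Proof.
move=> Ij; split; first exact: Ij.1.
by exists 0%N, j; split => //; have [_ ->] := hbpre j.
Qed.

Lemma bad_environment_indexI (B : set Omega0) j (e rho : R) : measurable B ->
  0 < P0 B -> (0 < j)%N -> (0 < e < 1)%R ->
  (forall w, B w -> [/\ mean (Q w) <= rho%:E,
      e%:E <= pmf (Q w) 0%N & e%:E <= pmf (Q w) j]) -> indexI P0 Q j.
Proof.
move=> mB B0 j_gt0 e01 HB; split => //; apply: (lt_le_trans B0).
have mp k : measurable_fun setT (fun w => pmf (Q w) k).
  exact: (measurableT_comp (measurable_pmf k) (measurable_funPT Q)).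
apply: le_measure; rewrite ?inE //.
  rewrite -[X in measurable X]setTI; apply: measurableI => //.
  by apply: measurableI; rewrite -[X in measurable X]setTI; exact: emeasurable_fun_o_infty.
move=> w /HB[_ p0 pj]; have [e0 _] := andP e01.
by split; [apply: lt_le_trans pj|apply: lt_le_trans p0]; rewrite lte_fin.
Qed.

(** The return probabilities to the [j0] of a bad environment are supermultiplicative, so Fekete's
    lemma applies to minus their logarithms. Other pairs of states are compared with [j0] through
    connecting paths of fixed length and positive probability. *)
Lemma rate_exists : exists r : R, is_varrho P0 Q Z PP r /\
  forall k j, ClI P0 Q Z PP k -> ClI P0 Q Z PP j ->
  (exists C : R, (0 < C)%R /\ forall n,
    popn P0 Q n (ind (pred1 j)) k <= (C * expR (- r * n%:R))%:E) /\
  (forall eps : R, (0 < eps)%R -> \forall n \near \oo,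
    (expR (- (r + eps) * n%:R))%:E <= popn P0 Q n (ind (pred1 j)) k).
Proof.
have [B [j0 [e [rho [mB B0 j0_gt0 [e01 rho01] HB]]]]] := bad_environment hexp hneg.
have Ij0 := bad_environment_indexI mB B0 j0_gt0 e01 HB.
have Cj0 := indexI_ClI Ij0.
pose a n : R := fine (popn P0 Q n (ind (pred1 j0)) j0).
have aE n : popn P0 Q n (ind (pred1 j0)) j0 = (a n)%:E.
  by rewrite /a fineK // popn_ind_fin.
have aM n m : (a n * a m <= a (n + m)%N)%R.
  by rewrite -lee_fin EFinM -!aE popn_chain.
have a0 : a 0%N = 1%R by rewrite /a /popn /= /ind /= eqxx.
have a_gt0 n : (0 < a n)%R.
  elim: n => [|n IH]; first by rewrite a0.
  rewrite -addn1; apply: lt_le_trans (aM n 1%N); rewrite mulr_gt0 //.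
  by rewrite -lte_fin -aE indexI_reachable.
have a_le1 n : (a n <= 1)%R by rewrite -lee_fin -aE popn_ind_le1.
have [||n m|r [r0 rle req]] := @fekete R (fun n => - ln (a n))%R.
- by rewrite a0 ln1 oppr0.
- by move=> n; rewrite oppr_ge0 ln_le0.
- by rewrite -opprD lerN2 -lnM ?posrE // ler_ln ?posrE // mulr_gt0.
have aU n : (a n <= expR (- r * n%:R))%R.
  by rewrite mulNr -[leLHS](lnK (a_gt0 n)) ler_expR -lerN2 opprK.
have pos n k j (H : 0 < popn P0 Q n (ind (pred1 j)) k) :
    exists2 c : R, (0 < c)%R & popn P0 Q n (ind (pred1 j)) k = c%:E.
  exists (fine (popn P0 Q n (ind (pred1 j)) k)); last by rewrite fineK // popn_ind_fin.
  by rewrite -lte_fin fineK // popn_ind_fin.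
(* A passage from [k] to [j] is completed into a loop at [j0]: [n1] steps from [j0] to [k] before it
   and one step from [j] to [j0] after it. *)
have upper k j : ClI P0 Q Z PP k -> ClI P0 Q Z PP j ->
    exists C : R, (0 < C)%R /\ forall n,
    popn P0 Q n (ind (pred1 j)) k <= (C * expR (- r * n%:R))%:E.
  move=> Ck [j1 _].
  have [n1 /pos[c1 c10 c1E]] := ClI_reachable Ck j0_gt0.
  have [c2 c20 c2E] := pos _ _ _ (indexI_reachable Ij0 j1).
  exists ((c1 * c2)^-1)%R; split; first by rewrite invr_gt0 mulr_gt0.
  move=> n; rewrite -(fineK (popn_ind_fin n (pred1 j) k)).
  set x := fine _; rewrite lee_fin ler_pdivlMl ?mulr_gt0 //.
  have x0 : (0 <= x)%R by rewrite fine_ge0 // popn_ge0 // => *; exact: ind_ge0.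
  have : (c1 * (x * c2) <= a (n1 + (n + 1))%N)%R.
    rewrite -lee_fin -aE; apply: le_trans (popn_chain _ _ _ k _).
    rewrite EFinM c1E lee_wpmul2l ?lee_fin ?(ltW c10) //.
    apply: le_trans (popn_chain _ _ _ j _).
    by rewrite EFinM c2E /x fineK // popn_ind_fin.
  move=> /le_trans/(_ (aU _)) H.
  have : (expR (- r * (n1 + (n + 1))%:R) <= expR (- r * n%:R))%R.
    by rewrite ler_expR !mulNr lerN2 ler_wpM2l // ler_nat (leq_trans (leq_addr 1 n)) // leq_addl.
  by move: H; lra.
(* One step from [k] to [j0], then [m] steps of return to [j0], then [n2] steps from [j0] to [j];
   [eps / 2] absorbs the two fixed costs. *)
have lower k j : ClI P0 Q Z PP k -> ClI P0 Q Z PP j ->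
    forall eps : R, (0 < eps)%R -> \forall n \near \oo,
    (expR (- (r + eps) * n%:R))%:E <= popn P0 Q n (ind (pred1 j)) k.
  move=> Ck Cj eps e0; have e20 : (0 < eps / 2)%R by rewrite divr_gt0.
  have [n2 /pos[c4 c40 c4E]] := ClI_reachable Cj j0_gt0.
  have [c3 c30 c3E] := pos _ _ _ (indexI_reachable Ij0 (proj1 Ck)).
  have [N HN] := req _ e20.
  near=> n.
  have cc : ((c3 * c4)^-1 <= expR (eps / 2 * n%:R))%R by near: n; exact: near_le_expR.
  have nN : (N + (1 + n2) <= n)%N by near: n; exact: nbhs_infty_ge.
  have [m [nE mN mn]] := split_steps nN; rewrite [X in popn _ _ X]nE.
  apply: le_trans (popn_chain _ _ _ j0 _).
  apply: (@le_trans _ _ (c3%:E * ((a m)%:E * c4%:E))); last first.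
    rewrite c3E lee_wpmul2l ?lee_fin ?(ltW c30) // -aE -c4E.
    exact: popn_chain.
  rewrite -!EFinM lee_fin.
  have am : (expR (- (r + eps / 2) * n%:R) <= a m)%R.
    rewrite -[leRHS](lnK (a_gt0 m)) ler_expR mulNr lerNl.
    apply: (le_trans (HN m mN)); apply: ler_wpM2l; first by lra.
    by rewrite ler_nat.
  have -> : (- (r + eps) * n%:R = - (eps / 2 * n%:R) + - (r + eps / 2) * n%:R)%R by field.
  rewrite expRD expRN.
  have cc' : ((expR (eps / 2 * n%:R))^-1 <= c3 * c4)%R.
    by rewrite invf_ple ?posrE ?expR_gt0 // mulr_gt0.
  apply: (@le_trans _ _ (c3 * c4 * a m)%R); last by rewrite mulrCA mulrA mulrC; lra.
  by apply: ler_pM => //; rewrite ?invr_ge0 expR_ge0.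
exists r; split => [|k j Ck Cj]; last by split; [exact: upper|exact: lower].
split => // k j Ck Cj; have [C [C0 HC]] := upper k j Ck Cj.
rewrite -[r%:E]oppeK; apply: cvgeN.
rewrite (_ : (fun _ => _) = (fun n => (n%:R^-1)%:E * lne (popn P0 Q n (ind (pred1 j)) k))); last first.
  by apply/funext => n; rewrite PP_popn1.
apply: cvg_log_rate => eps e0; near=> n; apply/andP; split.
  by near: n; exact: lower.
apply: (le_trans (HC n)); rewrite lee_fin.
have : (C <= expR (eps * n%:R))%R by near: n; exact: near_le_expR.
have -> : (- (r - eps) * n%:R = eps * n%:R + - r * n%:R)%R by ring.
by rewrite expRD => CC; rewrite ler_wpM2r ?expR_ge0.
Unshelve. all: by end_near. Qed.

(** Existence of a rate gives [xget] its specification, and uniqueness of limits identifies the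
    chosen number with the rate that carries the quantitative bounds. *)
Lemma varrho_rate : is_varrho P0 Q Z PP (varrho P0 Q Z PP) /\
  forall k j, ClI P0 Q Z PP k -> ClI P0 Q Z PP j ->
  (exists C : R, (0 < C)%R /\ forall n,
    popn P0 Q n (ind (pred1 j)) k <= (C * expR (- varrho P0 Q Z PP * n%:R))%:E) /\
  (forall eps : R, (0 < eps)%R -> \forall n \near \oo,
    (expR (- (varrho P0 Q Z PP + eps) * n%:R))%:E <= popn P0 Q n (ind (pred1 j)) k).
Proof.
have [r [Hr HU]] := rate_exists.
have Hv : is_varrho P0 Q Z PP (varrho P0 Q Z PP) by exact: (xgetPex 0%R (ex_intro _ r Hr)).
split => // k j Ck Cj.
have -> : varrho P0 Q Z PP = r; last exact: HU.
apply: EFin_inj.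
exact: (cvg_unique (@ereal_hausdorff R) (Hv.2 _ _ Ck Ck) (Hr.2 _ _ Ck Ck)).
Qed.

(* A population [z <= a] can be brought down to a fixed size in [O(ln a)]
   generations at a cost which is polynomial in [a]; from there, returning to a
   given state after [n] generations costs [exp (- varrho n)]. *)
Lemma small_values i : ClI P0 Q Z PP i -> exists C : R, (0 <= C)%R /\
  forall n (a : R), (1 <= a)%R ->
    popn P0 Q n (ind (fun k => (0 < k)%N && (k%:R <= a)%R)) i <=
    (C * expR (C * ln a) * expR (- varrho P0 Q Z PP * n%:R))%:E.
Proof.
move=> Ci.
have [B [j0 [e [rho [mB B0 j0_gt0 [e01 rho01] HB]]]]] := bad_environment hexp hneg.
have Cj0 := indexI_ClI (bad_environment_indexI mB B0 j0_gt0 e01 HB).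
have [[r0 _] /(_ _ _ Ci Cj0)[[C [C0 HC]] _]] := varrho_rate.
have := @popn_descent _ _ _ P0 Q B j0 e rho mB B0 j0_gt0 e01 rho01 HB.
set b := fine (P0 B); set kappa := (b * (e * _))%R => desc.
have [e0 e1] := andP e01; have [rho0 rho1] := andP rho01.
have b0 : (0 < b)%R by rewrite -lte_fin /b fineK // fin_num_measure.
have k0 : (0 < kappa)%R by rewrite !mulr_gt0 // exprn_gt0.
set r := varrho P0 Q Z PP in r0 HC *.
pose D := (- ln rho)%R; have D0 : (0 < D)%R by rewrite oppr_gt0 ln_lt0 // rho0 rho1.
pose K : R := `|ln kappa|%R.
(* The part of the cost independent of [a]: [1 / 2] bounds [1 - z rho^l] from below, and the
   exponential comes from [l <= ln (2 a) / D + 1]. *)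
pose c2 := (b * e / 2 * expR (- (K * (ln 2 / D + 1))))%R.
have c20 : (0 < c2)%R by rewrite !mulr_gt0 ?expR_gt0 ?invr_gt0.
have K0 : (0 <= K)%R by rewrite /K normr_ge0.
(* [l] is chosen with [rho^l <= 1 / (2 a)]. It depends on [a] only, so the same number of
   generations serves all populations up to [a]. *)
have fast (a : R) : (1 <= a)%R -> exists l, forall z, (0 < z)%N -> (z%:R <= a)%R ->
    (c2 * expR (- (K / D * ln a)))%:E <= popn P0 Q l.+1 (ind (pred1 j0)) z.
  move=> a1; have a0 : (0 < a)%R by lra.
  have a2 : (1 <= 2 * a)%R by lra.
  have x0 : (0 <= ln (2 * a) / D)%R by rewrite divr_ge0 ?(ltW D0) // ln_ge0.
  have [l lx xl] : exists2 l : nat, (ln (2 * a) / D < l%:R)%R &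
      (l%:R <= ln (2 * a) / D + 1)%R.
    exists (Num.truncn (ln (2 * a) / D)%R).+1; have /andP[h1 h2] := truncn_itv x0 => //.
    by rewrite -natr1 lerD2r.
  exists l => z z0 za; apply: le_trans (desc l z z0); rewrite lee_fin.
  have rl : (rho ^+ l <= (2 * a)^-1)%R.
    have p2 : (2 * a \is Num.pos)%R by rewrite posrE; lra.
    rewrite -[leLHS]lnK ?posrE ?exprn_gt0 // -[leRHS]lnK ?posrE ?invr_gt0 -?posrE //.
    rewrite ler_expR lnXn // lnV // -[leLHS]mulr_natl lerNr.
    have -> : (- (l%:R * ln rho) = D * l%:R)%R by rewrite /D; ring.
    by rewrite -ler_pdivrMl // mulrC; exact: (ltW lx).
  have kl : (expR (- (K * (ln (2 * a) / D + 1))) <= kappa ^+ l)%R.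
    rewrite -[leRHS]lnK ?posrE ?exprn_gt0 // ler_expR lnXn // -[leRHS]mulr_natl.
    have Kk : (- K <= ln kappa)%R by rewrite lerNl /K -normrN ler_norm.
    apply: (@le_trans _ _ (l%:R * - K)%R); last by rewrite ler_wpM2l.
    by rewrite mulrN lerN2 mulrC ler_wpM2l.
  have l2a : (ln (2 * a) = ln 2 + ln a)%R by rewrite lnM ?posrE.
  have -> : (c2 * expR (- (K / D * ln a)) =
      b * e * expR (- (K * (ln (2 * a) / D + 1))) * (1 / 2))%R.
    rewrite l2a (_ : - (K * ((ln 2 + ln a) / D + 1)) =
       - (K * (ln 2 / D + 1)) + - (K / D * ln a))%R; last by field; rewrite gt_eqF.
    by rewrite expRD /c2; ring.
  apply: ler_pM.
  - by rewrite !mulr_ge0 ?expR_ge0 // ltW.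
  - by rewrite divr_ge0.
  - by rewrite ler_wpM2l // mulr_ge0 // ltW.
  have : (z%:R * rho ^+ l <= a * (2 * a)^-1)%R.
    by apply: ler_pM => //; rewrite exprn_ge0 // ltW.
  have -> : (a * (2 * a)^-1 = 1 / 2)%R by field; rewrite gt_eqF.
  by lra.
(* One constant for two purposes: [C / c2] bounds the prefactor and [K / D] the exponent of [a]. *)
pose C' := (C / c2 + K / D)%R.
have cc2 : (0 <= C / c2)%R by rewrite divr_ge0 // ltW.
have kd : (0 <= K / D)%R by rewrite divr_ge0 // ltW.
exists C'; split; first by rewrite /C' addr_ge0.
move=> n a a1; have [l Hl] := fast a a1.
set S := fun k : nat => _.
have la : (0 <= ln a)%R by rewrite ln_ge0.
have H : (c2 * expR (- (K / D * ln a)))%:E * popn P0 Q n (ind S) i <=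
    (C * expR (- r * n%:R))%:E.
  (* Being small at time [n] and then descending leads to [j0] at time [n + l + 1], whose
     probability is known to be at most [C exp(- r (n + l + 1))]. *)
  apply: (@le_trans _ _ (popn P0 Q (n + l.+1) (ind (pred1 j0)) i)).
    rewrite popnD -popnZ; last 2 first.
    - by rewrite mulr_ge0 ?expR_ge0 // ltW.
    - exact: ind_ge0.
    apply: le_popn => z; first by rewrite mule_ge0 ?ind_ge0 // lee_fin mulr_ge0 ?expR_ge0 // ltW.
    rewrite /ind /S; case: (boolP ((0 < z)%N && _)) => [/andP[z0 za]|_].
      by rewrite mule1 Hl.
    by rewrite mule0 popn_ge0 // => *; exact: ind_ge0.
  apply: (le_trans (HC _)); rewrite lee_fin ler_wpM2l ?(ltW C0) //.
  by rewrite ler_expR !mulNr lerN2 ler_wpM2l // ler_nat leq_addr.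
have xf : popn P0 Q n (ind S) i \is a fin_num by exact: popn_ind_fin.
move: H; rewrite -(fineK xf) -EFinM !lee_fin; set x := fine _ => H.
have c2a : (0 < c2 * expR (- (K / D * ln a)))%R by rewrite mulr_gt0 ?expR_gt0.
rewrite -(ler_pM2l c2a); apply: (le_trans H).
have -> : (c2 * expR (- (K / D * ln a)) * (C' * expR (C' * ln a) * expR (- r * n%:R)) =
   (c2 * C') * expR (C / c2 * ln a) * expR (- r * n%:R))%R.
  rewrite (_ : C' * ln a = C / c2 * ln a + K / D * ln a)%R; last by rewrite /C' mulrDl.
  rewrite expRD [expR (- (K / D * ln a))]expRN.
  by field; rewrite gt_eqF ?expR_gt0 // gt_eqF.
rewrite ler_wpM2r ?expR_ge0 //.
have CC : (C <= c2 * C')%R.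
  rewrite /C' mulrDr (_ : c2 * (C / c2) = C)%R; last by field; rewrite gt_eqF.
  by rewrite lerDl mulr_ge0 // ltW.
apply: (le_trans CC); rewrite ler_peMr ?(le_trans _ CC) ?(ltW C0) //.
by rewrite -expR0 ler_expR mulr_ge0.
Qed.

(** Below, the event contains [Z n = i] as soon as [i <= k n]. Above, [k n <= exp(eta n)]
    eventually, and [small_values] charges only [C exp(C eta n)] for this range. *)
Lemma subexponential_rate (k : nat -> R) i :
  k n @[n --> \oo] --> +oo%R ->
  (forall eta : R, (0 < eta)%R ->
    (k n / expR (eta * n%:R))%R @[n --> \oo] --> (0 : R)%R) ->
  ClI P0 Q Z PP i ->
  (n%:R^-1)%:E * lne (PP i [set w | (1 <= Z n w)%N /\ ((Z n w)%:R <= k n)%R])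
    @[n --> \oo] --> (- varrho P0 Q Z PP)%:E.
Proof.
move=> kinf ksub Ci.
have [[r0 _] /(_ _ _ Ci Ci)[_ low]] := varrho_rate.
have [C [C0 HC]] := small_values Ci.
set r := varrho P0 Q Z PP in r0 low HC *.
pose S n j := (0 < j)%N && (j%:R <= k n)%R.
rewrite (_ : (fun _ => _) = (fun n => (n%:R^-1)%:E * lne (popn P0 Q n (ind (S n)) i))); last first.
  apply/funext => n; rewrite -PP_popn; congr (_ * lne (PP i _)).
  by apply/seteqP; split => w /= /andP.
apply: cvg_log_rate => eps e0.
pose eta := (eps / 2 / (C + 1))%R.
have C10 : (0 < C + 1)%R by lra.
have eta0 : (0 < eta)%R by rewrite !divr_gt0.
have e20 : (0 < eps / 2)%R by rewrite divr_gt0.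
near=> n; apply/andP; split.
  apply: (@le_trans _ _ (popn P0 Q n (ind (pred1 i)) i)); first by near: n; exact: low.
  have ki : (i%:R <= k n)%R.
    by near: n; move/cvgryPge : kinf; exact.
  apply: le_popn => z; first exact: ind_ge0.
  rewrite /ind lee_fin ler_nat /S /=; case: eqP => [->|//].
  by rewrite Ci.1 ki.
have Cn : (C <= expR (eps / 2 * n%:R))%R by near: n; exact: near_le_expR.
have kn : (k n <= expR (eta * n%:R))%R.
  rewrite -[leRHS]mul1r -ler_pdivrMr ?expR_gt0 //.
  near: n; have /cvgrPdist_le/(_ 1%R ltr01) := ksub eta eta0.
  apply: filterS => m; rewrite sub0r normrN; exact: le_trans (ler_norm _).
have e1 : (1 <= expR (eta * n%:R))%R by rewrite -expR0 ler_expR mulr_ge0 // ltW.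
apply: le_trans (_ : popn P0 Q n (ind (fun j => (0 < j)%N && (j%:R <= expR (eta * n%:R))%R)) i <= _).
  apply: le_popn => z; first exact: ind_ge0.
  rewrite /ind lee_fin ler_nat /S; case: (0 < z)%N => //=.
  by case: (leP z%:R (k n)) => // /le_trans ->.
apply: (le_trans (HC _ _ e1)); rewrite lee_fin expRK.
have -> : (- (r - eps) * n%:R = eps / 2 * n%:R + eps / 2 * n%:R + - r * n%:R)%R by field.
rewrite !expRD ler_wpM2r ?expR_ge0 //; apply: ler_pM => //; rewrite ?expR_ge0 //.
rewrite ler_expR mulrA ler_wpM2r //.
have -> : (eps / 2 = (C + 1) * eta)%R by rewrite /eta; field; rewrite gt_eqF.
by rewrite ler_wpM2r ?(ltW eta0) //; lra.
Unshelve. all: by end_near. Qed.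

End Rate.


(** * Upper bound *)

(** The power [k^lam] set to zero at and below [b]: the test function adapted to the process killed
    when it enters [[0, b]]. *)
Definition npow {R : realType} (lam b : R) (k : nat) : R :=
  (if b < k%:R then expR (lam * ln k%:R) else 0)%R.

Section NegativeMoment.
Context {R : realType}.
Implicit Types q : offspring_law R.

Lemma npow_ge0 (lam b : R) k : (0 <= npow lam b k)%R.
Proof. by rewrite /npow; case: ifP => // _; exact: expR_ge0. Qed.

Lemma npow_le1 (lam b : R) k : (lam <= 0)%R -> (1 <= b)%R -> (npow lam b k <= 1)%R.
Proof.
move=> l0 b1; rewrite /npow; case: ifP => // bk.
by rewrite -[leRHS]expR0 ler_expR mulr_le0_ge0 // ln_ge0 // (le_trans b1) // ltW.
Qed.

Lemma mean_le_second_moment q : mean q <= second_moment q.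
Proof.
apply: lee_nneseries => k *; first by rewrite mule_ge0 ?measure_ge0 // lee_fin.
rewrite lee_wpmul2r ?measure_ge0 // lee_fin ler_nat.
by case: k => // k; rewrite leq_pmulr.
Qed.

(** The offspring total is compared with [y = (1 - del) m z]. Above [y] the decreasing power is at
    most [y^lam]; at or below [y] it is at most 1, with a probability controlled by the lower
    tail. *)
Lemma csum_npow_le q z (m v c del lam b : R) : mean q = m%:E ->
  second_moment q = v%:E -> (0 < m)%R -> (v <= c * (m + m ^+ 2))%R ->
  (0 < c)%R -> (0 < del < 1)%R -> (lam <= 0)%R -> (1 <= b)%R -> (b < z%:R)%R ->
  csum q z (fun k => (npow lam b k)%:E) <=
  (expR (lam * ln ((1 - del) * m * z%:R)) + expR (- (del ^+ 2 / (8 * c) * b)))%:E.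
Proof.
move=> qm qv m0 vc c0 /andP[d0 d1] l0 b1 bz.
have z0 : (0 < z%:R :> R)%R by lra.
have d10 : (0 < 1 - del)%R by lra.
set y := ((1 - del) * m * z%:R)%R.
have y0 : (0 < y)%R by rewrite !mulr_gt0.
have v0 : (0 < v)%R.
  by rewrite -lte_fin -qv (lt_le_trans _ (mean_le_second_moment q)) // qm lte_fin.
have np0 k : 0 <= (npow lam b k)%:E by rewrite lee_fin npow_ge0.
(* If [y <= b], the cut-off already removes the values below [y] and no tail estimate is needed. *)
have [yb|yb] := leP y b.
  apply: (@le_trans _ _ (expR (lam * ln y))%:E); last by rewrite lee_fin lerDl expR_ge0.
  rewrite -[leRHS](@csum_cst _ q z) ?expR_ge0 //; apply: le_csum => // k.
  rewrite lee_fin /npow; case: ifP => [bk|_]; last exact: expR_ge0.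
  by rewrite ler_expR ler_wnM2l // ler_ln ?posrE //; lra.
(* The minimizer of [- r del m + r^2 v], the exponent per individual. *)
pose r := (del * m / (2 * v))%R.
have r0 : (0 <= r)%R by rewrite divr_ge0 ?mulr_ge0 // ltW.
have := csum_lower_tail z y qm qv r0.
have -> : (r * y + z%:R * (- (r * m) + r ^+ 2 * v) =
   - (z%:R * (del ^+ 2 * m ^+ 2 / (4 * v))))%R.
  by rewrite /r /y; field; rewrite gt_eqF.
move=> tail.
have le_tail : (expR (- (z%:R * (del ^+ 2 * m ^+ 2 / (4 * v)))) <=
    expR (- (del ^+ 2 / (8 * c) * b)))%R.
  rewrite ler_expR lerN2.
  (* Both [b < z] and [b <= z m] enter here, one for each term of the bound [v <= c (m + m^2)]; this
     turns the exponent into a multiple of [b] that does not depend on [m]. *)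
  have mz : (b * (m + m ^+ 2) <= 2 * z%:R * m ^+ 2)%R.
    have zm : (b <= z%:R * m)%R by move: yb; rewrite /y; nra.
    have : (b * m <= z%:R * m * m)%R by rewrite ler_wpM2r // ltW.
    have : (b * m ^+ 2 <= z%:R * m ^+ 2)%R by rewrite ler_wpM2r ?sqr_ge0 // ltW.
    by lra.
  rewrite (_ : z%:R * _ = del ^+ 2 * (2 * z%:R * m ^+ 2) / (8 * v))%R; last first.
    by field; rewrite gt_eqF.
  rewrite ler_pdivlMr ?mulr_gt0 //.
  rewrite (_ : del ^+ 2 / (8 * c) * b * (8 * v) = del ^+ 2 * (b * (v / c)))%R; last first.
    by field; rewrite gt_eqF.
  rewrite ler_wpM2l ?sqr_ge0 //; apply: le_trans mz.
  by apply: ler_wpM2l; [lra|rewrite ler_pdivrMr // mulrC].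
apply: (@le_trans _ _ (csum q z (fun k =>
   (expR (lam * ln y))%:E + ((k%:R <= y)%R%:R)%:E))).
  apply: le_csum => // k; rewrite -EFinD lee_fin.
  case: (leP k%:R y) => yk.
    by rewrite (le_trans (npow_le1 k l0 b1)) // lerDr expR_ge0.
  rewrite addr0 /npow; case: ifP => _; last exact: expR_ge0.
  by rewrite ler_expR ler_wnM2l // ler_ln ?posrE //; lra.
rewrite csumD; last 2 first.
- by move=> k; rewrite lee_fin expR_ge0.
- by move=> k; rewrite lee_fin.
rewrite csum_cst ?expR_ge0 // EFinD leeD2l //; apply: (le_trans tail).
by rewrite lee_fin.
Qed.

End NegativeMoment.

Section Upper.
Context {R : realType} {d0 : measure_display} {Omega0 : measurableType d0}.
Context (P0 : probability Omega0 R) (Q : {mfun Omega0 >-> offspring_law R}).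

(** The real witnesses make the two moments finite, so the estimates on one environment take place
    in [R]. *)
Definition regular (c : R) : set Omega0 := [set w | exists m v : R,
  [/\ mean (Q w) = m%:E, second_moment (Q w) = v%:E, (0 < m)%R &
      (v <= c * (m + m ^+ 2))%R]].

Context (c : R).
Hypotheses (c0 : (0 < c)%R) (regP : P0.-negligible (~` regular c)).
Hypothesis mreg : measurable (regular c).

Lemma pop_regular g z : (forall k, 0 <= g k) ->
  pop P0 Q setT g z = pop P0 Q (regular c) g z.
Proof.
move=> g0; rewrite /pop (@ge0_negligible_integral _ _ _ P0 setT (~` regular c)) //.
- by rewrite setTD setCK.
- exact: measurableC.
- exact: measurable_csumQ.
- by move=> w _; exact: csum_ge0.
- by apply: measure_negligible => //; exact: measurableC.
Qed.

Lemma pop_npow (lam f del b : R) z : (lam <= 0)%R -> mgf_X P0 Q lam = f%:E ->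
  (0 < del < 1)%R -> (1 <= b)%R -> (b < z%:R)%R ->
  pop P0 Q setT (fun k => (npow lam b k)%:E) z <=
  (f * expR (lam * ln (1 - del)) * expR (lam * ln z%:R) +
     expR (- (del ^+ 2 / (8 * c) * b)))%:E.
Proof.
move=> l0 mgfE d01 b1 bz; have /andP[dl0 dl1] := d01.
have z0 : (0 < z%:R :> R)%R by lra.
set eta := expR (- _); set A := (expR (lam * ln (1 - del)) * expR (lam * ln z%:R))%R.
have A0 : (0 <= A)%R by rewrite mulr_ge0 ?expR_ge0.
have mX : measurable_fun setT (fun w => expeR (lam%:E * X Q w)).
  apply: (measurableT_comp measurable_expeR); apply: measurable_funeM.
  apply: (measurableT_comp measurable_lne).
  exact: (measurableT_comp measurable_mean (measurable_funPT Q)).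
have mA : measurable_fun setT (fun w => A%:E * expeR (lam%:E * X Q w)).
  exact: measurable_funeM.
have np0 k : 0 <= (npow lam b k)%:E by rewrite lee_fin npow_ge0.
rewrite pop_regular //.
apply: (@le_trans _ _ (\int[P0]_(w in regular c) (A%:E * expeR (lam%:E * X Q w) + eta%:E))).
  have AX0 w : 0 <= A%:E * expeR (lam%:E * X Q w) + eta%:E.
    by rewrite adde_ge0 ?mule_ge0 ?expeR_ge0 ?lee_fin ?expR_ge0.
  apply: ge0_le_integral => //; do ?[by move=> w _; exact: csum_ge0 |
    exact: measurable_csumQ | by apply: measurable_funTS; exact: emeasurable_funD].
  move=> w [m [v [qm qv m0 vc]]].
    apply: (le_trans (csum_npow_le qm qv m0 vc c0 d01 l0 b1 bz)).
    rewrite EFinD leeD2r // /X /logmean qm lne_EFin //.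
    rewrite (_ : lam%:E * _ = (lam * ln m)%:E) // lee_fin.
    rewrite !lnM ?posrE ?mulr_gt0 ?subr_gt0 // !mulrDr !expRD /A.
    by rewrite mulrAC.
apply: (@le_trans _ _ (\int[P0]_w (A%:E * expeR (lam%:E * X Q w) + eta%:E))).
  apply: ge0_subset_integral => //; first exact: emeasurable_funD.
  by move=> w _; rewrite adde_ge0 ?mule_ge0 ?expeR_ge0 ?lee_fin ?expR_ge0.
rewrite ge0_integralD //; last 2 first.
- by move=> w _; rewrite mule_ge0 ?expeR_ge0 ?lee_fin.
- by move=> w _; rewrite lee_fin expR_ge0.
rewrite ge0_integralZl_EFin //; last by move=> w _; exact: expeR_ge0.
have -> : \int[P0]_w eta%:E = eta%:E.
  rewrite integral_cst //.
  exact: (etrans (congr1 (mule eta%:E) (@probability_setT _ _ _ P0)) (mule1 _)).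
rewrite -/(mgf_X P0 Q lam) mgfE.
by rewrite -EFinM -EFinD lee_fin /A; lra.
Qed.

End Upper.


Lemma near_mul_le_expR {R : realType} (A kappa eps : R) : (0 < kappa)%R ->
  (0 < eps)%R -> \forall n \near \oo, (A * n%:R <= kappa * expR (eps * n%:R))%R.
Proof.
move=> k0 e0; have e20 : (0 < eps / 2)%R by rewrite divr_gt0.
near=> n.
have n0 : (0 <= n%:R :> R)%R by [].
have h1 : (`|A| / kappa * (2 / eps) <= expR (eps / 2 * n%:R))%R.
  by near: n; exact: near_le_expR.
have h2 : (eps / 2 * n%:R <= expR (eps / 2 * n%:R))%R.
  by apply: le_trans (expR_ge1Dx _); lra.
have -> : (eps * n%:R = eps / 2 * n%:R + eps / 2 * n%:R)%R by field.
rewrite expRD.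
have h3 : (`|A| / kappa * (2 / eps) * (eps / 2 * n%:R) <=
    expR (eps / 2 * n%:R) * expR (eps / 2 * n%:R))%R.
  apply: ler_pM => //; first by rewrite !mulr_ge0 ?invr_ge0 // ltW.
  by rewrite mulr_ge0 // ltW.
have -> : (A * n%:R = kappa * (A / kappa * n%:R))%R by field; rewrite gt_eqF.
rewrite ler_wpM2l ?(ltW k0) //; apply: le_trans h3.
have -> : (`|A| / kappa * (2 / eps) * (eps / 2 * n%:R) = `|A| / kappa * n%:R)%R.
  by field; rewrite !gt_eqF.
by rewrite ler_wpM2r // ler_wpM2r ?invr_ge0 ?(ltW k0) // ler_norm.
Unshelve. all: by end_near. Qed.

Lemma near_seq {T : eqType} (s : seq T) (P : T -> nat -> Prop) :
  (forall p, p \in s -> \forall n \near \oo, P p n) ->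
  \forall n \near \oo, forall p, p \in s -> P p n.
Proof.
elim: s => [|q s IH] H; first by near=> n.
have Hq := H q (mem_head _ _).
have /IH Hs : forall p, p \in s -> \forall n \near \oo, P p n.
  by move=> p ps; apply: H; rewrite inE ps orbT.
near=> n => p; rewrite inE => /predU1P[->|]; first by near: n.
by move: p; near: n.
Unshelve. all: by end_near. Qed.

Section Arithmetic.
Context {R : realType}.
Implicit Types (x y mu n A L : R).

Lemma linear_shift x y mu n A L : ((x - mu) * n <= A + y - L)%R ->
  (mu * n - A + L <= - (x - 2 * mu) * n + y)%R.
Proof. lra. Qed.

Lemma linear_slack x y mu n : (0 <= mu * n)%R -> (0 <= y)%R ->
  (- x * n <= - (x - 2 * mu) * n + y)%R.
Proof. lra. Qed.

Lemma linear_weaken x mu n (k k' : R) : (0 <= mu * n)%R -> (k <= k')%R ->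
  (- (x - k * mu) * n <= - (x - k' * mu) * n)%R.
Proof.
move=> mn kk; have : (k * (mu * n) <= k' * (mu * n))%R by rewrite ler_wpM2r.
lra.
Qed.

Lemma double_bound x y A : (x <= A)%R -> (y <= A)%R -> (x + y <= 2 * A)%R.
Proof. lra. Qed.

Lemma last_visit_count (C n W : R) : (0 <= C)%R -> (1 <= n)%R -> (0 <= W)%R ->
  (2 * W + 2 * C * W * n <= (C + 1) * 2 * (2 * n) * W)%R.
Proof.
move=> C0 n1 W0; have : (0 <= C * n * W)%R by rewrite !mulr_ge0 //; lra.
have : (W <= n * W)%R by rewrite ler_peMl.
lra.
Qed.

End Arithmetic.

(** * Decomposition at the last visit to small values *)

Section LastVisit.
Context {R : realType} {d0 : measure_display} {Omega0 : measurableType d0}.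
Context (P0 : probability Omega0 R) (Q : {mfun Omega0 >-> offspring_law R}).
Implicit Types (g h : nat -> \bar R) (b : R).

Definition above b h k : \bar R := if (b < k%:R)%R then h k else 0.

Definition below b h k : \bar R :=
  if (0 < k)%N && (k%:R <= b)%R then h k else 0.

(* One step of the process killed at its visits of [[0, b]]. *)
Definition dpop b h z : \bar R := pop P0 Q setT (above b h) z.

Lemma above_ge0 b h k : (forall j, 0 <= h j) -> 0 <= above b h k.
Proof. by move=> h0; rewrite /above; case: ifP. Qed.

Lemma below_ge0 b h k : (forall j, 0 <= h j) -> 0 <= below b h k.
Proof. by move=> h0; rewrite /below; case: ifP. Qed.

Lemma iter_dpop_ge0 b g m z : (forall j, 0 <= g j) -> 0 <= iter m (dpop b) g z.
Proof.
move=> g0; elim: m z => [//|m IH] z /=; apply: pop_ge0 => k.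
exact: above_ge0.
Qed.

Lemma iter_dpop0 b g m : (0 <= b)%R -> (forall j, 0 <= g j) -> g 0%N = 0 ->
  iter m (dpop b) g 0%N = 0.
Proof.
move=> b0 g0 g00; case: m => [//|m] /=; rewrite /dpop /pop.
under eq_integral => w _.
  rewrite csum0; last by move=> k; apply: above_ge0 => j; exact: iter_dpop_ge0.
  rewrite /above ltNge b0 /=; over.
exact: integral0.
Qed.

Lemma pop_sumf n (h : nat -> nat -> \bar R) z :
  (forall i k, 0 <= h i k) ->
  pop P0 Q setT (fun k => \sum_(0 <= i < n) h i k) z =
  \sum_(0 <= i < n) pop P0 Q setT (h i) z.
Proof.
move=> h0; elim: n => [|n IH].
  rewrite big_geq // (_ : (fun k => _) = fun=> 0%:E); first exact: pop_cst.
  by apply/funext => k; rewrite big_geq.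
rewrite big_nat_recr //= -IH -popD //; last by move=> k; exact: sume_ge0.
rewrite (_ : (fun k => \sum_(0 <= i < n.+1) h i k) =
  (fun k => \sum_(0 <= i < n) h i k + h n k)) //.
by apply/funext => k; rewrite big_nat_recr.
Qed.

(** The index [t] means that the last time in [[1, n]] with population in [(0, b]] is [t + 1]; the
    isolated term is the case without such a visit. Induction on the first step: its part at or
    below [b] produces the new term of index 0. Extinct paths contribute nothing because
    [g 0 = 0]. *)
Lemma last_visit b g n z : (0 <= b)%R -> (forall j, 0 <= g j) -> g 0%N = 0 ->
  popn P0 Q n g z <= iter n (dpop b) g z +
    \sum_(0 <= t < n) popn P0 Q t.+1 (below b (iter (n - t.+1) (dpop b) g)) z.
Proof.
move=> b0 g0 g00.
have r0 m k : 0 <= iter m (dpop b) g k by exact: iter_dpop_ge0.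
have bl0 m k : 0 <= below b (iter m (dpop b) g) k by exact: below_ge0.
elim: n z => [|n IH] z; first by rewrite big_geq // adde0.
rewrite popnS; apply: (@le_trans _ _ (pop P0 Q setT (fun k => iter n (dpop b) g k +
    \sum_(0 <= t < n) popn P0 Q t.+1 (below b (iter (n - t.+1) (dpop b) g)) k) z)).
  by apply: le_pop => // k; exact: popn_ge0.
have s0 k : 0 <= \sum_(0 <= t < n) popn P0 Q t.+1 (below b (iter (n - t.+1) (dpop b) g)) k.
  by apply: sume_ge0 => t _; exact: popn_ge0.
rewrite popD // big_nat_recl // subSS subn0 [leRHS]addeA.
have E : pop P0 Q setT (fun k => \sum_(0 <= t < n)
      popn P0 Q t.+1 (below b (iter (n - t.+1) (dpop b) g)) k) z =
    \sum_(0 <= t < n) popn P0 Q t.+2 (below b (iter (n - t.+1) (dpop b) g)) z.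
  apply: (@pop_sumf n (fun t => popn P0 Q t.+1 (below b (iter (n - t.+1) (dpop b) g)))).
  by move=> *; exact: popn_ge0.
rewrite E.
apply: leeD => //.
have -> : iter n.+1 (dpop b) g z = pop P0 Q setT (above b (iter n (dpop b) g)) z by [].
have -> : popn P0 Q 1 (below b (iter n (dpop b) g)) z =
  pop P0 Q setT (below b (iter n (dpop b) g)) z by [].
rewrite -popD //; last by move=> k; exact: above_ge0.
(* The state 0 is in neither part; there the left side vanishes by [iter_dpop0]. *)
apply: le_pop => // k; rewrite /above /below.
case: (ltP b k%:R) => bk; first by rewrite leeDl //; case: ifP.
rewrite add0e andbT; case: k bk => [|k] bk //=.
by rewrite iter_dpop0.
Qed.

Context (c : R).
Hypotheses (c0 : (0 < c)%R) (regP : P0.-negligible (~` regular Q c)).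
Hypothesis mreg : measurable (regular Q c).

Definition upto (a : R) : nat -> \bar R := ind (fun k => (0 < k)%N && (k%:R <= a)%R).

(** Starts from [1{0 < z <= a} <= a^(- lam) z^lam]. Each step multiplies [z^lam] by [F] and adds one
    lower-tail error; after [m] steps there are [m] errors, each amplified at most by
    [max(1, F)^m]. *)
Lemma iter_dpop_le (lam f del a b F : R) m z : (lam <= 0)%R ->
  mgf_X P0 Q lam = f%:E -> (0 < f)%R ->
  (0 < del < 1)%R -> (1 <= a)%R -> (1 <= b)%R -> (b < z%:R)%R ->
  F = (f * expR (lam * ln (1 - del)))%R ->
  iter m (dpop b) (upto a) z <=
  (expR (- lam * ln a) * (F ^+ m * expR (lam * ln z%:R) +
    m%:R * Num.max 1 F ^+ m * expR (- (del ^+ 2 / (8 * c) * b))))%:E.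
Proof.
move=> l0 mgfE f0 d01 a1 b1 bz FE; set eta := expR (- _).
have F0 : (0 <= F)%R by rewrite FE mulr_ge0 ?expR_ge0 // ltW.
set F' := Num.max 1%R F; have F'1 : (1 <= F')%R by rewrite le_max lexx.
have FF' : (F <= F')%R by rewrite le_max lexx orbT.
set K := expR (- lam * ln a); have K0 : (0 < K)%R by rewrite expR_gt0.
elim: m z bz => [|m IH] z bz.
  rewrite /= expr0 mul1r mul0r mul0r addr0 /upto /ind lee_fin.
  case: (boolP ((0 < z)%N && _)) => [/andP[z0 za]|_]; last by rewrite mulr_ge0 ?expR_ge0.
  rewrite /K -expRD -[leLHS]expR0 ler_expR mulNr addrC subr_ge0.
  by rewrite ler_wnM2l // ler_ln ?posrE ?ltr0n //; lra.
have np0 k : 0 <= (npow lam b k)%:E by rewrite lee_fin npow_ge0.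
have e0 : (0 <= eta)%R by rewrite expR_ge0.
have kf0 : (0 <= K * F ^+ m)%R by rewrite mulr_ge0 ?exprn_ge0 // ltW.
have kfe0 : (0 <= K * (m%:R * F' ^+ m * eta))%R.
  by rewrite !mulr_ge0 ?exprn_ge0 ?(ltW K0) //; lra.
rewrite iterS; apply: (@le_trans _ _ (pop P0 Q setT (fun k => (K * F ^+ m)%:E * (npow lam b k)%:E +
    (K * (m%:R * F' ^+ m * eta))%:E) z)).
  apply: le_pop => // k.
    by apply: above_ge0 => j; apply: iter_dpop_ge0 => ?; exact: ind_ge0.
  rewrite /above /npow; case: ifP => bk.
    by apply: (le_trans (IH k bk)); rewrite -EFinM -EFinD lee_fin mulrDr mulrA.
  by rewrite mule0 add0e lee_fin.
rewrite popD //; last by move=> k; rewrite mule_ge0.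
rewrite (@popZ _ _ _ P0 Q setT (fun k => (npow lam b k)%:E) z (K * F ^+ m)%R) //.
rewrite pop_cst //.
apply: (@le_trans _ _ ((K * F ^+ m)%:E * (F * expR (lam * ln z%:R) + eta)%:E +
   (K * (m%:R * F' ^+ m * eta))%:E)).
  rewrite leeD2r // lee_wpmul2l ?lee_fin // FE.
  exact: (pop_npow c0 regP mreg l0 mgfE d01 b1 bz).
rewrite -EFinM -EFinD lee_fin; set w := expR (lam * ln z%:R).
have -> : (K * F ^+ m * (F * w + eta) + K * (m%:R * F' ^+ m * eta) =
    K * (F ^+ m.+1 * w + (F ^+ m * eta + m%:R * F' ^+ m * eta)))%R.
  by rewrite exprS; ring.
rewrite ler_wpM2l ?(ltW K0) // lerD2l.
have h1 : (F ^+ m <= F' ^+ m.+1)%R.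
  apply: (@le_trans _ _ (F' ^+ m)%R); first by rewrite lerXn2r ?nnegrE //; lra.
  by rewrite ler_weXn2l.
have h2 : (F' ^+ m <= F' ^+ m.+1)%R by rewrite ler_weXn2l.
have : (F ^+ m * eta <= F' ^+ m.+1 * eta)%R by rewrite ler_wpM2r.
have : (m%:R * (F' ^+ m * eta) <= m%:R * (F' ^+ m.+1 * eta))%R.
  by rewrite ler_wpM2l // ler_wpM2r.
by rewrite -natr1; lra.
Qed.

(** With threshold [exp(eps n)] the accumulated errors are doubly exponentially small, so their rate
    [x] is arbitrary. The bound is uniform in the starting point. *)
Lemma iter_dpop_near (lam f eps nu theta x : R) : (lam <= 0)%R -> (0 < f)%R ->
  mgf_X P0 Q lam = f%:E -> (0 < eps)%R -> (0 < nu)%R -> (0 <= theta)%R ->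
  \forall n \near \oo, forall m z, (0 < m <= n)%N ->
    iter m (dpop (expR (eps * n%:R))) (upto (expR (theta * n%:R))) z <=
    (expR (nu * n%:R - lam * theta * n%:R + m%:R * ln f) + expR (- x * n%:R))%:E.
Proof.
move=> l0 f0 mgfE e0 nu0 th0.
(* Chosen so that replacing [m] by [(1 - del) m] costs at most a factor [exp(nu / 2)] per step:
   [- lam / (1 - lam) <= 1]. *)
pose del := (1 - expR (- (nu / 2 / (1 - lam))))%R.
have l1 : (0 < 1 - lam)%R by lra.
have d01 : (0 < del < 1)%R.
  rewrite /del subr_gt0 gtrBl expR_gt0 andbT -[ltRHS]expR0 ltr_expR oppr_lt0.
  by rewrite !divr_gt0.
have lnd : (lam * ln (1 - del) <= nu / 2)%R.
  rewrite /del opprB addrC subrK expRK mulrN -mulNr mulrCA ger_pMr ?divr_gt0 //.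
  by rewrite ler_pdivrMr //; lra.
set F := (f * expR (lam * ln (1 - del)))%R.
pose G := (ln f + lam * ln (1 - del))%R.
have FE : F = expR G by rewrite /G expRD lnK.
pose H := Num.max 0%R G.
have H0 : (0 <= H)%R by rewrite le_max lexx.
have F'E : (Num.max 1 F <= expR H)%R.
  rewrite ge_max -[leLHS]expR0 FE !ler_expR H0 /=.
  by rewrite le_max lexx orbT.
pose kap := (del ^+ 2 / (8 * c))%R.
have kap0 : (0 < kap)%R.
  by rewrite divr_gt0 ?exprn_gt0 ?mulr_gt0 //; case/andP: d01.
near=> n => m z /andP[m0 mn].
have n0 : (0 <= n%:R :> R)%R by [].
have a1 : (1 <= expR (theta * n%:R))%R by rewrite -[leLHS]expR0 ler_expR mulr_ge0.
have b1 : (1 <= expR (eps * n%:R))%R.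
  by rewrite -[leLHS]expR0 ler_expR mulr_ge0 // ltW.
(* Compensates for one missing factor [f]: the first step is not estimated through the moment
   bound. *)
have hf : (`|ln f| <= nu / 2 * n%:R)%R.
  rewrite mulrC -ler_pdivrMr ?divr_gt0 //; near: n; exact: nbhs_infty_ger.
have hk : ((1 + H - lam * theta + x) * n%:R <= kap * expR (eps * n%:R))%R.
  by near: n; exact: near_mul_le_expR.
(* The first step is spent to be above [b >= 1], where [z^lam <= 1]; this removes the dependence on
   the starting point. *)
case: m m0 mn => // m _ mn.
set a := expR (theta * _); set b := expR (eps * _).
rewrite iterS.
set U := (expR (- lam * ln a) * (F ^+ m + m%:R * Num.max 1 F ^+ m * expR (- (kap * b))))%R.
have M0 : (0 <= Num.max 1 F)%R by rewrite le_max ler01.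
have F0 : (0 <= F)%R by rewrite FE expR_ge0.
have U0 : (0 <= U)%R.
  apply: mulr_ge0; first exact: expR_ge0.
  by apply: addr_ge0; rewrite ?exprn_ge0 // !mulr_ge0 ?exprn_ge0 ?expR_ge0.
apply: (@le_trans _ _ U%:E).
  rewrite -[leRHS](pop_cst P0 Q z U0); apply: le_pop => // k.
    by apply: above_ge0 => j; apply: iter_dpop_ge0 => ?; exact: ind_ge0.
  rewrite /above; case: ifP => bk; last by rewrite lee_fin.
  apply: (le_trans (iter_dpop_le m l0 mgfE f0 d01 a1 b1 bk (erefl _))).
  rewrite lee_fin ler_wpM2l ?expR_ge0 // lerD2r ler_piMr //.
    by rewrite exprn_ge0 // mulr_ge0 ?expR_ge0 // ltW.
  by rewrite -[leRHS]expR0 ler_expR mulr_le0_ge0 // ln_ge0 // (le_trans b1 (ltW bk)).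
rewrite lee_fin /U /a expRK mulrDr; apply: lerD.
  rewrite FE -expRM_natl -expRD ler_expR /G.
  have mn' : (m%:R * (lam * ln (1 - del)) <= n%:R * (nu / 2))%R.
    apply: (@le_trans _ _ (m%:R * (nu / 2))%R); first by rewrite ler_wpM2l.
    by apply: ler_wpM2r; [rewrite divr_ge0 // ltW | rewrite ler_nat ltnW].
  have : (- ln f <= nu / 2 * n%:R)%R by apply: le_trans hf; rewrite -normrN ler_norm.
  by rewrite -[m.+1%:R]natr1; lra.
have h1 : (m%:R * Num.max 1 F ^+ m <= expR n%:R * expR (n%:R * H))%R.
  apply: ler_pM => //; first by rewrite exprn_ge0 // le_max ler01.
    apply: (@le_trans _ _ n%:R); first by rewrite ler_nat ltnW.
    by apply: le_trans (expR_ge1Dx _); lra.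
  apply: (@le_trans _ _ (expR H ^+ m)%R).
    by rewrite lerXn2r ?nnegrE ?expR_ge0 // le_max ler01.
  by rewrite -expRM_natl ler_expR ler_wpM2r // ler_nat ltnW.
apply: (@le_trans _ _ (expR (- lam * (theta * n%:R)) *
   (expR n%:R * expR (n%:R * H) * expR (- (kap * b))))%R).
  by rewrite ler_wpM2l ?expR_ge0 // ler_wpM2r ?expR_ge0.
by rewrite -!expRD ler_expR; move: hk; rewrite -/b; lra.
Unshelve. all: by end_near. Qed.

(* [C e^(C eps n)] absorbs the cost of the last visit below [e^(eps n)]. *)
Lemma upper_rate (i : nat) (C r theta x : R) : (0 <= C)%R -> (0 <= r)%R -> (0 < theta)%R ->
  (forall n (a : R), (1 <= a)%R -> popn P0 Q n (upto a) i <=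
     (C * expR (C * ln a) * expR (- r * n%:R))%:E) ->
  (forall nu : R, (0 < nu)%R -> exists s : seq (R * R),
     (forall p, p \in s -> [/\ p.1 <= 0, 0 < p.2 & mgf_X P0 Q p.1 = p.2%:E]%R) /\
     forall t : R, (0 <= t <= 1)%R -> exists2 p, p \in s &
       (x - nu <= p.1 * theta + t * r - (1 - t) * ln p.2)%R) ->
  (x <= r)%R ->
  forall nu : R, (0 < nu)%R -> \forall n \near \oo,
    popn P0 Q n (upto (expR (theta * n%:R))) i <= (expR (- (x - nu) * n%:R))%:E.
Proof.
move=> C0 r0 th0 small Hs xr nu nu0.
(* Five losses of rate [mu]: the finite family of tilts, the moment estimate, the factor
   [exp(C eps n)], and the two prefactors [2 (C + 1)] and [2 n]. *)
pose mu := (nu / 5)%R; have mu0 : (0 < mu)%R by rewrite divr_gt0.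
have [s [sP sT]] := Hs mu mu0.
pose eps := (mu / (C + 1))%R.
have C10 : (0 < C + 1)%R by lra.
have eps0 : (0 < eps)%R by rewrite divr_gt0.
have Ceps : (C * eps <= mu)%R by rewrite /eps mulrCA ger_pMr // ler_pdivrMr //; lra.
pose HP n := forall p, p \in s -> forall m z, (0 < m <= n)%N ->
    iter m (dpop (expR (eps * n%:R))) (upto (expR (theta * n%:R))) z <=
    (expR (mu * n%:R - p.1 * theta * n%:R + m%:R * ln p.2) + expR (- x * n%:R))%:E.
have Hnear : \forall n \near \oo, HP n.
  apply: near_seq => p ps; have [p1 p2 p3] := sP p ps.
  by apply: iter_dpop_near => //; exact: ltW.
have up0 a k : 0 <= upto a k :> \bar R by exact: ind_ge0.
near=> n.
have n1 : (0 < n)%N by near: n; exact: nbhs_infty_gt.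
have n0 : (0 <= n%:R :> R)%R by [].
have nn0 : (0 < n%:R :> R)%R by rewrite ltr0n.
have Cn : ((C + 1) * 2 <= expR (mu * n%:R))%R by near: n; exact: near_le_expR.
have nn2 : (2 * n%:R <= 1 * expR (mu * n%:R))%R by near: n; exact: near_mul_le_expR.
have Hn : HP n by near: n; exact: Hnear.
have iN : (i%:R <= expR (eps * n%:R))%R by near: n; exact: near_le_expR.
move: iN Hn; rewrite /HP; set b := expR (eps * n%:R); set a := expR (theta * n%:R) => ib Hn.
have nn1 : (1 <= n%:R :> R)%R by rewrite ler1n.
have b1 : (1 <= b)%R by rewrite /b -[leLHS]expR0 ler_expR mulr_ge0 // ltW.
(* [m] is the time left after the last visit; the tilt is the one that the finite family offers for
   [t = (n - m) / n], the fraction of time spent before it. *)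
have key (m : nat) z : (0 < m <= n)%N ->
   iter m (dpop b) (upto a) z <=
   (2 * expR (- (x - 2 * mu) * n%:R + r * (n - m)%:R))%:E.
  move=> m0n; have /andP[m0 mn] := m0n.
  have mnR : (m%:R <= n%:R :> R)%R by rewrite ler_nat.
  have [|p ps Hp] := sT ((n - m)%:R / n%:R)%R.
    by rewrite divr_ge0 //= ler_pdivrMr // mul1r ler_nat leq_subr.
  apply: (le_trans (Hn p ps m z m0n)); rewrite lee_fin.
  have E1 : (mu * n%:R - p.1 * theta * n%:R + m%:R * ln p.2 <=
      - (x - 2 * mu) * n%:R + r * (n - m)%:R)%R.
    move: Hp; rewrite natrB // => Hp.
    apply: linear_shift; apply: (le_trans (ler_wpM2r n0 Hp)); rewrite le_eqVlt; apply/orP; left; apply/eqP.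
    by rewrite /=; field; rewrite gt_eqF.
  have E2 : (- x * n%:R <= - (x - 2 * mu) * n%:R + r * (n - m)%:R)%R.
    by apply: linear_slack; rewrite mulr_ge0 // ltW.
  by apply: double_bound; rewrite ler_expR.
have b0 : (0 <= b)%R by rewrite expR_ge0.
apply: (le_trans (last_visit n i b0 (up0 a) _)).
  by rewrite /upto /ind.
pose W := expR (- (x - 3 * mu) * n%:R); have W0 : (0 <= W)%R by rewrite expR_ge0.
have mun0 : (0 <= mu * n%:R)%R by rewrite mulr_ge0 // ltW.
have cb : (expR (C * ln b) <= expR (mu * n%:R))%R.
  by rewrite ler_expR /b expRK mulrA ler_wpM2r.
have t1 : iter n (dpop b) (upto a) i <= (2 * W)%:E.
  apply: le_trans (key n i _) _; first by rewrite n1 leqnn.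
  rewrite lee_fin ler_wpM2l // ler_expR subnn mulr0 addr0.
  by apply: linear_weaken => //; rewrite ler_nat.
have t2 t : (t < n)%N ->
    popn P0 Q t.+1 (below b (iter (n - t.+1) (dpop b) (upto a))) i <= (2 * C * W)%:E.
  (* If the last visit occurs at time [n], no step is left and [key] does not apply; the small-value
     bound and [x <= r] suffice. *)
  move=> tn; have [m0|m0] := posnP (n - t.+1)%N.
    have tE : t.+1 = n by apply/eqP; rewrite eqn_leq tn -subn_eq0 m0.
    rewrite m0 tE /=.
    apply: (@le_trans _ _ (popn P0 Q n (upto b) i)).
      apply: le_popn => k; first exact: below_ge0.
      rewrite /below /upto /ind; case: (_ && (k%:R <= b)%R) => //.
      by rewrite lee_fin ler_nat; case: (_ && _).
    apply: (le_trans (small n b b1)); rewrite lee_fin.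
    apply: (@le_trans _ _ (C * (expR (mu * n%:R) * expR (- x * n%:R)))%R).
      rewrite -mulrA ler_wpM2l //; apply: ler_pM; rewrite ?expR_ge0 //.
      by rewrite ler_expR ler_wpM2r // lerN2.
    rewrite -expRD (_ : 2 * C * W = C * (2 * W))%R; last by ring.
    apply: ler_wpM2l => //; apply: (@le_trans _ _ W); last by rewrite ler_peMl // ler1n.
    have -> : (mu * n%:R + - x * n%:R = - (x - 1 * mu) * n%:R)%R by ring.
    by rewrite ler_expR; apply: linear_weaken => //; rewrite ler1n.
  set Y := (2 * expR (- (x - 2 * mu) * n%:R + r * t.+1%:R))%R.
  have Y0 : (0 <= Y)%R by rewrite mulr_ge0 ?expR_ge0.
  apply: (@le_trans _ _ (popn P0 Q t.+1 (fun k => Y%:E * upto b k) i)).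
    apply: le_popn => k.
      by apply: below_ge0 => j; exact: iter_dpop_ge0.
    rewrite /below /upto /ind; case: (_ && (k%:R <= b)%R); last by rewrite mule0.
    rewrite mule1; apply: le_trans (key (n - t.+1)%N k _) _; first by rewrite m0 leq_subr.
    by rewrite lee_fin subKn.
  rewrite (@popnZ _ _ _ P0 Q t.+1 (upto b) i Y) //.
  apply: (@le_trans _ _ (Y%:E * (C * expR (C * ln b) * expR (- r * t.+1%:R))%:E)).
    by rewrite lee_wpmul2l ?lee_fin // small.
  rewrite -EFinM lee_fin.
  apply: (@le_trans _ _ (Y * (C * expR (mu * n%:R) * expR (- r * t.+1%:R)))%R).
    by rewrite ler_wpM2l // ler_wpM2r ?expR_ge0 // ler_wpM2l.
  rewrite /Y /W.
  have -> : (- (x - 3 * mu) * n%:R = (- (x - 2 * mu) * n%:R + r * t.+1%:R) +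
      mu * n%:R + - r * t.+1%:R)%R by ring.
  rewrite [in leRHS]expRD [in leRHS]expRD.
  by rewrite le_eqVlt; apply/orP; left; apply/eqP; ring.
apply: (@le_trans _ _ ((2 * W)%:E + \sum_(0 <= t < n) (2 * C * W)%:E)).
  apply: leeD => //; rewrite big_nat_cond [leRHS]big_nat_cond.
  by apply: lee_sum => t; rewrite andbT => /andP[_ tn]; exact: t2.
rewrite sumEFin -EFinD lee_fin sumr_const_nat subn0.
apply: (@le_trans _ _ ((C + 1) * 2 * (2 * n%:R) * W)%R).
  by rewrite -[X in (_ + X)%R]mulr_natr; exact: last_visit_count.
have -> : (- (x - nu) * n%:R = mu * n%:R + mu * n%:R + - (x - 3 * mu) * n%:R)%R.
  by rewrite /mu; field.
rewrite 2!expRD ler_wpM2r //; rewrite mul1r in nn2.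
apply: ler_pM => //; first by rewrite mulr_ge0 // ltW.
Unshelve. all: by end_near. Qed.

End LastVisit.


(** * Lower bound *)

Section Words.
Context {R : realType}.
Implicit Types (p xv : nat -> R) (l : seq nat).
Local Open Scope ring_scope.

Fixpoint words (N n : nat) : seq (seq nat) :=
  if n is n'.+1 then [seq x :: l | x <- iota 0 N, l <- words N n'] else [:: [::]].

Definition wprod p l : R := \prod_(x <- l) p x.
Definition wsum xv l : R := \sum_(x <- l) xv x.

Lemma big_words N n (F : seq nat -> R) :
  \sum_(l <- words N n.+1) F l = \sum_(0 <= x < N) \sum_(l <- words N n) F (x :: l).
Proof. by rewrite /= big_allpairs_dep /index_iota subn0. Qed.

Lemma size_words N n l : l \in words N n -> size l = n /\ all (ltn^~ N) l.
Proof.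
elim: n l => [|n IH] l /=; first by rewrite inE => /eqP ->.
move=> /allpairsP[[x k] [/= xN kw ->]] /=.
by have [-> ->] := IH k kw; move: xN; rewrite mem_iota /= => ->.
Qed.

Lemma wprod_cons p x l : wprod p (x :: l) = p x * wprod p l.
Proof. by rewrite /wprod big_cons. Qed.

Lemma wsum_cons xv x l : wsum xv (x :: l) = xv x + wsum xv l.
Proof. by rewrite /wsum big_cons. Qed.

Lemma wprod_ge0 p l : (forall x, 0 <= p x) -> 0 <= wprod p l.
Proof. by move=> p0; apply: prodr_ge0. Qed.

Context (N : nat) (p xv : nat -> R).
Hypotheses (p0 : forall x, 0 <= p x) (p1 : \sum_(0 <= x < N) p x = 1).

Lemma sum_wprod n : \sum_(l <- words N n) wprod p l = 1.
Proof.
elim: n => [|n IH]; first by rewrite big_seq1 /wprod big_nil.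
rewrite big_words -[RHS]p1; apply: eq_bigr => x _.
by under eq_bigr do rewrite wprod_cons; rewrite -mulr_sumr IH mulr1.
Qed.

Lemma wsum_variance n m v : \sum_(0 <= x < N) p x * xv x = m ->
  \sum_(0 <= x < N) p x * (xv x - m) ^+ 2 = v ->
  \sum_(l <- words N n) wprod p l * (wsum xv l - n%:R * m) ^+ 2 = n%:R * v.
Proof.
move=> pm pv; elim: n => [|n IH].
  by rewrite big_seq1 /wsum big_nil !mul0r subrr expr0n mulr0.
rewrite big_words; set T := \sum_(l <- words N n) wprod p l * (wsum xv l - n%:R * m).
transitivity (\sum_(0 <= x < N) (p x * (xv x - m) ^+ 2 +
    (2 * T) * (p x * (xv x - m)) + (n%:R * v) * p x)).
  apply: eq_bigr => x _.
  transitivity (p x * ((xv x - m) ^+ 2 * \sum_(l <- words N n) wprod p l +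
     2 * (xv x - m) * T + \sum_(l <- words N n) wprod p l * (wsum xv l - n%:R * m) ^+ 2)).
    rewrite !mulr_sumr -!big_split /= mulr_sumr; apply: eq_bigr => l _.
    by rewrite wprod_cons wsum_cons -natr1; ring.
  by rewrite sum_wprod IH; ring.
rewrite !big_split /= -!mulr_sumr pv p1.
have -> : \sum_(0 <= x < N) p x * (xv x - m) = 0.
  under eq_bigr do rewrite mulrBr.
  by rewrite sumrB pm -mulr_suml p1 mul1r subrr.
by rewrite -natr1; ring.
Qed.

(* Dominates [exp (- h S)] for every partial sum [S] of the values along [l]. *)
Fixpoint Mh (h : R) l : R := if l is x :: l' then 1 + expR (- h * xv x) * Mh h l' else 1.

Lemma Mh_ge1 h l : 1 <= Mh h l.
Proof.
elim: l => [|x l IH] //=; rewrite lerDl mulr_ge0 ?expR_ge0 //.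
exact: le_trans IH.
Qed.

Lemma sum_Mh h n : \sum_(0 <= x < N) p x * expR (- h * xv x) <= 1 ->
  \sum_(l <- words N n) wprod p l * Mh h l <= n.+1%:R.
Proof.
move=> ph; elim: n => [|n IH]; first by rewrite big_seq1 /wprod big_nil mul1r.
rewrite big_words.
have -> : \sum_(0 <= x < N) \sum_(l <- words N n) wprod p (x :: l) * Mh h (x :: l) =
    \sum_(0 <= x < N) (p x + p x * expR (- h * xv x) *
       (\sum_(l <- words N n) wprod p l * Mh h l)).
  apply: eq_bigr => x _.
  rewrite -[X in X + _]mulr1 -(sum_wprod n) mulr_sumr mulr_sumr -big_split /=.
  by apply: eq_bigr => l _; rewrite wprod_cons; ring.
rewrite big_split /= p1 -mulr_suml -[leRHS]natr1 addrC lerD2r.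
apply: le_trans IH; rewrite -[leRHS]mul1r ler_wpM2r //.
by apply: sumr_ge0 => l _; rewrite mulr_ge0 ?wprod_ge0 // (le_trans _ (Mh_ge1 _ _)).
Qed.

Definition good (m eps h : R) n l : bool :=
  (`|wsum xv l - n%:R * m| <= eps * n%:R) && (Mh h l <= 4 * n.+1%:R).

Lemma good_prob n (m v eps h : R) : (0 < n)%N -> 0 < eps ->
  \sum_(0 <= x < N) p x * xv x = m ->
  \sum_(0 <= x < N) p x * (xv x - m) ^+ 2 = v ->
  \sum_(0 <= x < N) p x * expR (- h * xv x) <= 1 ->
  4 * v <= eps ^+ 2 * n%:R ->
  1 / 2 <= \sum_(l <- words N n | good m eps h n l) wprod p l.
Proof.
move=> n0 e0 pm pv ph nv.
have nR : (0 < n%:R :> R) by rewrite ltr0n.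
have en : 0 < eps * n%:R by rewrite mulr_gt0.
have le1 l : wprod p l <= wprod p l * (good m eps h n l)%:R +
    (wprod p l * (wsum xv l - n%:R * m) ^+ 2) / (eps * n%:R) ^+ 2 +
    (wprod p l * Mh h l) / (4 * n.+1%:R).
  have w0 : 0 <= wprod p l by exact: wprod_ge0.
  have M0 : 0 <= Mh h l by rewrite (le_trans _ (Mh_ge1 _ _)).
  have t1 : 0 <= wprod p l * (wsum xv l - n%:R * m) ^+ 2 / (eps * n%:R) ^+ 2.
    by apply: divr_ge0; [apply: mulr_ge0 => //|]; exact: sqr_ge0.
  have t2 : 0 <= wprod p l * Mh h l / (4 * n.+1%:R) by rewrite divr_ge0 ?mulr_ge0.
  case: (boolP (good _ _ _ _ _)) => [_|]; first by rewrite mulr1 -addrA lerDl addr_ge0.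
  rewrite /good negb_and -!ltNge mulr0 add0r => /orP[H|H].
    apply: ler_wpDr => //; rewrite -mulrA ler_peMr // ler_pdivlMr ?exprn_gt0 // mul1r.
    by rewrite -[leRHS]real_normK ?num_real // lerXn2r ?nnegrE ?normr_ge0 // ltW.
  apply: ler_wpDl => //; rewrite -mulrA ler_peMr // ler_pdivlMr ?mulr_gt0 ?ltr0n //.
  by rewrite mul1r ltW.
have := ler_sum (words N n) (fun l (_ : true) => le1 l).
rewrite sum_wprod !big_split /= -!mulr_suml (wsum_variance n pm pv) => H.
have -> : \sum_(l <- words N n | good m eps h n l) wprod p l =
   \sum_(l <- words N n) wprod p l * (good m eps h n l)%:R.
  by rewrite big_mkcond; apply: eq_bigr => l _; case: ifP; rewrite ?mulr1 ?mulr0.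
have h1 : n%:R * v / (eps * n%:R) ^+ 2 <= 1 / 4.
  rewrite exprMn ler_pdivrMr ?mulr_gt0 ?exprn_gt0 //.
  have := ler_wpM2l (ltW nR) nv.
  have -> : n%:R * (eps ^+ 2 * n%:R) = 4 * (1 / 4 * (eps ^+ 2 * n%:R ^+ 2)) by field.
  by rewrite mulrCA ler_pM2l.
have h2 : (\sum_(l <- words N n) wprod p l * Mh h l) / (4 * n.+1%:R) <= 1 / 4.
  rewrite ler_pdivrMr ?mulr_gt0 ?ltr0n // mulrA.
  have -> : 1 / 4 * 4 * n.+1%:R = n.+1%:R :> R by field.
  exact: sum_Mh.
move: H h1 h2; move: (n%:R * v / _) (_ / (4 * n.+1%:R)) => a b.
move: (\sum_(i <- _) _) => g; lra.
Qed.

End Words.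


Section FiniteTilting.
Context {R : realType}.
Local Open Scope ring_scope.

Lemma expR_le_quadratic (y : R) : y <= 1 / 2 -> expR y <= 1 + y + 2 * y ^+ 2.
Proof.
move=> y12; have [y0|y0] := leP 0 y; last first.
  have := @expRN_le_quadratic R (- y); rewrite opprK sqrrN => /(_ _).
  have yn : 0 <= - y by lra.
  move=> /(_ yn) H; have := sqr_ge0 y; lra.
have y1 : 0 < 1 - y by lra.
have h : expR y <= (1 - y)^-1.
  rewrite -[leLHS]invrK -expRN lef_pV2 ?posrE ?expR_gt0 //.
  by apply: le_trans (expR_ge1Dx _); lra.
apply: (le_trans h); rewrite -[leLHS]mul1r ler_pdivrMr //.
have : 0 <= y ^+ 2 * (1 - 2 * y) by rewrite mulr_ge0 ?sqr_ge0 //; lra.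
lra.
Qed.

Lemma small_step (K A c : R) : 0 <= K -> 0 <= A -> 0 < c ->
  exists t : R, [/\ 0 < t, t * K <= 1 / 2, t * A <= 1 & t <= c].
Proof.
move=> K0 A0 c0; have ci : 0 < c^-1 by rewrite invr_gt0.
have s0 : 0 < 2 * K + A + c^-1 by lra.
exists (2 * K + A + c^-1)^-1; split.
- by rewrite invr_gt0.
- by rewrite mulrC ler_pdivrMr //; lra.
- by rewrite mulrC ler_pdivrMr //; lra.
- by rewrite -[leRHS]invrK lef_pV2 ?posrE //; lra.
Qed.

Context (N : nat).

Lemma finite_bound (F : nat -> R) : exists2 K : R, 0 <= K &
  forall x, (x < N)%N -> `|F x| <= K.
Proof.
exists (\sum_(0 <= x < N) `|F x|); first exact: sumr_ge0.
move=> x xN; rewrite (bigD1_seq x) ?mem_index_iota ?iota_uniq //=.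
by rewrite lerDl sumr_ge0.
Qed.

Lemma expsum_expand (w F : nat -> R) (s K : R) : (forall x, 0 <= w x) ->
  (forall x, (x < N)%N -> `|F x| <= K) -> `|s| * K <= 1 / 2 ->
  \sum_(0 <= x < N) w x * expR (s * F x) <=
  \sum_(0 <= x < N) w x + s * (\sum_(0 <= x < N) w x * F x) +
    2 * s ^+ 2 * (\sum_(0 <= x < N) w x * F x ^+ 2).
Proof.
move=> w0 FK sK.
rewrite !mulr_sumr -!big_split /= big_nat_cond [leRHS]big_nat_cond.
apply: ler_sum => x; rewrite andbT => /andP[_ xN].
have : s * F x <= 1 / 2.
  apply: le_trans sK; apply: (le_trans (ler_norm _)); rewrite normrM.
  by rewrite ler_wpM2l // FK.
move=> /expR_le_quadratic /(ler_wpM2l (w0 x)) H; apply: (le_trans H).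
by rewrite le_eqVlt; apply/orP; left; apply/eqP; ring.
Qed.

Lemma negative_exponent (p xv : nat -> R) (m : R) : (forall x, 0 <= p x) ->
  \sum_(0 <= x < N) p x = 1 -> \sum_(0 <= x < N) p x * xv x = m -> 0 < m ->
  exists2 h : R, 0 < h & \sum_(0 <= x < N) p x * expR (- h * xv x) <= 1.
Proof.
move=> p0 p1 pm m0; have [K K0 xK] := finite_bound xv.
set q := \sum_(0 <= x < N) p x * xv x ^+ 2.
have q0 : 0 <= q by apply: sumr_ge0 => x _; rewrite mulr_ge0 ?sqr_ge0.
have [|t [t0 tK tq _]] := @small_step K (2 * q / m) 1 K0 _ ltr01.
  by rewrite divr_ge0 ?mulr_ge0 // ltW.
exists t => //; apply: (le_trans (expsum_expand p0 xK _)).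
  by rewrite normrN gtr0_norm.
rewrite p1 pm -/q sqrrN.
have : t * (2 * q) <= m by move: tq; rewrite mulrA ler_pdivrMr // mul1r.
move=> /(ler_wpM2l (ltW t0)) H.
have -> : 1 + - t * m + 2 * t ^+ 2 * q = 1 + (t * (t * (2 * q)) - t * m) by ring.
by rewrite gerDl subr_le0.
Qed.

(* Optimality on the half-line [lam <= 0]: complementary slackness. *)
Lemma first_order (mu F : nat -> R) (lam : R) : (forall x, 0 <= mu x) -> lam <= 0 ->
  (forall l, l <= 0 -> \sum_(0 <= x < N) mu x * expR (lam * F x) <=
     \sum_(0 <= x < N) mu x * expR (l * F x)) ->
  let D := \sum_(0 <= x < N) mu x * expR (lam * F x) * F x in
  D <= 0 /\ lam * D = 0.
Proof.
move=> mu0 l0 min D; have [K K0 FK] := finite_bound F.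
pose w x := mu x * expR (lam * F x).
have w0 x : 0 <= w x by rewrite mulr_ge0 ?expR_ge0.
set Q := \sum_(0 <= x < N) w x * F x ^+ 2.
have Q0 : 0 <= Q by apply: sumr_ge0 => x _; rewrite mulr_ge0 ?sqr_ge0.
have step s : `|s| * K <= 1 / 2 -> lam + s <= 0 -> 0 <= s * D + 2 * s ^+ 2 * Q.
  move=> sK ls; have := min _ ls.
  have -> : \sum_(0 <= x < N) mu x * expR ((lam + s) * F x) =
      \sum_(0 <= x < N) w x * expR (s * F x).
    by apply: eq_bigr => x _; rewrite /w -mulrA -expRD mulrDl.
  move=> /le_trans/(_ (expsum_expand w0 FK sK)).
  by rewrite -/D -/Q -addrA lerDl.
have D0 : D <= 0.
  rewrite leNgt; apply/negP => D0.
  have [|t [t0 tK tq _]] := @small_step K (4 * Q / D) 1 K0 _ ltr01.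
    by rewrite divr_ge0 ?mulr_ge0 // ltW.
  have := step (- t); rewrite normrN gtr0_norm // => /(_ tK).
  have lt0 : lam + - t <= 0 by lra.
  move=> /(_ lt0); rewrite sqrrN.
  have -> : - t * D + 2 * t ^+ 2 * Q = t * (2 * (t * Q) - D) by ring.
  rewrite pmulr_rge0 //.
  have : t * (4 * Q) <= D by move: tq; rewrite mulrA ler_pdivrMr // mul1r.
  lra.
split=> //; have [lt0|ge0] := ltP lam 0; last first.
  by rewrite (le_anti (introT andP (conj l0 ge0))) mul0r.
suff -> : D = 0 by rewrite mulr0.
apply/le_anti; rewrite D0 leNgt /=; apply/negP => Dn.
have Dn' : 0 < - D by lra.
have nl0 : 0 < - lam by lra.
have [|t [t0 tK tq tl]] := @small_step K (4 * Q / - D) (- lam) K0 _ nl0.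
  by rewrite divr_ge0 ?mulr_ge0 // ltW.
have := step t; rewrite gtr0_norm // => /(_ tK).
have lt0' : lam + t <= 0 by lra.
move=> /(_ lt0').
have -> : t * D + 2 * t ^+ 2 * Q = t * (2 * (t * Q) + D) by ring.
rewrite pmulr_rge0 //.
have : t * (4 * Q) <= - D by move: tq; rewrite mulrA ler_pdivrMr // mul1r.
lra.
Qed.

End FiniteTilting.

Section WordSurvival.
Context {R : realType}.
Local Open Scope ring_scope.
Context (xv : nat -> R) (c : R).
Hypothesis c1 : 1 <= c.

(* [1 / Vw l] bounds from below the quenched survival probability of a single
   line in the environments [l]. *)
Fixpoint Vw (l : seq nat) : R :=
  if l is x :: l' then expR (- xv x) * Vw l' + c * (expR (- xv x) + 1) else 1.

Lemma Vw_ge1 l : 1 <= Vw l.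
Proof.
elim: l => [|x l IH] //=; have e0 := expR_ge0 (- xv x).
have : 0 <= expR (- xv x) * Vw l by rewrite mulr_ge0 //; lra.
have c0 : 0 <= c by exact: le_trans ler01 c1.
have : 0 <= c * expR (- xv x) by rewrite mulr_ge0.
move: (expR _) (Vw l) => a b; move: c1; rewrite mulrDr mulr1; lra.
Qed.

Lemma Vw_le h l : 0 < h ->
  Vw l <= (1 + 2 * c * (size l)%:R) * expR (ln (Mh xv h l) / h).
Proof.
move=> h0; elim: l => [|x l IH].
  by rewrite /= ln1 mul0r expR0 mulr0 addr0 mulr1.
set M := Mh xv h l; set M' := Mh xv h (x :: l).
have M1 : 1 <= M := Mh_ge1 xv h l.
have M'1 : 1 <= M' := Mh_ge1 xv h (x :: l).
have M0 : 0 < M by lra.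
have M'0 : 0 < M' by lra.
have e1 : 1 <= expR (ln M / h).
  by rewrite -[leLHS]expR0 ler_expR divr_ge0 ?(ltW h0) // ln_ge0.
have e1' : 1 <= expR (ln M' / h).
  by rewrite -[leLHS]expR0 ler_expR divr_ge0 ?(ltW h0) // ln_ge0.
have e2 : expR (- xv x) * expR (ln M / h) <= expR (ln M' / h).
  rewrite -expRD ler_expR ler_pdivlMr // mulrDl divfK ?gt_eqF //.
  rewrite -ler_expR expRD [expR (ln M)]lnK ?posrE // [expR (ln M')]lnK ?posrE //.
  by rewrite /M' /= (_ : - xv x * h = - h * xv x) ?lerDr // mulNr mulrC mulNr.
have e0 := expR_ge0 (- xv x).
have c0 : 0 <= c by exact: le_trans ler01 c1.
have e3 : expR (- xv x) <= expR (ln M' / h).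
  by apply: le_trans e2; rewrite ler_peMr.
move: e1 e1' e2 e0 e3 IH => /=.
have -> : (size l).+1%:R = (size l)%:R + 1 :> R by rewrite natr1.
move: (expR (ln M / h)) (expR (ln M' / h)) (expR (- xv x)) (size l)%:R (ler0n R (size l)) => A A' ex s s0 e1 e1' e2 e0 e3 IH.
have h1 : ex * Vw l <= ex * ((1 + 2 * c * s) * A) by rewrite ler_wpM2l.
have h2 : (1 + 2 * c * s) * (ex * A) <= (1 + 2 * c * s) * A'.
  by rewrite ler_wpM2l // addr_ge0 // !mulr_ge0.
have h3 : c * (ex + 1) <= c * (2 * A') by rewrite ler_wpM2l //; lra.
lra.
Qed.

Lemma survival_step (u m v ex : R) : 0 < u -> 0 < m -> 0 <= v ->
  v <= c * (m + m ^+ 2) -> 0 < ex -> 1 <= m * ex ->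
  (ex / u + c * (ex + 1))^-1 <= u * m ^+ 2 / (m + u * v).
Proof.
move=> u0 m0 v0 vc ex0 mex.
have c0 : 0 < c by exact: lt_le_trans ltr01 c1.
have d0 : 0 < m + u * v by rewrite ltr_wpDr // mulr_ge0 // ltW.
have V0 : 0 < ex / u + c * (ex + 1).
  by rewrite addr_gt0 ?divr_gt0 // mulr_gt0 // addr_gt0.
rewrite ler_pdivlMr // ler_pdivrMl //.
have -> : (ex / u + c * (ex + 1)) * (u * m ^+ 2) =
   (m * ex) * m + u * (c * ((m * ex) * m + m ^+ 2)) by field; rewrite gt_eqF.
have h : m <= m * ex * m by rewrite ler_peMl // ltW.
apply: lerD => //; apply: ler_wpM2l; first exact: ltW.
apply: (le_trans vc); apply: ler_wpM2l; first exact: ltW.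
by rewrite lerD2r.
Qed.

End WordSurvival.


(* Enumeration of the integers, so that the letters [x < N] form an increasing
   family of windows. *)
Definition zigzag (n : nat) : int := if odd n then Negz n./2 else Posz n./2.

Lemma zigzag_inj : injective zigzag.
Proof.
move=> a b; rewrite /zigzag => H.
have [oE hE] : odd a = odd b /\ a./2 = b./2.
  by move: H; case: (odd a); case: (odd b) => // -[->].
by rewrite -(odd_double_half a) -(odd_double_half b) oE hE.
Qed.

Lemma zigzag_surj (k : int) : exists n, zigzag n = k.
Proof.
case: k => a; first by exists a.*2; rewrite /zigzag odd_double doubleK.
by exists a.*2.+1; rewrite /zigzag /= odd_double /= uphalf_double.
Qed.

Section Letters.
Context {R : realType} {d0 : measure_display} {Omega0 : measurableType d0}.
Context (P0 : probability Omega0 R) (Q : {mfun Omega0 >-> offspring_law R}).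
Context (c eta : R).
Hypotheses (c1 : (1 <= c)%R) (eta0 : (0 < eta)%R).
Hypothesis mreg : measurable (regular Q c).

Definition lval (n : nat) : R := ((zigzag n)%:~R * eta)%R.

Definition letter (n : nat) : set Omega0 := regular Q c `&`
  ([set w | (lval n)%:E <= X Q w] `&` [set w | X Q w < (lval n + eta)%:E]).

Definition lmass (n : nat) : R := fine (P0 (letter n)).

Lemma measurable_X : measurable_fun setT (X Q).
Proof.
apply: (measurableT_comp measurable_lne).
exact: (measurableT_comp measurable_mean (measurable_funPT Q)).
Qed.

Lemma measurable_letter n : measurable (letter n).
Proof.
have mX := measurable_X; apply: measurableI => //; apply: measurableI.
  by rewrite -[X in measurable X]setTI; exact: emeasurable_fun_c_infty.
by rewrite -[X in measurable X]setTI; exact: emeasurable_fun_infty_o.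
Qed.

Lemma lmassE n : P0 (letter n) = (lmass n)%:E.
Proof. by rewrite /lmass fineK // fin_num_measure //; exact: measurable_letter. Qed.

Lemma lmass_ge0 n : (0 <= lmass n)%R.
Proof. by rewrite -lee_fin -lmassE. Qed.

Lemma regular_X w : regular Q c w -> exists m v : R, [/\ mean (Q w) = m%:E,
  second_moment (Q w) = v%:E, (0 < m)%R, (v <= c * (m + m ^+ 2))%R & X Q w = (ln m)%:E].
Proof.
move=> [m [v [qm qv m0 vc]]]; exists m, v; split => //.
by rewrite /X /logmean qm lne_EFin.
Qed.

Lemma trivIset_letter : trivIset setT letter.
Proof.
move=> a b _ _ [w [[/regular_X[m [v [_ _ _ _ Xw]]] [/= a1 a2]] [_ [/= b1 b2]]]].
move: a1 a2 b1 b2; rewrite Xw !lee_fin !lte_fin /lval => a1 a2 b1 b2.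
apply: zigzag_inj.
have lt1 (i j : int) : (i%:~R * eta <= ln m)%R -> (ln m < j%:~R * eta + eta)%R -> (i <= j)%R.
  move=> h1 h2; rewrite -ltzD1 -(ltr_int R) intrD.
  rewrite -(ltr_pM2r eta0) mulrDl mul1r; exact: le_lt_trans h2.
by apply/le_anti; rewrite (lt1 _ _ a1 b2) (lt1 _ _ b1 a2).
Qed.

Lemma bigcup_letter : \bigcup_n letter n = regular Q c.
Proof.
apply/seteqP; split => [w [n _ []]//|w rw].
have [m [v [_ _ _ _ Xw]]] := regular_X rw.
have [n nE] := zigzag_surj (Num.floor (ln m / eta)%R).
exists n => //; split => //; split => /=; rewrite Xw ?lee_fin ?lte_fin /lval nE.
  by rewrite -ler_pdivlMr // floor_le_tmp.
by rewrite -[X in (_ + X)%R]mul1r -mulrDl -ltr_pdivrMr // -intrD1 lt_succ_floor.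
Qed.

Fixpoint pword (l : seq nat) (g : nat -> \bar R) : nat -> \bar R :=
  if l is x :: l' then pop P0 Q (letter x) (pword l' g) else g.

Lemma pword_ge0 l g z : (forall k, 0 <= g k) -> 0 <= pword l g z.
Proof. by move=> g0; elim: l z => [//|x l IH] z; exact: pop_ge0. Qed.

Lemma le_pword l g h z : (forall k, 0 <= g k) -> (forall k, g k <= h k) ->
  pword l g z <= pword l h z.
Proof.
move=> g0 gh; elim: l z => [//|x l IH] z.
apply: le_pop => [|k|k]; [exact: measurable_letter|exact: pword_ge0|exact: IH].
Qed.

Lemma pwordD l g h z : (forall k, 0 <= g k) -> (forall k, 0 <= h k) ->
  pword l (fun k => g k + h k) z = pword l g z + pword l h z.
Proof.
move=> g0 h0; elim: l z => [//|x l IH] z /=.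
have -> : pword l (fun k => g k + h k) = (fun k => pword l g k + pword l h k).
  by apply/funext.
by apply: popD; [exact: measurable_letter|move=> k; exact: pword_ge0|move=> k; exact: pword_ge0].
Qed.

Lemma pwordZ l g z (K : R) : (0 <= K)%R -> (forall k, 0 <= g k) ->
  pword l (fun k => K%:E * g k) z = K%:E * pword l g z.
Proof.
move=> K0 g0; elim: l z => [//|x l IH] z /=.
have -> : pword l (fun k => K%:E * g k) = (fun k => K%:E * pword l g k).
  by apply/funext.
by apply: popZ => //; [exact: measurable_letter|move=> k; exact: pword_ge0].
Qed.

Lemma popn_ge_words N n g z : (forall k, 0 <= g k) ->
  \sum_(l <- words N n) pword l g z <= popn P0 Q n g z.
Proof.
move=> g0; elim: n z => [|n IH] z; first by rewrite big_seq1.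
have pg0 l k : 0 <= pword l g k by exact: pword_ge0.
have -> : \sum_(l <- words N n.+1) pword l g z =
    \sum_(0 <= x < N) \sum_(l <- words N n) pop P0 Q (letter x) (pword l g) z.
  by rewrite /= big_allpairs_dep /index_iota subn0.
apply: (@le_trans _ _ (\sum_(0 <= x < N) pop P0 Q (letter x) (popn P0 Q n g) z)); last first.
  rewrite popnS; apply: pop_sum.
  - exact: measurable_letter.
  - exact: iota_uniq.
  - by apply: sub_trivIset trivIset_letter.
  - by move=> k; exact: popn_ge0.
apply: lee_sum => x _.
apply: (@le_trans _ _ (pop P0 Q (letter x) (fun k => \sum_(l <- words N n) pword l g k) z)).
  elim: (words N n) => [|l s IHs].
    by rewrite big_nil; apply: pop_ge0 => k; exact: sume_ge0.
  rewrite big_cons.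
  have -> : (fun k => \sum_(l' <- l :: s) pword l' g k) =
     (fun k => pword l g k + \sum_(l' <- s) pword l' g k).
    by apply/funext => k; rewrite big_cons.
  rewrite popD //; [|exact: measurable_letter|by move=> k; exact: sume_ge0].
  exact: leeD2l.
apply: le_pop => [|k|k]; [exact: measurable_letter|exact: sume_ge0|exact: IH].
Qed.

Let c0 : (0 < c)%R := lt_le_trans ltr01 c1.

Lemma letter_mean x w : letter x w -> exists m v : R, [/\ mean (Q w) = m%:E,
  second_moment (Q w) = v%:E, (v <= c * (m + m ^+ 2))%R,
  (expR (lval x) <= m)%R & (m <= expR (lval x + eta))%R].
Proof.
move=> [/regular_X[m [v [qm qv m0 vc Xw]]] [/=]].
rewrite Xw lee_fin lte_fin => h1 h2; exists m, v; split => //.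
  by rewrite -[leRHS](@lnK _ m) ?posrE // ler_expR.
by rewrite -[leLHS](@lnK _ m) ?posrE // ler_expR ltW.
Qed.

Definition surv (u : R) (k : nat) : \bar R := (1 - (1 - u) ^+ k)%:E.

Lemma surv_ge0 u k : (0 <= u <= 1)%R -> 0 <= surv u k.
Proof.
move=> /andP[u0 u1]; rewrite /surv lee_fin subr_ge0 exprn_ile1 //; first by rewrite subr_ge0.
by rewrite gerBl.
Qed.

Lemma pop_surv x z (V : R) : (1 <= V)%R ->
  (lmass x)%:E * surv (expR (- lval x) * V + c * (expR (- lval x) + 1))^-1 z <=
  pop P0 Q (letter x) (surv V^-1) z.
Proof.
move=> V1; have V0 : (0 < V)%R := lt_le_trans ltr01 V1.
set ex := expR (- lval x); have ex0 : (0 < ex)%R by rewrite expR_gt0.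
set V' := (ex * V + c * (ex + 1))%R.
have u01 : (0 <= V^-1 <= 1)%R by rewrite invr_ge0 (ltW V0) invf_le1.
have V'1 : (1 <= V')%R.
  rewrite /V' mulrDr mulr1 addrA; apply: (le_trans c1); rewrite lerDr.
  by rewrite addr_ge0 // mulr_ge0 // ltW.
have V'0 : (0 < V')%R := lt_le_trans ltr01 V'1.
have u01' : (0 <= V'^-1 <= 1)%R by rewrite invr_ge0 (ltW V'0) invf_le1.
rewrite muleC -lmassE; apply: pop_ge_cst.
- exact: measurable_letter.
- by move=> k; exact: surv_ge0.
- by rewrite -lee_fin; exact: surv_ge0.
move=> w /letter_mean[m [v [qm qv vc m1 m2]]].
have m0 : (0 < m)%R by apply: lt_le_trans m1; exact: expR_gt0.
have v0 : (0 < v)%R.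
  by rewrite -lte_fin -qv (lt_le_trans _ (mean_le_second_moment (Q w))) // qm lte_fin.
apply: csum_survival => //.
have d0' : (0 < m + V^-1 * v)%R by rewrite addr_gt0 // mulr_gt0 // invr_gt0.
pose a := (m / (m + V^-1 * v))%R.
have a0 : (0 <= a)%R by rewrite divr_ge0 ?ltW.
apply: (le_trans (gf_survival_le qm qv u01 a0)); rewrite lee_fin.
have -> : (1 - 2 * a * V^-1 * m + a ^+ 2 * (V^-1 * m + V^-1 ^+ 2 * v) =
   1 - V^-1 * m ^+ 2 / (m + V^-1 * v))%R.
  by rewrite /a; field; rewrite !gt_eqF //= addr_gt0 // mulr_gt0.
rewrite lerD2l lerN2 /V' -[X in (ex * X)%R]invrK.
apply: survival_step => //; rewrite ?invr_gt0 // ?(ltW v0) //.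
by rewrite -ler_pdivrMr // mul1r /ex expRN invrK.
Qed.

Lemma pword_surv l z :
  (wprod lmass l)%:E * surv (Vw lval c l)^-1 z <= pword l (surv 1) z.
Proof.
elim: l z => [|x l IH] z; first by rewrite /wprod big_nil mul1e /= invr1.
have V1 : (1 <= Vw lval c l)%R by exact: Vw_ge1.
have w0 : (0 <= wprod lmass l)%R by apply: wprod_ge0 => y; exact: lmass_ge0.
have u01 : (0 <= (Vw lval c l)^-1 <= 1)%R.
  by rewrite invr_ge0 (le_trans ler01 V1) invf_le1 // (lt_le_trans ltr01 V1).
apply: (@le_trans _ _ (pop P0 Q (letter x)
    (fun k => (wprod lmass l)%:E * surv (Vw lval c l)^-1 k) z)).
  rewrite popZ //; [|exact: measurable_letter|by move=> k; exact: surv_ge0].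
  rewrite wprod_cons mulrC EFinM -muleA lee_wpmul2l ?lee_fin //.
  exact: pop_surv.
apply: le_pop => [|k|k]; [exact: measurable_letter| |exact: IH].
by apply: mule_ge0; [rewrite lee_fin|exact: surv_ge0].
Qed.

Lemma pword_id l z : pword l (fun k => (k%:R)%:E) z <=
  (wprod lmass l * expR (wsum lval l + (size l)%:R * eta) * z%:R)%:E.
Proof.
elim: l z => [|x l IH] z.
  by rewrite /wprod /wsum !big_nil /= mul0r addr0 expR0 !mul1r.
set K := (wprod lmass l * expR (wsum lval l + (size l)%:R * eta))%R.
have K0 : (0 <= K)%R.
  by rewrite mulr_ge0 ?expR_ge0 //; apply: wprod_ge0 => y; exact: lmass_ge0.
apply: (@le_trans _ _ (pop P0 Q (letter x) (fun k => K%:E * (k%:R)%:E) z)).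
  apply: le_pop => [|k|k]; first exact: measurable_letter.
    by apply: pword_ge0 => j; rewrite lee_fin.
  by rewrite -EFinM; exact: IH.
rewrite (@popZ _ _ _ P0 Q (letter x) (fun k => (k%:R)%:E) z K) //; last exact: measurable_letter.
apply: (@le_trans _ _ (K%:E * ((z%:R * expR (lval x + eta))%:E * P0 (letter x)))).
  rewrite lee_wpmul2l ?lee_fin // -integral_cst; last exact: measurable_letter.
  apply: ge0_le_integral; do ?[exact: measurable_letter | exact: measurable_csumQ |
    exact: measurable_cst | by move=> w _; apply: csum_ge0 => k; rewrite lee_fin |
    by move=> w _; rewrite lee_fin mulr_ge0 // expR_ge0].
  move=> w /letter_mean[m [v [qm qv vc m1 m2]]].
  by rewrite (csum_id _ qm) lee_fin ler_wpM2l.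
rewrite lmassE -!EFinM lee_fin wprod_cons wsum_cons /= /K.
have -> : (lval x + wsum lval l + (size l).+1%:R * eta =
   (wsum lval l + (size l)%:R * eta) + (lval x + eta))%R by rewrite -natr1; ring.
by rewrite [in leRHS]expRD le_eqVlt; apply/orP; left; apply/eqP; ring.
Qed.

Lemma pword_upto l (a : R) z : (0 < z)%N -> (0 < a)%R ->
  (wprod lmass l * ((Vw lval c l)^-1 -
     z%:R * expR (wsum lval l + (size l)%:R * eta) / a))%:E <=
  pword l (upto a) z.
Proof.
move=> z0 a0.
have V1 : (1 <= Vw lval c l)%R by exact: Vw_ge1.
have u01 : (0 <= (Vw lval c l)^-1 <= 1)%R.
  by rewrite invr_ge0 (le_trans ler01 V1) invf_le1 // (lt_le_trans ltr01 V1).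
have w0 : (0 <= wprod lmass l)%R by apply: wprod_ge0 => y; exact: lmass_ge0.
have up0 k : 0 <= upto a k :> \bar R by exact: ind_ge0.
have id0 k : 0 <= a^-1%:E * (k%:R)%:E :> \bar R by rewrite -EFinM lee_fin mulr_ge0 ?invr_ge0 ?(ltW a0).
have H : pword l (surv 1) z <= pword l (fun k => upto a k + a^-1%:E * (k%:R)%:E) z.
  apply: le_pword => k; first by apply: surv_ge0; rewrite ler01 lexx.
  rewrite /surv subrr /upto /ind -EFinM -EFinD lee_fin.
  case: k => [|k]; first by rewrite expr0 subrr mulr0 addr0.
  rewrite expr0n subr0 /=; case: (leP k.+1%:R a) => [_|ka].
    by rewrite lerDl mulr_ge0 ?invr_ge0 // ltW.
  by rewrite add0r mulrC ler_pdivlMr // mul1r ltW.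
rewrite pwordD // in H.
have Hid : pword l (fun k => a^-1%:E * (k%:R)%:E) z <=
   (a^-1 * (wprod lmass l * expR (wsum lval l + (size l)%:R * eta) * z%:R))%:E.
  rewrite (@pwordZ l (fun k => (k%:R)%:E) z) ?invr_ge0 ?(ltW a0) // EFinM.
  by rewrite lee_wpmul2l ?lee_fin ?invr_ge0 ?(ltW a0) // pword_id.
have Hs : (wprod lmass l * (Vw lval c l)^-1)%:E <= pword l (surv 1) z.
  apply: le_trans (pword_surv l z); rewrite EFinM lee_wpmul2l ?lee_fin // /surv.
  set u := (Vw lval c l)^-1%R in u01 *.
  have /andP[u0 u1] := u01.
  have : ((1 - u) ^+ z <= 1 - u)%R.
    by case: z z0 {H Hid} => // z _; rewrite exprS ler_piMr ?exprn_ile1 ?subr_ge0 // gerBl.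
  lra.
rewrite mulrBr EFinB leeBlDr //.
apply: (le_trans Hs); apply: (le_trans H); rewrite leeD2l //.
apply: (le_trans Hid); rewrite lee_fin le_eqVlt; apply/orP; left; apply/eqP.
by field; rewrite gt_eqF.
Qed.

End Letters.


Lemma near_poly_le_expR {R : realType} (A c h kappa : R) : (0 <= A)%R -> (0 <= c)%R ->
  (0 < h)%R -> (0 < kappa)%R -> \forall n \near \oo,
  (A * ((1 + 2 * c * n%:R) * expR (ln (4 * n.+1%:R) / h)) <= expR (kappa * n%:R))%R.
Proof.
move=> A0 c0 h0 k0; pose k3 := (kappa / 3)%R.
have k30 : (0 < k3)%R by rewrite divr_gt0.
have hk0 : (0 < h * k3)%R by rewrite mulr_gt0.
near=> n.
have n1 : (1 <= n%:R :> R)%R by rewrite ler1n; near: n; exact: nbhs_infty_gt.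
have E1 : (A <= expR (k3 * n%:R))%R by near: n; exact: near_le_expR.
have E2 : ((1 + 2 * c) * n%:R <= 1 * expR (k3 * n%:R))%R.
  by near: n; exact: near_mul_le_expR.
have E3 : (8 * n%:R <= 1 * expR (h * k3 * n%:R))%R.
  by near: n; exact: near_mul_le_expR.
have -> : (kappa * n%:R = k3 * n%:R + (k3 * n%:R + k3 * n%:R))%R.
  by rewrite /k3; field.
rewrite !expRD; apply: ler_pM => //.
  by rewrite mulr_ge0 ?expR_ge0 // addr_ge0 // !mulr_ge0.
apply: ler_pM; rewrite ?expR_ge0 //; first by rewrite addr_ge0 // !mulr_ge0.
  by move: E2; rewrite mul1r mulrDl mul1r; apply: le_trans; rewrite lerD2r.
rewrite ler_expR ler_pdivrMr // -ler_expR lnK ?posrE ?mulr_gt0 ?ltr0n //.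
rewrite mul1r in E3; rewrite (_ : k3 * n%:R * h = h * k3 * n%:R)%R; last by ring.
apply: le_trans E3.
have -> : (n.+1%:R = n%:R + 1 :> R)%R by rewrite natr1.
by move: n1; move: n%:R => y; lra.
Unshelve. all: by end_near. Qed.

Section TiltedLower.
Context {R : realType} {d0 : measure_display} {Omega0 : measurableType d0}.
Context (P0 : probability Omega0 R) (Q : {mfun Omega0 >-> offspring_law R}).
Context (c eta : R).
Hypotheses (c1 : (1 <= c)%R) (eta0 : (0 < eta)%R).
Hypothesis mreg : measurable (regular Q c).

Local Notation lmass := (lmass P0 Q c eta).
Local Notation lval := (lval eta).

Definition expsum (theta : R) (N : nat) (lam : R) : R :=
  (\sum_(0 <= x < N) lmass x * expR (lam * (lval x - theta)))%R.

Lemma wprod_tilt (theta lam f : R) l : (0 < f)%R ->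
  wprod lmass l = (f ^+ size l *
    wprod (fun x => lmass x * expR (lam * (lval x - theta)) / f) l *
    expR (- lam * (wsum lval l - (size l)%:R * theta)))%R.
Proof.
move=> f0; elim: l => [|x l IH].
  by rewrite /wprod /wsum !big_nil /= expr0 !mul0r subr0 mulr0 expR0 !mulr1.
rewrite !wprod_cons wsum_cons IH /= exprS.
have -> : (- lam * (lval x + wsum lval l - (size l).+1%:R * theta) =
   - (lam * (lval x - theta)) + - lam * (wsum lval l - (size l)%:R * theta))%R.
  by rewrite -natr1; ring.
rewrite [in RHS]expRD expRN; field.
by rewrite !gt_eqF // expR_gt0.
Qed.

Lemma tilted_lower (N : nat) (theta lam nu : R) z : (0 < z)%N -> (0 < theta)%R ->
  (lam <= 0)%R -> (0 < expsum theta N lam)%R ->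
  (forall l, (l <= 0)%R -> (expsum theta N lam <= expsum theta N l)%R) ->
  (0 < \sum_(0 <= x < N) lmass x * lval x)%R -> (0 < nu)%R ->
  \forall n \near \oo,
    (expR ((ln (expsum theta N lam) - nu) * n%:R))%:E <=
    popn P0 Q n (upto (expR ((theta + 2 * eta) * n%:R))) z.
Proof.
move=> z0 th0 l0 f0 fmin mpos nu0.
set f := expsum theta N lam in f0 *.
pose p x := (lmass x * expR (lam * (lval x - theta)) / f)%R.
have mu0 x : (0 <= lmass x)%R by exact: lmass_ge0.
have p0 x : (0 <= p x)%R by rewrite divr_ge0 ?mulr_ge0 ?expR_ge0 // ltW.
have p1 : (\sum_(0 <= x < N) p x = 1)%R.
  by rewrite -mulr_suml mulfV // gt_eqF.
set m := (\sum_(0 <= x < N) p x * lval x)%R.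
have [D0 lD0] := first_order mu0 l0 fmin.
have DE : (\sum_(0 <= x < N) lmass x * expR (lam * (lval x - theta)) * (lval x - theta) =
    f * (m - theta))%R.
  have -> : (m - theta = \sum_(0 <= x < N) p x * (lval x - theta))%R.
    under eq_bigr do rewrite mulrBr.
    by rewrite sumrB -mulr_suml p1 mul1r.
  rewrite mulr_sumr; apply: eq_bigr => x _.
  by rewrite /p; field; rewrite gt_eqF.
rewrite DE in D0 lD0.
have mth : (m <= theta)%R by move: D0; rewrite pmulr_rle0 // subr_le0.
have lmth : (lam * (m - theta) = 0)%R.
  by move/eqP: lD0; rewrite mulrCA mulf_eq0 gt_eqF //= => /eqP.
have m0 : (0 < m)%R.
  have [lam0|lam_ge0] := ltP lam 0%R.
    move/eqP: lmth; rewrite mulf_eq0 lt_eqF //= subr_eq0 => /eqP ->; exact: th0.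
  have lE : lam = 0%R by apply/le_anti; rewrite l0 lam_ge0.
  have -> : m = ((\sum_(0 <= x < N) lmass x * lval x) / f)%R.
    rewrite /m mulr_suml; apply: eq_bigr => x _.
    by rewrite /p lE mul0r expR0 mulr1 mulrAC.
  by rewrite divr_gt0.
have [h h0 ph] := negative_exponent p0 p1 (erefl m) m0.
set v := (\sum_(0 <= x < N) p x * (lval x - m) ^+ 2)%R.
have [|||eps [eps0 epsnu _ epseta]] := @small_step R (`|lam| / nu) 0 (eta / 2).
- by rewrite divr_ge0 // ltW.
- by [].
- by rewrite divr_gt0.
have leps : (`|lam| * eps <= nu / 2)%R.
  by move: epsnu; rewrite mulrA ler_pdivrMr // mulrC mul1r [(2^-1 * _)%R]mulrC.
have e20 : (0 < eta / 2)%R by rewrite divr_gt0.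
have n20 : (0 < nu / 2)%R by rewrite divr_gt0.
have c0 : (0 <= c)%R := le_trans ler01 c1.
near=> n.
have n1 : (0 < n)%N by near: n; exact: nbhs_infty_gt.
have nv : (4 * v <= eps ^+ 2 * n%:R)%R.
  rewrite [leRHS]mulrC -ler_pdivrMr ?exprn_gt0 //.
  by near: n; exact: nbhs_infty_ger.
have V1 : (2 * z%:R * ((1 + 2 * c * n%:R) * expR (ln (4 * n.+1%:R) / h)) <=
   expR (eta / 2 * n%:R))%R by near: n; apply: near_poly_le_expR => //; rewrite mulr_ge0.
have V2 : (4 * ((1 + 2 * c * n%:R) * expR (ln (4 * n.+1%:R) / h)) <=
   expR (nu / 2 * n%:R))%R by near: n; exact: near_poly_le_expR.
move: V1 V2; set Vn := ((1 + 2 * c * n%:R) * expR (ln (4 * n.+1%:R) / h))%R => V1 V2.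
have Vn0 : (0 < Vn)%R.
  by rewrite mulr_gt0 ?expR_gt0 // ltr_pwDl // !mulr_ge0.
set a := expR ((theta + 2 * eta) * n%:R); have a0 : (0 < a)%R by rewrite expR_gt0.
have up0 k : 0 <= upto a k :> \bar R by exact: ind_ge0.
apply: le_trans (popn_ge_words P0 eta0 mreg N n z up0).
have G := good_prob p0 p1 n1 eps0 (erefl m) (erefl v) ph nv.
pose Cn := (f ^+ n * expR (- (nu / 2) * n%:R) * (2 * Vn)^-1)%R.
have fn0 : (0 <= f ^+ n)%R by rewrite exprn_ge0 // ltW.
have i0 : (0 <= (2 * Vn)^-1)%R by rewrite invr_ge0 mulr_ge0 // ltW.
have Cn0 : (0 <= Cn)%R by rewrite /Cn mulr_ge0 // mulr_ge0 // expR_ge0.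
have word_lb l : l \in words N n -> good lval m eps h n l ->
    (Cn * wprod p l)%:E <= pword P0 Q c eta l (upto a) z.
  move=> lw; rewrite /good => /andP[gS gM]; have [ls _] := size_words lw.
  apply: le_trans (pword_upto P0 eta c1 mreg l z0 a0); rewrite lee_fin.
  rewrite (wprod_tilt theta lam l f0) ls -/p.
  have wp0 : (0 <= wprod p l)%R by exact: wprod_ge0.
  set S := wsum lval l in gS *.
  have VV : (Vw lval c l <= Vn)%R.
    apply: (le_trans (Vw_le lval c1 l h0)); rewrite ls /Vn ler_wpM2l //.
      by rewrite addr_ge0 // !mulr_ge0.
    have M1 := Mh_ge1 lval h l.
    rewrite ler_expR ler_wpM2r ?invr_ge0 ?(ltW h0) // ler_ln ?posrE //.
    exact: lt_le_trans ltr01 M1.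
  have Vw1 : (1 <= Vw lval c l)%R by exact: Vw_ge1.
  have iV : (Vn^-1 <= (Vw lval c l)^-1)%R.
    by rewrite lef_pV2 ?posrE // (lt_le_trans ltr01 Vw1).
  have Sm : (S <= n%:R * m + eps * n%:R)%R.
    by rewrite -lerBlDl; apply: le_trans gS; exact: ler_norm.
  have pe1 : (z%:R * expR (S + n%:R * eta) / a <= (2 * Vn)^-1)%R.
    rewrite /a -mulrA -expRN -expRD.
    apply: (@le_trans _ _ (z%:R * expR (- (eta / 2 * n%:R)))%R).
      rewrite ler_wpM2l // ler_expR.
      have h1 : (n%:R * m <= n%:R * theta)%R by rewrite ler_wpM2l.
      have h2 : (eps * n%:R <= eta / 2 * n%:R)%R by rewrite ler_wpM2r.
      apply: (@le_trans _ _ (n%:R * theta + eta / 2 * n%:R + n%:R * eta -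
         (theta + 2 * eta) * n%:R)%R).
        by rewrite lerD2r lerD2r (le_trans Sm) // lerD.
      by rewrite le_eqVlt; apply/orP; left; apply/eqP; field.
    rewrite expRN ler_pdivrMr ?expR_gt0 // ler_pdivlMl; last by rewrite mulr_gt0.
    by apply: le_trans V1; rewrite le_eqVlt; apply/orP; left; apply/eqP; ring.
  have tilt : (expR (- (nu / 2) * n%:R) <= expR (- lam * (S - n%:R * theta)))%R.
    rewrite ler_expR.
    have -> : (- lam * (S - n%:R * theta) = - (lam * (S - n%:R * m)) - n%:R * (lam * (m - theta)))%R by ring.
    rewrite lmth mulr0 subr0 mulNr lerN2; apply: (le_trans (ler_norm _)).
    rewrite normrM; apply: (@le_trans _ _ (`|lam| * (eps * n%:R))%R).
      by rewrite ler_wpM2l.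
    by rewrite mulrA ler_wpM2r.
  have br : ((2 * Vn)^-1 <= (Vw lval c l)^-1 - z%:R * expR (S + n%:R * eta) / a)%R.
    have E2 : (Vn^-1 = (2 * Vn)^-1 + (2 * Vn)^-1)%R by field; rewrite gt_eqF.
    by rewrite lerBrDr; apply: le_trans iV; rewrite [leRHS]E2 lerD2l; exact: pe1.
  rewrite /Cn.
  have -> : (f ^+ n * expR (- (nu / 2) * n%:R) * (2 * Vn)^-1 * wprod p l =
    f ^+ n * wprod p l * expR (- (nu / 2) * n%:R) * (2 * Vn)^-1)%R by ring.
  have fw0 : (0 <= f ^+ n * wprod p l)%R by rewrite mulr_ge0.
  apply: ler_pM => //; first by rewrite mulr_ge0 // expR_ge0.
  by rewrite ler_wpM2l.
apply: (@le_trans _ _ (\sum_(l <- words N n | good lval m eps h n l) (Cn * wprod p l)%:E)).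
  rewrite sumEFin lee_fin -mulr_sumr.
  apply: (@le_trans _ _ (Cn * (1 / 2))%R); last by rewrite ler_wpM2l.
  have -> : (expR ((ln f - nu) * n%:R) = expR (- nu * n%:R) * f ^+ n)%R.
    by rewrite mulrDl expRD [LHS]mulrC [(ln f * _)%R]mulrC expRM_natl lnK ?posrE.
  have -> : (Cn * (1 / 2) = expR (- (nu / 2) * n%:R) * (4 * Vn)^-1 * f ^+ n)%R.
    by rewrite /Cn; field; rewrite gt_eqF.
  rewrite ler_wpM2r ?exprn_ge0 ?(ltW f0) //.
  have -> : (- nu * n%:R = - (nu / 2) * n%:R + - (nu / 2 * n%:R))%R by field.
  rewrite expRD ler_wpM2l ?expR_ge0 // expRN lef_pV2 ?posrE ?expR_gt0 //.
  by rewrite mulr_gt0.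
rewrite big_mkcond big_seq [leRHS]big_seq; apply: lee_sum => l lw.
by case: ifP => [gl|_]; [exact: word_lb | exact: pword_ge0].
Unshelve. all: by end_near. Qed.

End TiltedLower.


Section LowerRate.
Context {R : realType} {d0 : measure_display} {Omega0 : measurableType d0}.
Context (P0 : probability Omega0 R) (Q : {mfun Omega0 >-> offspring_law R}).
Context (c : R).
Hypothesis c1 : (1 <= c)%R.
Hypothesis mreg : measurable (regular Q c).
Hypothesis regP : P0 (~` regular Q c) = 0.

Section Mesh.
Context (eta : R).
Hypothesis eta0 : (0 < eta)%R.

Local Notation letter := (letter Q c eta).
Local Notation lmass := (lmass P0 Q c eta).
Local Notation lval := (lval eta).

Lemma integral_letters (f : Omega0 -> \bar R) : measurable_fun setT f ->
  (forall w, 0 <= f w) -> \int[P0]_w f w = \sum_(0 <= n <oo) \int[P0]_(w in letter n) f w.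
Proof.
move=> mf f0.
rewrite (@ge0_negligible_integral _ _ _ _ setT (~` regular Q c)) //; last exact: measurableC.
rewrite setDE setCK setTI -(bigcup_letter Q c eta0).
apply: ge0_integral_bigcup => //.
- by move=> k; exact: measurable_letter.
- exact: measurable_funTS.
- exact: trivIset_letter.
Qed.

Lemma sum_lmass_le1 N : (\sum_(0 <= x < N) lmass x <= 1)%R.
Proof.
have ml n : measurable (letter n) by exact: measurable_letter.
rewrite -lee_fin -sumEFin; under eq_bigr do rewrite -lmassE //.
apply: (@le_trans _ _ (\sum_(0 <= x <oo) P0 (letter x))).
  exact: nneseries_lim_ge.
rewrite -measure_semi_bigcup //; [|exact: trivIset_letter|exact: bigcup_measurable].
by apply: probability_le1; exact: bigcup_measurable.
Qed.

Lemma sum_lval_gt0 : 2 * eta%:E + \int[P0]_w (X Q)^\- w < \int[P0]_w (X Q)^\+ w ->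
  exists N0, forall N, (N0 <= N)%N -> (0 < \sum_(0 <= x < N) lmass x * lval x)%R.
Proof.
move=> H.
have mX := measurable_X Q.
have mXp := measurable_funepos mX; have mXn := measurable_funeneg mX.
have ml n : measurable (letter n) by exact: measurable_letter.
have intp n : \int[P0]_(w in letter n) (X Q)^\+ w <=
    (lmass n * Num.max (lval n) 0 + eta * lmass n)%:E.
  rewrite mulrC -mulrDl EFinM -(lmassE P0 eta mreg) -integral_cst //.
  apply: ge0_le_integral => //; first exact: measurable_funTS.
  move=> w [/regular_X[m [v [_ _ _ _ Xw]]] []]; rewrite /= Xw !lee_fin lte_fin => h1 h2.
  rewrite funeposE Xw -EFin_max lee_fin ge_max; apply/andP; split.
    by apply: (le_trans (ltW h2)); rewrite lerD2r le_max lexx.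
  by rewrite addr_ge0 // ?(ltW eta0) // le_max lexx orbT.
have intn n : (lmass n * Num.max (- lval n) 0)%:E <=
    \int[P0]_(w in letter n) (X Q)^\- w + (eta * lmass n)%:E.
  have -> : (eta * lmass n)%:E = \int[P0]_(w in letter n) eta%:E.
    by rewrite EFinM -(lmassE P0 eta mreg) -integral_cst.
  rewrite -ge0_integralD //; [|exact: measurable_funTS|by move=> w _; rewrite lee_fin ltW].
  rewrite mulrC EFinM -(lmassE P0 eta mreg) -integral_cst //.
  apply: ge0_le_integral => //.
  - by move=> w _; rewrite lee_fin le_max lexx orbT.
  - apply: emeasurable_funD => //; exact: measurable_funTS.
  move=> w [/regular_X[m [v [_ _ _ _ Xw]]] []]; rewrite /= Xw !lee_fin lte_fin => h1 h2.
  rewrite funenegE Xw -EFinN -EFin_max -EFinD lee_fin ge_max; apply/andP; split.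
    apply: (@le_trans _ _ (- ln m + eta)%R); last by rewrite lerD2r le_max lexx.
    by rewrite -lerBlDr -opprD lerN2 ltW.
  by rewrite addr_ge0 // ?(ltW eta0) // le_max lexx orbT.
have in0 n : 0 <= \int[P0]_(w in letter n) (X Q)^\- w by exact: integral_ge0.
have ip0 n : 0 <= \int[P0]_(w in letter n) (X Q)^\+ w by exact: integral_ge0.
have mu0 x : (0 <= lmass x)%R by exact: lmass_ge0.
set p := \int[P0]_w (X Q)^\+ w in H; set q := \int[P0]_w (X Q)^\- w in H.
have q0 : 0 <= q by exact: integral_ge0.
have qfin : q \is a fin_num.
  rewrite ge0_fin_numE // ltNge leye_eq; apply/negP => /eqP qE.
  by move: H; rewrite qE addey // => /lt_le_trans/(_ (leey _)); rewrite ltxx.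
pose S1 N := (\sum_(0 <= x < N) lmass x * Num.max (lval x) 0)%R.
pose S2 N := (\sum_(0 <= x < N) lmass x * Num.max (- lval x) 0)%R.
have S2q N : (S2 N <= fine q + eta)%R.
  rewrite -lee_fin EFinD fineK // /S2 -sumEFin.
  apply: (@le_trans _ _ (\sum_(0 <= x < N) (\int[P0]_(w in letter x) (X Q)^\- w + (eta * lmass x)%:E))).
    by apply: lee_sum.
  rewrite big_split /= leeD //.
    rewrite /q (integral_letters mXn) //; exact: nneseries_lim_ge.
  rewrite sumEFin lee_fin -mulr_sumr -[leRHS]mulr1 ler_wpM2l ?(ltW eta0) //.
  exact: sum_lmass_le1.
have [N0 HN0] : exists N0, (fine q + eta < S1 N0)%R.
  apply: contrapT => no.
  have {}no N : (S1 N <= fine q + eta)%R.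
    by rewrite leNgt; apply/negP => ?; apply: no; exists N.
  move: H; apply/negP; rewrite -leNgt /p (integral_letters mXp) //.
  apply: lime_le; first exact: is_cvg_nneseries.
  near=> N; apply: (@le_trans _ _ (S1 N + eta)%:E).
    apply: (@le_trans _ _ (\sum_(0 <= x < N) (lmass x * Num.max (lval x) 0 + eta * lmass x)%:E)).
      by apply: lee_sum.
    rewrite sumEFin big_split /= lee_fin lerD2l -mulr_sumr -[leRHS]mulr1.
    by rewrite ler_wpM2l ?(ltW eta0) //; exact: sum_lmass_le1.
  rewrite -[q]fineK // -EFinM -EFinD lee_fin.
  by move: (no N); move: (fine q) (S1 N) => x y; lra.
exists N0 => N N0N.
have -> : (\sum_(0 <= x < N) lmass x * lval x = S1 N - S2 N)%R.
  rewrite /S1 /S2 -sumrB; apply: eq_bigr => x _; rewrite -mulrBr; congr (_ * _)%R.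
  by have [l0|l0] := leP 0%R (lval x); [rewrite max_r|rewrite max_l]; rewrite ?oppr_le0 ?oppr_ge0 ?(ltW l0) //; ring.
rewrite subr_gt0; apply: (le_lt_trans (S2q N)); apply: (lt_le_trans HN0).
rewrite /S1 (big_cat_nat _ N0N) //= lerDl sumr_ge0 // => x _.
by rewrite mulr_ge0 // le_max lexx orbT.
Unshelve. all: by end_near. Qed.

Lemma expsum_continuous theta N : continuous (expsum P0 Q c eta theta N).
Proof.
rewrite /expsum; elim: N => [|N IH] l.
  under [X in continuous_at _ X]eq_fun do rewrite big_geq //.
  exact: cvg_cst.
under [X in continuous_at _ X]eq_fun do rewrite big_nat_recr //=.
apply: cvgD; first exact: IH.
apply: cvgM; first exact: cvg_cst.
apply: (cvg_comp (fun l => l * (lval N - theta))%R expR); last exact: continuous_expR.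
by apply: cvgM; [exact: cvg_id|exact: cvg_cst].
Qed.

Lemma expsum_mono theta N M l : (N <= M)%N ->
  (expsum P0 Q c eta theta N l <= expsum P0 Q c eta theta M l)%R.
Proof.
move=> NM; rewrite /expsum (big_cat_nat _ NM) //= lerDl sumr_ge0 // => x _.
by rewrite mulr_ge0 ?lmass_ge0 ?expR_ge0.
Qed.

Lemma mgf_le_expsum theta l G : (l <= 0)%R ->
  (forall N, expsum P0 Q c eta theta N l <= G)%R ->
  mgf_X P0 Q l <= (G * expR (l * theta))%:E.
Proof.
move=> l0 H; have mX := measurable_X Q.
have ml n : measurable (letter n) by exact: measurable_letter.
have me : measurable_fun setT (fun w => expeR (l%:E * X Q w)).
  by apply: (measurableT_comp measurable_expeR); exact: measurable_funeM.
rewrite /mgf_X integral_letters //; last by move=> w; exact: expeR_ge0.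
apply: lime_le.
  by apply: is_cvg_nneseries => n _ _; apply: integral_ge0 => w _; exact: expeR_ge0.
near=> N; apply: (@le_trans _ _ (expsum P0 Q c eta theta N l * expR (l * theta))%:E); last first.
  by rewrite lee_fin ler_wpM2r ?expR_ge0.
rewrite /expsum mulr_suml -sumEFin; apply: lee_sum => n _.
rewrite -mulrA -expRD (_ : l * (lval n - theta) + l * theta = l * lval n)%R; last by ring.
rewrite mulrC EFinM -(lmassE P0 eta mreg) -integral_cst //.
apply: ge0_le_integral => //.
- by move=> w _; exact: expeR_ge0.
- exact: measurable_funTS.
move=> w [/regular_X[m [v [_ _ _ _ Xw]]] []]; rewrite /= Xw !lee_fin => h1 _.
by rewrite ler_expR ler_wnM2l.
Unshelve. all: by end_near. Qed.

Hypothesis hneg : 0 < P0 [set w | X Q w < 0].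

Lemma negative_letter : exists2 x, (0 < lmass x)%R & (lval x < 0)%R.
Proof.
have ml n : measurable (letter n) by exact: measurable_letter.
have mneg : measurable [set w | X Q w < 0].
  by rewrite -[X in measurable X]setTI; apply: emeasurable_fun_infty_o => //; exact: measurable_X.
have [n Hn] : exists n, 0 < P0 (letter n `&` [set w | X Q w < 0]).
  apply: measure_bigcup_gt0; first by move=> n; exact: measurableI.
  rewrite -setI_bigcupl (bigcup_letter Q c eta0).
  apply: (lt_le_trans hneg).
  have mC : measurable (~` regular Q c) by exact: measurableC.
  apply: (@le_trans _ _ (P0 (([set w | X Q w < 0] `&` regular Q c) `|` ~` regular Q c))).
    have mU : measurable (([set w | X Q w < 0] `&` regular Q c) `|` ~` regular Q c).
      by apply: measurableU => //; exact: measurableI.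
    apply: le_measure; rewrite ?inE //.
    by move=> w Xw; have [rw|rw] := pselect (regular Q c w); [left|right].
  apply: (@le_trans _ _ (P0 ([set w | X Q w < 0] `&` regular Q c) + P0 (~` regular Q c))).
    by apply: measureU2 => //; exact: measurableI.
  by rewrite regP adde0 setIC.
exists n.
  rewrite -lte_fin -(lmassE P0 eta mreg); apply: (lt_le_trans Hn).
  by apply: le_measure; rewrite ?inE //; exact: measurableI.
have [w [[_ [/= lX _]] /= X0]] : exists w, (letter n `&` [set w | X Q w < 0]) w.
  by apply/set0P/eqP => E; move: Hn; rewrite E measure0 ltxx.
by rewrite -lte_fin; exact: le_lt_trans X0.
Qed.

Lemma expsum_minimizer theta : (0 < theta)%R -> exists r N0, (0 <= r)%R /\ forall N, (N0 <= N)%N ->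
  exists2 lam, (- r <= lam <= 0)%R & (0 < expsum P0 Q c eta theta N lam)%R /\
    forall l, (l <= 0)%R -> (expsum P0 Q c eta theta N lam <= expsum P0 Q c eta theta N l)%R.
Proof.
move=> th0; have [y muy ly] := negative_letter.
have gap : (0 < theta - lval y)%R by rewrite subr_gt0 (lt_trans ly).
have mu0 x : (0 <= lmass x)%R by exact: lmass_ge0.
have coer N l : (y < N)%N ->
    (lmass y * expR (l * (lval y - theta)) <= expsum P0 Q c eta theta N l)%R.
  move=> yN; rewrite /expsum (bigD1_seq y) ?mem_index_iota ?iota_uniq //=.
  by rewrite lerDl sumr_ge0 // => x _; rewrite mulr_ge0 ?expR_ge0.
have e01 N : (expsum P0 Q c eta theta N 0 <= 1)%R.
  rewrite /expsum; under eq_bigr do rewrite mul0r expR0 mulr1.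
  exact: sum_lmass_le1.
have muy1 : (lmass y <= 1)%R.
  rewrite -lee_fin -(lmassE P0 eta mreg); apply: probability_le1; exact: measurable_letter.
pose r := (- ln (lmass y) / (theta - lval y))%R.
have r0 : (0 <= r)%R by rewrite divr_ge0 ?(ltW gap) // oppr_ge0 ln_le0.
exists r, y.+1; split=> // N yN.
have r0' : (- r <= 0)%R by rewrite oppr_le0.
have [lam lamI lmin] := EVT_min r0' (continuous_subspaceT (@expsum_continuous theta N)).
rewrite in_itv /= in lamI; exists lam => //; split.
  apply: lt_le_trans (coer N lam yN); by rewrite mulr_gt0 ?expR_gt0.
move=> l l0; have [lr|lr] := leP (- r)%R l; first by apply: lmin; rewrite in_itv /= lr l0.
apply: (@le_trans _ _ (expsum P0 Q c eta theta N 0)).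
  by apply: lmin; rewrite in_itv /= oppr_le0 r0 lexx.
apply: (le_trans (e01 N)); apply: le_trans (coer N l yN).
rewrite -ler_pdivrMl // mulr1 -[leLHS]lnK ?posrE ?invr_gt0 // ler_expR lnV ?posrE //.
have -> : (l * (lval y - theta) = (- l) * (theta - lval y))%R by ring.
by rewrite -ler_pdivrMr // lerNr ltW.
Qed.

(* Otherwise the minimizers accumulate at some [l], where the generating
   function itself would be below [exp (l theta - L0 - nu)]. *)
Lemma expsum_min_ge theta L0 nu : (0 < theta)%R -> (0 < nu)%R -> Lambda P0 Q theta = L0%:E ->
  exists N0, forall N, (N0 <= N)%N -> exists lam, [/\ (lam <= 0)%R,
    (0 < expsum P0 Q c eta theta N lam)%R,
    forall l, (l <= 0)%R -> (expsum P0 Q c eta theta N lam <= expsum P0 Q c eta theta N l)%R &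
    (expR (- L0 - nu) <= expsum P0 Q c eta theta N lam)%R].
Proof.
move=> th0 nu0 LE; have [r [N1 [r0 H]]] := expsum_minimizer th0.
set G := expR (- L0 - nu).
have [N2 HN2] : exists N2, forall l, (- r <= l <= 0)%R -> (G <= expsum P0 Q c eta theta N2 l)%R.
  apply: contrapT => no.
  have bad N : exists l, (- r <= l <= 0)%R /\ (expsum P0 Q c eta theta N l <= G)%R.
    apply: contrapT => nb; apply: no; exists N => l lI; rewrite leNgt; apply/negP => lt.
    by apply: nb; exists l; rewrite (ltW lt).
  have [ls hls] := choice bad.
  have lsI : (ls @ \oo) `[(- r)%R, 0%R]%classic.
    by exists 0%N => // n _; rewrite /= in_itv /=; have [] := hls n.
  have [l [lI lcl]] := @segment_compact R (- r) 0 (ls @ \oo) _ lsI.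
  have l0 : (l <= 0)%R by move: lI; rewrite /= in_itv /= => /andP[].
  have lG N : (expsum P0 Q c eta theta N l <= G)%R.
    have cl : closed [set x | (expsum P0 Q c eta theta N x <= G)%R].
      apply: (@closed_comp _ _ (expsum P0 Q c eta theta N) [set x | (x <= G)%R]).
        by move=> x _; exact: expsum_continuous.
      exact: closed_le.
    apply: (cl l); move: lcl; rewrite clusterE; apply.
    exists N => // n /= Nn; apply: le_trans (hls n).2; exact: expsum_mono.
  have := mgf_le_expsum l0 lG; rewrite /G -expRD => mgfl.
  have : (l * theta)%:E - lne (mgf_X P0 Q l) <= L0%:E.
    by rewrite -LE; apply: ereal_sup_ubound; exists l.
  have : lne (mgf_X P0 Q l) <= (- L0 - nu + l * theta)%:E.
    apply: (@le_trans _ _ (lne (expR (- L0 - nu + l * theta))%:E)); last first.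
      by rewrite lne_EFin ?expR_gt0 // expRK.
    rewrite lee_lne ?in_itv /= ?leey ?andbT ?lee_fin ?expR_ge0 //.
    by apply: integral_ge0 => w _; exact: expeR_ge0.
  case: (lne (mgf_X P0 Q l)) => [x| |] //=.
  by rewrite -EFinB !lee_fin; move: (l * theta)%R => y; lra.
exists (maxn N1 N2) => N; rewrite geq_max => /andP[/H[lam lamI [f0 fm]] N2N].
have /andP[_ lam0] := lamI.
exists lam; split=> //; apply: (le_trans (HN2 _ lamI)); exact: expsum_mono.
Qed.

End Mesh.
Lemma lower_rate theta L0 nu z : 0 < mean_X P0 Q -> 0 < P0 [set w | X Q w < 0] ->
  (0 < theta)%R -> (0 < nu)%R -> Lambda P0 Q theta = L0%:E -> (0 < z)%N ->
  \forall n \near \oo, (expR (- (L0 + nu) * n%:R))%:E <=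
    popn P0 Q n (upto (expR ((theta + nu) * n%:R))) z.
Proof.
move=> mpos hneg th0 nu0 LE z0.
have [eta [eta0 etanu etaX]] : exists eta : R, [/\ (0 < eta)%R, (2 * eta <= nu)%R &
    2 * eta%:E + \int[P0]_w (X Q)^\- w < \int[P0]_w (X Q)^\+ w].
  have p0 : 0 <= \int[P0]_w (X Q)^\+ w by exact: integral_ge0.
  have q0 : 0 <= \int[P0]_w (X Q)^\- w by exact: integral_ge0.
  move: mpos; rewrite /mean_X integralE.
  move: (\int[P0]_w (X Q)^\+ w) (\int[P0]_w (X Q)^\- w) p0 q0.
  case=> [p| |] // [q| |] // _ _.
    rewrite -EFinB lte_fin => pq; exists (Num.min (nu / 2) ((p - q) / 4))%R.
    have h1 : (Num.min (nu / 2) ((p - q) / 4) <= nu / 2)%R by rewrite ge_min lexx.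
    have h2 : (Num.min (nu / 2) ((p - q) / 4) <= (p - q) / 4)%R by rewrite ge_min lexx orbT.
    have h3 : (0 < Num.min (nu / 2) ((p - q) / 4))%R by rewrite lt_min !divr_gt0.
    rewrite -EFinM -EFinD lte_fin.
    by move: h1 h2 h3; move: (Num.min _ _) => y; split; lra.
  move=> _; exists (nu / 2)%R; split; first by rewrite divr_gt0.
    by rewrite mulrC divfK.
  by rewrite -EFinM -EFinD ltry.
have [N1 HN1] := sum_lval_gt0 eta0 etaX.
have n20 : (0 < nu / 2)%R by rewrite divr_gt0.
have [N2 HN2] := expsum_min_ge eta0 hneg th0 n20 LE.
have [lam [lam0 f0 fmin fG]] := HN2 _ (leq_maxr N1 N2).
have TL := tilted_lower c1 eta0 mreg z0 th0 lam0 f0 fmin (HN1 _ (leq_maxl N1 N2)) n20.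
near=> n.
apply: (@le_trans _ _ (expR ((ln (expsum P0 Q c eta theta (maxn N1 N2) lam) - nu / 2) * n%:R))%:E).
  rewrite lee_fin ler_expR ler_wpM2r //.
  have : (- L0 - nu / 2 <= ln (expsum P0 Q c eta theta (maxn N1 N2) lam))%R.
    by rewrite -[leLHS]expRK ler_ln ?posrE ?expR_gt0.
  by move: (ln _) => y; lra.
apply: (@le_trans _ _ (popn P0 Q n (upto (expR ((theta + 2 * eta) * n%:R))) z)).
  by near: n; exact: TL.
apply: le_popn => k; first exact: ind_ge0.
rewrite /upto /ind lee_fin ler_nat; case: (0 < k)%N => //=.
case: (leP k%:R (expR ((theta + 2 * eta) * n%:R))) => //= h.
rewrite (le_trans h) // ler_expR ler_wpM2r // lerD2l //.
Unshelve. all: by end_near. Qed.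

End LowerRate.


(** * The rate function and the conclusion *)

Lemma le_add_mulln {R : realType} (k : nat) : (k%:R <= 1 + k%:R * Num.max (ln k%:R) 0 :> R)%R.
Proof.
case: k => [|k]; first by rewrite mul0r addr0.
set x : R := k.+1%:R; have x0 : (0 < x)%R by rewrite ltr0n.
apply: (@le_trans _ _ (1 + x * ln x)%R); last by rewrite lerD2l ler_wpM2l ?(ltW x0) // le_max lexx.
have xV : (0 < x^-1)%R by rewrite invr_gt0.
have := @le_ln1Dx R (x^-1 - 1); rewrite subrKC lnV ?posrE // ltrBrDr addNr => /(_ xV) h.
have : (x * (- ln x) <= x * (x^-1 - 1))%R by rewrite ler_wpM2l // ltW.
by rewrite mulrBr mulfV ?gt_eqF // mulr1 mulrN; move: (x * ln x)%R => y; lra.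
Qed.

Section Regularity.
Context {R : realType} {d0 d : measure_display} {Omega0 : measurableType d0}.
Context (P0 : probability Omega0 R) (Q : {mfun Omega0 >-> offspring_law R}).
Context {Omega : measurableType d} (E : nat -> {mfun Omega >-> offspring_law R}).
Context (Z : nat -> {mfun Omega >-> nat}) (PP : nat -> probability Omega R).

Let measurable_meanQ : measurable_fun setT (fun w => mean (Q w)).
Proof. exact: (measurableT_comp measurable_mean (measurable_funPT Q)). Qed.

Lemma regularE c : regular Q c = [set w | 0 < mean (Q w)] `&` ([set w | mean (Q w) < +oo] `&`
  [set w | 0 <= c%:E * (mean (Q w) + mean (Q w) * mean (Q w)) - second_moment (Q w)]).
Proof.
have sm0 w : 0 <= second_moment (Q w).
  by apply: nneseries_ge0 => k _ _; rewrite mule_ge0 ?measure_ge0 // lee_fin.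
apply/seteqP; split => w.
  move=> [m [v [qm qv m0 vc]]]; rewrite /= qm qv lte_fin ltry; split => //; split => //.
  have -> : c%:E * (m%:E + m%:E * m%:E) - v%:E = (c * (m + m ^+ 2) - v)%:E by rewrite expr2.
  by rewrite lee_fin subr_ge0.
move=> [/= m0 [mfin]].
have {mfin} mfin : mean (Q w) \is a fin_num by rewrite ge0_fin_numE // ltW.
rewrite -(fineK mfin) in m0 *.
move: (sm0 w); case sE : (second_moment (Q w)) => [v| |] // _.
set m := fine _ in m0 *.
have -> : c%:E * (m%:E + m%:E * m%:E) - v%:E = (c * (m + m ^+ 2) - v)%:E by rewrite expr2.
rewrite lee_fin subr_ge0 => vc; exists m, v; split=> //.
by rewrite /m fineK.
Qed.

Lemma measurable_regular c : measurable (regular Q c).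
Proof.
have mm := measurable_meanQ.
rewrite regularE; apply: measurableI; last apply: measurableI.
- by rewrite -[X in measurable X]setTI; exact: emeasurable_fun_o_infty.
- by rewrite -[X in measurable X]setTI; exact: emeasurable_fun_infty_o.
rewrite -[X in measurable X]setTI; apply: emeasurable_fun_c_infty => //.
apply: emeasurable_funB; last first.
  exact: (measurableT_comp measurable_second_moment (measurable_funPT Q)).
apply: measurable_funeM; apply: emeasurable_funD => //; exact: emeasurable_funM.
Qed.

Hypothesis hbpre : bpre_family P0 Q E Z PP.

Lemma integral_first_generation : \int[PP 1%N]_w ((Z 1%N w)%:R)%:E = \int[P0]_w mean (Q w).
Proof.
have mZ k : measurable [set w | Z 1%N w = k].
  have -> : [set w | Z 1%N w = k] = Z 1%N @^-1` [set k] by [].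
  by rewrite -[X in measurable X]setTI; exact: measurable_funPT.
have cov : \bigcup_k [set w | Z 1%N w = k] = setT.
  by apply/seteqP; split => // w _; exists (Z 1%N w).
rewrite -cov ge0_integral_bigcup //; last first.
- by move=> a b _ _ [w [/= <- <-]].
- rewrite cov; apply/measurable_EFinP.
  apply: (@measurableT_comp _ _ _ _ _ _ (fun k : nat => k%:R : R)) => //.
rewrite /mean integral_nneseries //; last 2 first.
- move=> k; apply: measurable_funeM.
  exact: (measurableT_comp (measurable_pmf k) (measurable_funPT Q)).
- by move=> k w _; rewrite mule_ge0 ?measure_ge0 // lee_fin.
apply: eq_eseriesr => k _.
rewrite (eq_integral (cst (k%:R)%:E)); last by move=> w; rewrite inE /= => ->.
rewrite integral_cst //; apply: (etrans (congr1 (mule _) (PP_popn1 hbpre 1 1 k))).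
rewrite /= /pop -ge0_integralZl //.
- apply: eq_integral => w _; rewrite csum_ind1; congr (_ * _).
  rewrite /= big_ord_recr /= subnn mule1 big1 ?add0e // => l _.
  by rewrite subn_eq0 leqNgt ltn_ord mule0.
- by apply: measurable_csumQ; exact: ind_ge0.
- by move=> w _; apply: csum_ge0; exact: ind_ge0.
Qed.

Lemma regular_ae c0 : (exists s : R, (0 < s)%R /\ mgf_X P0 Q (- s)%R < +oo) ->
  \int[PP 1%N]_w ((Z 1%N w)%:R * Num.max (ln (Z 1%N w)%:R) 0)%:E < +oo ->
  {ae P0, forall w, second_moment (Q w) <= c0%:E * (mean (Q w) + mean (Q w) ^+ 2)} ->
  P0 (~` regular Q (Num.max c0 1%R)) = 0.
Proof.
move=> hexp hlog hsm.
have mean_ge0 w : 0 <= mean (Q w).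
  by apply: nneseries_ge0 => k _ _; rewrite mule_ge0 ?measure_ge0 // lee_fin.
have mfn (f : nat -> R) : measurable_fun setT (fun w => (f (Z 1%N w))%:E).
  apply/measurable_EFinP.
  by apply: (@measurableT_comp _ _ _ _ _ _ f) => //; exact: measurable_funPT.
have mfin : {ae P0, forall w, setT w -> mean (Q w) \is a fin_num}.
  apply: integrable_ae => //; apply/integrableP; split; first exact: measurable_meanQ.
  under eq_integral do rewrite gee0_abs //.
  rewrite -integral_first_generation.
  apply: (@le_lt_trans _ _ (\int[PP 1%N]_w (1 + ((Z 1%N w)%:R * Num.max (ln (Z 1%N w)%:R) 0)%:E))).
    apply: ge0_le_integral => //; do ?[exact: (mfn (fun k => k%:R)%R)
      |by apply: emeasurable_funD => //; exact: (mfn (fun k => k%:R * Num.max (ln k%:R) 0)%R)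
      |by move=> w _; rewrite lee_fin].
    move=> w _; rewrite -EFinD lee_fin; exact: le_add_mulln.
  rewrite ge0_integralD //.
  - rewrite integral_cst // mul1e.
    by apply: lte_add_pinfty => //; apply: (le_lt_trans (probability_le1 _ _)) => //; exact: ltry.
  - by move=> w _; rewrite lee_fin mulr_ge0 // le_max lexx orbT.
  - exact: (mfn (fun k => k%:R * Num.max (ln k%:R) 0)%R).
apply: measure_negligible; first by apply: measurableC; exact: measurable_regular.
have mpos : {ae P0, forall w, 0 < mean (Q w)}.
  exists [set w | mean (Q w) <= 0]; split.
  - rewrite -[X in measurable X]setTI; apply: emeasurable_fun_infty_c => //.
  - exact: mean_gt0_ae.
  - by move=> w /= /negP; rewrite -leNgt.
suff : {ae P0, forall w, regular Q (Num.max c0 1%R) w} by [].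
apply: filterS3 mpos mfin hsm => w m0 /(_ Logic.I) mf sm.
move: m0 sm; rewrite -(fineK mf); set m := fine _ => m0 sm.
have sm0 : 0 <= second_moment (Q w).
  by apply: nneseries_ge0 => k _ _; rewrite mule_ge0 ?measure_ge0 // lee_fin.
rewrite lte_fin in m0.
have {}sm : second_moment (Q w) <= (c0 * (m + m ^+ 2))%:E by rewrite EFinM EFinD EFin_expe.
move: sm sm0; case sE : (second_moment (Q w)) => [v| |] //; rewrite !lee_fin => sm _.
exists m, v; split => //; first by rewrite /m fineK.
apply: (le_trans sm); rewrite ler_wpM2r ?le_max ?lexx //.
by rewrite addr_ge0 ?sqr_ge0 // ltW.
Qed.

End Regularity.


Section LambdaBounds.
Context {R : realType} {d0 : measure_display} {Omega0 : measurableType d0}.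
Context (P0 : probability Omega0 R) (Q : {mfun Omega0 >-> offspring_law R}).
Hypothesis hneg : 0 < P0 [set w | X Q w < 0].

Local Notation K := (- ln (fine (P0 [set w | (X Q w < 0)%E])))%R.

Let measurable_neg : measurable [set w | X Q w < 0].
Proof.
rewrite -[X in measurable X]setTI; apply: emeasurable_fun_infty_o => //.
exact: measurable_X.
Qed.

Let negE : P0 [set w | X Q w < 0] = (expR (- K))%:E.
Proof.
have fin : P0 [set w | X Q w < 0] \is a fin_num by exact: fin_num_measure.
by rewrite opprK lnK ?fineK // posrE -lte_fin fineK.
Qed.

Lemma K_ge0 : (0 <= K)%R.
Proof.
by rewrite -oppr_le0 -ler_expR expR0 -lee_fin -negE; exact: probability_le1.
Qed.

Lemma mgf_ge (l : R) : (l <= 0)%R -> (expR (- K))%:E <= mgf_X P0 Q l.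
Proof.
move=> l0; rewrite -negE.
have me : measurable_fun setT (fun w => expeR (l%:E * X Q w)).
  by apply: (measurableT_comp measurable_expeR); apply: measurable_funeM; exact: measurable_X.
apply: (@le_trans _ _ (\int[P0]_(w in [set w | X Q w < 0]) 1)).
  by rewrite integral_cst // mul1e.
apply: (@le_trans _ _ (\int[P0]_(w in [set w | X Q w < 0]) expeR (l%:E * X Q w))); last first.
  by apply: ge0_subset_integral => // w _; exact: expeR_ge0.
apply: ge0_le_integral => //; first exact: measurable_funTS.
move=> w /= Xw; rewrite -expeR0 lee_expeR mule_le0 // ?lee_fin //; exact: ltW.
Qed.

(* The first case is that of an infinite generating function. *)
Lemma tilted_value (theta l : R) : (l <= 0)%R ->
  (l * theta)%:E - lne (mgf_X P0 Q l) = -oo \/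
  exists2 f : R, (expR (- K) <= f)%R & mgf_X P0 Q l = f%:E /\
    (l * theta)%:E - lne (mgf_X P0 Q l) = (l * theta - ln f)%:E.
Proof.
move=> l0; have := mgf_ge l0; case: (mgf_X P0 Q l) => [f| |] // H; last by left.
rewrite lee_fin in H; have f0 : (0 < f)%R by rewrite (lt_le_trans _ H) ?expR_gt0.
by right; exists f => //; split=> //; rewrite lne_EFin.
Qed.

Lemma Lambda_ge0 theta : 0 <= Lambda P0 Q theta.
Proof.
apply: ereal_sup_ubound; exists 0%R => //=.
rewrite mul0r (_ : mgf_X P0 Q 0 = 1) ?lne1 ?sube0 //.
rewrite /mgf_X; under eq_integral do rewrite mul0e expeR0.
by rewrite integral_cst // mul1e; exact: probability_setT.
Qed.

Lemma Lambda_le theta : (0 <= theta)%R -> Lambda P0 Q theta <= K%:E.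
Proof.
move=> th0; apply: ub_ereal_sup => _ [l /= l0 <-].
have [->|[f fK [_ ->]]] := tilted_value theta l0; first exact: leNye.
have f0 : (0 < f)%R by rewrite (lt_le_trans _ fK) ?expR_gt0.
rewrite lee_fin -[leRHS]add0r lerD ?mulr_le0_ge0 // lerNl -[leLHS]expRK.
by rewrite ler_ln ?posrE ?expR_gt0.
Qed.

Lemma Lambda_fin theta : (0 <= theta)%R -> Lambda P0 Q theta = (fine (Lambda P0 Q theta))%:E.
Proof.
move=> th0; rewrite fineK // ge0_fin_numE ?Lambda_ge0 //.
exact: le_lt_trans (Lambda_le th0) (ltry _).
Qed.

(* [theta] is a convex combination of [theta + delta] and [0], where the value of
   each affine function in the supremum is at most [K]. *)
Lemma Lambda_continuous theta delta : (0 < theta)%R -> (0 < delta)%R ->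
  (fine (Lambda P0 Q theta) <= fine (Lambda P0 Q (theta + delta)) + K * delta / (theta + delta))%R.
Proof.
move=> th0 de0; have td0 : (0 < theta + delta)%R by exact: addr_gt0.
have K0 := K_ge0.
rewrite -lee_fin -Lambda_fin ?(ltW th0) //; apply: ub_ereal_sup => _ [l /= l0 <-].
have [->|[f fK [fE ->]]] := tilted_value theta l0; first exact: leNye.
have Lle : (l * (theta + delta) - ln f <= fine (Lambda P0 Q (theta + delta)))%R.
  rewrite -lee_fin -Lambda_fin ?(ltW td0) //; apply: ereal_sup_ubound; exists l => //=.
  by rewrite fE lne_EFin // (lt_le_trans _ fK) // expR_gt0.
have L0 : (0 <= fine (Lambda P0 Q (theta + delta)))%R by rewrite fine_ge0 // Lambda_ge0.
have lf : (- ln f <= K)%R by rewrite lerNl -[leLHS]expRK ler_ln ?posrE ?expR_gt0 // (lt_le_trans _ fK) ?expR_gt0.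
rewrite lee_fin.
set a := (theta / (theta + delta))%R.
have a0 : (0 <= a <= 1)%R.
  by rewrite divr_ge0 ?(ltW th0) ?(ltW td0) //= ler_pdivrMr // mul1r lerDl ltW.
have aE : (delta / (theta + delta) = 1 - a)%R by rewrite /a; field; rewrite gt_eqF.
have -> : (l * theta = a * (l * (theta + delta)))%R by rewrite /a; field; rewrite gt_eqF.
rewrite -mulrA aE.
have h1 : (a * (l * (theta + delta) - ln f) <= fine (Lambda P0 Q (theta + delta)))%R.
  case/andP: a0 => a0 a1; apply: (@le_trans _ _ (a * fine (Lambda P0 Q (theta + delta)))%R).
    by rewrite ler_wpM2l.
  by rewrite -[leRHS]mul1r ler_wpM2r.
have h2 : ((1 - a) * (- ln f) <= K * (1 - a))%R.
  by case/andP: a0 => a0 a1; rewrite [leRHS]mulrC ler_wpM2l // subr_ge0.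
apply: le_trans (lerD h1 h2).
by rewrite le_eqVlt; apply/orP; left; apply/eqP; ring.
Qed.

End LambdaBounds.


Section ConcatRate.
Context {R : realType} {d0 : measure_display} {Omega0 : measurableType d0}.
Context (P0 : probability Omega0 R) (Q : {mfun Omega0 >-> offspring_law R}).

Lemma split_time (t : R) (N1 N2 n : nat) : (0 < t < 1)%R ->
  (N1%:R / t <= n%:R)%R -> (N2.+1%:R / (1 - t) <= n%:R)%R ->
  exists a b : nat, [/\ n = (a + b)%N, (N1 <= a)%N, (N2 <= b)%N,
    (a%:R <= t * n%:R + 1)%R & (b%:R <= (1 - t) * n%:R)%R].
Proof.
move=> /andP[t0 t1]; have s0 : (0 < 1 - t)%R by rewrite subr_gt0.
rewrite ler_pdivrMr // ler_pdivrMr // => h1 h2.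
have tn0 : (0 <= t * n%:R)%R by rewrite mulr_ge0 // ltW.
have /andP[k1 k2] := Num.Theory.truncn_itv tn0.
set k := Num.truncn (t * n%:R) in k1 k2.
have kn : (k.+1 + N2 <= n)%N.
  rewrite -(ler_nat R) natrD; move: h2; rewrite -!natr1 in k2 *.
  by move: k1; move: (n%:R) (k%:R) (N2%:R) => x y z h3 h4; rewrite mulrC in h3; lra.
exists k.+1, (n - k.+1)%N; split.
- by rewrite subnKC // (leq_trans _ kn) // leq_addr.
- rewrite -(ler_nat R); apply: ltW; apply: le_lt_trans k2; by rewrite mulrC.
- by rewrite leq_subRL ?(leq_trans _ kn) // leq_addr.
- by rewrite -natr1 lerD2r.
- by rewrite natrB ?(leq_trans _ kn) ?leq_addr // mulrBl mul1r lerD2l lerN2 ltW.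
Qed.

Lemma concat_rate (t r L theta eps : R) i : (0 < t < 1)%R -> (0 <= r)%R -> (0 <= L)%R ->
  (0 < theta)%R -> (0 < eps)%R ->
  (forall e : R, (0 < e)%R -> \forall n \near \oo,
     (expR (- (r + e) * n%:R))%:E <= popn P0 Q n (ind (pred1 i)) i) ->
  (forall e : R, (0 < e)%R -> \forall n \near \oo,
     (expR (- (L + e) * n%:R))%:E <= popn P0 Q n (upto (expR (theta / (1 - t) * n%:R))) i) ->
  \forall n \near \oo, (expR (- (t * r + (1 - t) * L + eps) * n%:R))%:E <=
    popn P0 Q n (upto (expR (theta * n%:R))) i.
Proof.
move=> t01 r0 L0 th0 e0 Hr HL.
have e20 : (0 < eps / 2)%R by rewrite divr_gt0.
have [N1 _ {}Hr] := Hr _ e20; have [N2 _ {}HL] := HL _ e20.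
have /andP[t0 t1] := t01; have s0 : (0 < 1 - t)%R by rewrite subr_gt0.
near=> n.
have n1 : (N1%:R / t <= n%:R)%R by near: n; exact: nbhs_infty_ger.
have n2 : (N2.+1%:R / (1 - t) <= n%:R)%R by near: n; exact: nbhs_infty_ger.
have n3 : (r + eps / 2 <= eps / 2 * n%:R)%R.
  by rewrite [leRHS]mulrC -ler_pdivrMr //; near: n; exact: nbhs_infty_ger.
have [a [b [nE N1a N2b an bn]]] := split_time t01 n1 n2.
apply: (@le_trans _ _ (popn P0 Q a (ind (pred1 i)) i *
    popn P0 Q b (upto (expR (theta / (1 - t) * b%:R))) i)).
  apply: (@le_trans _ _ ((expR (- (r + eps / 2) * a%:R))%:E * (expR (- (L + eps / 2) * b%:R))%:E)).
    rewrite -EFinM lee_fin -expRD ler_expR.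
    have h1 : ((r + eps / 2) * a%:R <= (r + eps / 2) * (t * n%:R + 1))%R.
      by rewrite ler_wpM2l // addr_ge0 // ltW.
    have h2 : ((L + eps / 2) * b%:R <= (L + eps / 2) * ((1 - t) * n%:R))%R.
      by rewrite ler_wpM2l // addr_ge0 // ltW.
    rewrite !mulNr -opprD lerN2; apply: (le_trans (lerD h1 h2)).
    rewrite -subr_ge0; apply: (@le_trans _ _ (eps / 2 * n%:R - (r + eps / 2))%R).
      by rewrite subr_ge0.
    by rewrite le_eqVlt; apply/orP; left; apply/eqP; field.
  by apply: lee_pmul; rewrite ?lee_fin ?expR_ge0 //; [exact: Hr|exact: HL].
apply: (le_trans (popn_chain P0 Q a b _ i i)); rewrite -nE.
apply: le_popn => k; first exact: ind_ge0.
rewrite /upto /ind lee_fin ler_nat; case: (0 < k)%N => //=.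
case: (leP k%:R (expR (theta / (1 - t) * b%:R))) => //= h.
rewrite (le_trans h) // ler_expR; apply: (@le_trans _ _ (theta / (1 - t) * ((1 - t) * n%:R))%R).
  by rewrite ler_wpM2l // divr_ge0 // ltW.
by rewrite mulrA divfK // gt_eqF.
Unshelve. all: by end_near. Qed.

End ConcatRate.


Section ChiBounds.
Context {R : realType} {d0 : measure_display} {Omega0 : measurableType d0}.
Context (P0 : probability Omega0 R) (Q : {mfun Omega0 >-> offspring_law R}).
Hypothesis hneg : 0 < P0 [set w | X Q w < 0].
Context (theta r : R).
Hypotheses (theta0 : (0 < theta)%R) (r0 : (0 <= r)%R).

Local Notation K := (- ln (fine (P0 [set w | (X Q w < 0)%E])))%R.
Local Notation x := (fine (chi theta r (Lambda P0 Q))).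
Local Notation L t := (fine (Lambda P0 Q (theta / (1 - t)))).

Let chi_term (t : R) : (0 <= t <= 1)%R ->
  (t * r)%:E + (1 - t)%:E * Lambda P0 Q (theta / (1 - t))%R = (t * r + (1 - t) * L t)%:E.
Proof.
move=> /andP[t0 t1]; have th : (0 <= theta / (1 - t))%R.
  by rewrite divr_ge0 ?(ltW theta0) // subr_ge0.
by rewrite (Lambda_fin hneg th).
Qed.

Lemma chi_le : chi theta r (Lambda P0 Q) <= r%:E.
Proof.
apply: ereal_inf_lbound; exists 1%R; first by rewrite /= in_itv /= ler01 lexx.
by rewrite subrr mul0e adde0 mul1r.
Qed.

Lemma chiE : chi theta r (Lambda P0 Q) = x%:E.
Proof.
rewrite fineK // ge0_fin_numE; first exact: le_lt_trans chi_le (ltry _).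
apply: le_ereal_inf_tmp => _ [t /= tI <-]; rewrite in_itv /= in tI.
rewrite chi_term // lee_fin; case/andP: tI => t0 t1.
by rewrite addr_ge0 // mulr_ge0 ?subr_ge0 // fine_ge0 // Lambda_ge0.
Qed.

Lemma chi_le_term t : (0 <= t <= 1)%R -> (x <= t * r + (1 - t) * L t)%R.
Proof.
move=> tI; rewrite -lee_fin -chiE -chi_term //.
by apply: ereal_inf_lbound; exists t => //=; rewrite in_itv.
Qed.

Lemma chi_near_term eps : (0 < eps)%R ->
  exists2 t : R, (0 <= t <= 1)%R & (t * r + (1 - t) * L t < x + eps)%R.
Proof.
move=> e0; have : chi theta r (Lambda P0 Q) < (x + eps)%:E.
  by rewrite chiE lte_fin ltrDl.
move=> /ereal_inf_lt[_ [t /= tI <-]]; rewrite in_itv /= in tI.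
by rewrite chi_term // lte_fin => h; exists t.
Qed.

Lemma near_optimal_tilt t nu : (0 <= t < 1)%R -> (0 < nu)%R -> exists p : R * R,
  [/\ (p.1 <= 0)%R, (expR (- K) <= p.2)%R, mgf_X P0 Q p.1 = p.2%:E &
    (x - nu <= p.1 * theta + t * r - (1 - t) * ln p.2)%R].
Proof.
move=> /andP[t0 t1] nu0; have s0 : (0 < 1 - t)%R by rewrite subr_gt0.
have h := @chi_le_term t; rewrite t0 (ltW t1) in h; have {}h := h isT.
have thp : (0 <= theta / (1 - t))%R by rewrite divr_ge0 // ltW.
have : (L t - nu)%:E < Lambda P0 Q (theta / (1 - t))%R.
  by rewrite (Lambda_fin hneg thp) lte_fin gtrBl.
move=> /ereal_sup_gt[_ [l /= l0 <-]].
have [->//|[f fK [fE ->]]] := tilted_value hneg (theta / (1 - t)) l0.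
rewrite lte_fin => lt; exists (l, f); split => //=.
have : ((1 - t) * (L t - nu) <= (1 - t) * (l * (theta / (1 - t)) - ln f))%R.
  by rewrite ler_wpM2l // ltW.
have -> : ((1 - t) * (l * (theta / (1 - t)) - ln f) = l * theta - (1 - t) * ln f)%R.
  by field; rewrite gt_eqF.
have tnu : (0 <= t * nu)%R by rewrite mulr_ge0 // ltW.
have -> : ((1 - t) * (L t - nu) = (1 - t) * L t - nu + t * nu)%R by ring.
by move: h; move: ((1 - t) * L t)%R ((1 - t) * ln f)%R (t * r)%R (l * theta)%R (t * nu)%R tnu => *; lra.
Qed.

(* The values at [t] and at a grid point below [t] differ by [r + ln f >= - K]
   times the distance. *)
Lemma tilt_grid nu : (0 < nu)%R -> exists s : seq (R * R),
  (forall p, p \in s -> [/\ p.1 <= 0, 0 < p.2 & mgf_X P0 Q p.1 = p.2%:E]%R) /\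
  forall t : R, (0 <= t <= 1)%R -> exists2 p, p \in s &
    (x - nu <= p.1 * theta + t * r - (1 - t) * ln p.2)%R.
Proof.
move=> nu0; have n20 : (0 < nu / 2)%R by rewrite divr_gt0.
have K0 := K_ge0 hneg; have [J JK] : exists J : nat, (K / (nu / 2) <= J.+1%:R)%R.
  exists (Num.truncn (K / (nu / 2))).
  by have /andP[_ /ltW] := Num.Theory.truncn_itv (divr_ge0 K0 (ltW n20)).
have J0 : (0 < J.+1%:R :> R)%R by rewrite ltr0n.
pose good j (p : R * R) := [/\ (p.1 <= 0)%R, (expR (- K) <= p.2)%R, mgf_X P0 Q p.1 = p.2%:E &
    (x - nu / 2 <= p.1 * theta + j%:R / J.+1%:R * r - (1 - j%:R / J.+1%:R) * ln p.2)%R].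
have ex j : exists p, (j < J.+1)%N -> good j p.
  have [jJ|] := boolP (j < J.+1)%N; last by exists (0, 0)%R.
  have [|p Hp] := @near_optimal_tilt (j%:R / J.+1%:R)%R _ _ n20; last by exists p.
  by rewrite divr_ge0 //= ltr_pdivrMr // mul1r ltr_nat.
have [p Hp] := choice ex.
exists [seq p j | j <- iota 0 J.+1]; split.
  move=> q /mapP[j]; rewrite mem_iota add0n => /andP[_ /Hp[? fK ? _]] ->; split => //.
  by apply: lt_le_trans fK; exact: expR_gt0.
move=> t /andP[t0 t1].
have [j [jJ jt tj]] : exists j, [/\ (j < J.+1)%N, (j%:R / J.+1%:R <= t)%R &
    (t - j%:R / J.+1%:R <= J.+1%:R^-1)%R].
  have [tlt|tge] := ltP t 1%R; last first.
    exists J; split => //; first by apply: le_trans tge; rewrite ler_pdivrMr // mul1r ler_nat.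
    by rewrite lerBlDr -[X in (X + _)%R]mul1r -mulrDl nat1r mulfV // gt_eqF.
  have tJ0 : (0 <= t * J.+1%:R)%R by rewrite mulr_ge0.
  have /andP[k1 k2] := Num.Theory.truncn_itv tJ0.
  exists (Num.truncn (t * J.+1%:R)); split.
  - rewrite -(ltr_nat R); apply: (le_lt_trans k1); by rewrite -[ltRHS]mul1r ltr_pM2r.
  - by rewrite ler_pdivrMr.
  - by rewrite lerBlDr -[X in (X + _)%R]mul1r -mulrDl nat1r ler_pdivlMr // ltW.
exists (p j); first by apply: map_f; rewrite mem_iota add0n.
have [_ fK _ H] := Hp j jJ.
have lf : (- K <= ln (p j).2)%R.
  by rewrite -[leLHS]expRK ler_ln ?posrE ?expR_gt0 // (lt_le_trans _ fK) // expR_gt0.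
set tj' := (j%:R / J.+1%:R)%R in jt tj H; set f := ln (p j).2 in lf H *.
have h1 : (- K * (t - tj') <= (r + f) * (t - tj'))%R.
  by rewrite ler_wpM2r ?subr_ge0 // -[leLHS]add0r lerD.
have h2 : (K * (t - tj') <= nu / 2)%R.
  apply: (@le_trans _ _ (K * J.+1%:R^-1)%R); first by rewrite ler_wpM2l.
  by rewrite ler_pdivrMr // mulrC -ler_pdivrMr.
have -> : ((p j).1 * theta + t * r - (1 - t) * f =
  ((p j).1 * theta + tj' * r - (1 - tj') * f) + (r + f) * (t - tj'))%R by ring.
have -> : (x - nu = (x - nu / 2) + - (nu / 2))%R by field.
apply: lerD => //; apply: le_trans h1; by rewrite mulNr lerN2.
Qed.

End ChiBounds.


Section LowerDeviation.
Context {R : realType} {d0 d : measure_display} {Omega0 : measurableType d0}.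
Context (P0 : probability Omega0 R) (Q : {mfun Omega0 >-> offspring_law R}).
Context {Omega : measurableType d} (E : nat -> {mfun Omega >-> offspring_law R}).
Context (Z : nat -> {mfun Omega >-> nat}) (PP : nat -> probability Omega R).
Hypothesis hbpre : bpre_family P0 Q E Z PP.
Hypothesis hsuper : 0 < mean_X P0 Q.
Hypothesis hexp : exists s : R, (0 < s)%R /\ mgf_X P0 Q (- s)%R < +oo.
Hypothesis hneg : 0 < P0 [set w | X Q w < 0].
Context (c : R).
Hypothesis c1 : (1 <= c)%R.
Hypothesis regP : P0 (~` regular Q c) = 0.

Lemma lower_rate_Lambda theta eps z : (0 < theta)%R -> (0 < eps)%R -> (0 < z)%N ->
  \forall n \near \oo, (expR (- (fine (Lambda P0 Q theta) + eps) * n%:R))%:E <=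
    popn P0 Q n (upto (expR (theta * n%:R))) z.
Proof.
move=> th0 e0 z0; have K0 := K_ge0 hneg.
set K := (- ln _)%R in K0.
have A0 : (0 <= (K / theta + 1) / eps)%R.
  by rewrite divr_ge0 ?(ltW e0) // addr_ge0 // divr_ge0 // ltW.
have h0 : (0 < theta / 2)%R by rewrite divr_gt0.
have [nu [nu0 _ nuA nuth]] := @small_step R 0 _ _ (lexx _) A0 h0.
have thn : (0 < theta - nu)%R by move: nuth h0; lra.
have LE := Lambda_fin hneg (ltW thn).
have Lc := Lambda_continuous hneg thn nu0; rewrite subrK -/K in Lc.
have LR := lower_rate c1 (measurable_regular Q c) regP hsuper hneg thn nu0 LE z0; rewrite subrK in LR.
near=> n.
apply: (@le_trans _ _ (expR (- (fine (Lambda P0 Q (theta - nu)) + nu) * n%:R))%:E).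
  rewrite lee_fin ler_expR ler_wpM2r // lerN2.
  have : (K * nu / theta + nu <= eps)%R.
    move: nuA; rewrite mulrA ler_pdivrMr // mul1r mulrDr mulr1; apply: le_trans.
    by rewrite lerD2r le_eqVlt; apply/orP; left; apply/eqP; ring.
  by move: Lc; move: (fine _) (fine _) (K * nu / theta)%R => x y u; lra.
by near: n; exact: LR.
Unshelve. all: by end_near. Qed.

Lemma lower_deviation theta i : (0 < theta)%R -> ClI P0 Q Z PP i ->
  limn_esup (fun n : nat => (n%:R^-1)%:E *
    lne (PP i [set w | (1 <= Z n w)%N /\ ((Z n w)%:R <= expR (theta * n%:R))%R])) =
  - chi theta (varrho P0 Q Z PP) (Lambda P0 Q).
Proof.
move=> th0 Ci; have i0 : (0 < i)%N by case: Ci.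
have [[r0 _] /(_ _ _ Ci Ci)[_ low]] := varrho_rate hbpre hexp hneg.
have [C [C0 small]] := small_values hbpre hexp hneg Ci.
set r := varrho P0 Q Z PP in r0 low small *.
have chE := chiE hneg th0 r0.
set x := fine (chi theta r (Lambda P0 Q)) in chE.
have xr : (x <= r)%R by rewrite -lee_fin -chE; exact: chi_le.
have c0 : (0 < c)%R := lt_le_trans ltr01 c1.
have mreg := measurable_regular Q c.
have regN : P0.-negligible (~` regular Q c).
  by exists (~` regular Q c); split => //; exact: measurableC.
have up := upper_rate c0 regN mreg C0 r0 th0 small (tilt_grid hneg th0 r0) xr.
suff H : (n%:R^-1)%:E * lne (popn P0 Q n (upto (expR (theta * n%:R))) i) @[n --> \oo] --> (- x)%:E.
  rewrite chE -EFinN -(cvg_lim (@ereal_hausdorff R) H) -is_cvg_limn_esupE; last first.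
    by apply/cvg_ex; exists (- x)%:E.
  congr limn_esup; apply/funext => n; rewrite /upto -(PP_popn hbpre); congr (_ * lne (PP i _)).
  by apply/seteqP; split => w /= /andP.
apply: cvg_log_rate => eps e0; have e20 : (0 < eps / 2)%R by rewrite divr_gt0.
suff lo : \forall n \near \oo, (expR (- (x + eps) * n%:R))%:E <=
    popn P0 Q n (upto (expR (theta * n%:R))) i.
  near=> n; apply/andP; split; near: n; [exact: lo|exact: up].
have [t tI tx] := chi_near_term hneg th0 r0 e20.
rewrite -/x in tx.
have [t0 t1] := andP tI.
have weaken y : (y <= x + eps)%R -> (\forall n \near \oo, (expR (- y * n%:R))%:E <=
      popn P0 Q n (upto (expR (theta * n%:R))) i) ->
    \forall n \near \oo, (expR (- (x + eps) * n%:R))%:E <=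
      popn P0 Q n (upto (expR (theta * n%:R))) i.
  move=> yx; apply: filterS => n; apply: le_trans.
  by rewrite lee_fin ler_expR ler_wpM2r // lerN2.
have [tE|tn1] := eqVneq t 1%R.
  apply: (weaken (r + eps / 2)%R).
    by move: tx; rewrite tE mul1r subrr mul0r addr0; lra.
  near=> n; apply: (@le_trans _ _ (popn P0 Q n (ind (pred1 i)) i)); first by near: n; exact: low.
  have ni : (i%:R <= expR (theta * n%:R))%R by near: n; exact: near_le_expR.
  apply: le_popn => k; first exact: ind_ge0.
  by rewrite /upto /ind lee_fin ler_nat /=; case: eqP => [->|//]; rewrite i0 ni.
have t1' : (t < 1)%R by rewrite lt_neqAle tn1.
have s0 : (0 < 1 - t)%R by rewrite subr_gt0.
have [tE|tn0] := eqVneq t 0%R.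
  apply: (weaken (fine (Lambda P0 Q theta) + eps / 2)%R); last exact: lower_rate_Lambda.
  by move: tx; rewrite tE mul0r subr0 divr1 mul1r add0r; lra.
apply: (weaken (t * r + (1 - t) * fine (Lambda P0 Q (theta / (1 - t))) + eps / 2)%R).
  by move: tx; lra.
apply: concat_rate => //.
- by rewrite lt_neqAle eq_sym tn0 t0.
- by rewrite fine_ge0 // Lambda_ge0.
- by move=> e e1; apply: lower_rate_Lambda => //; rewrite divr_gt0.
Unshelve. all: by end_near. Qed.

End LowerDeviation.

Theorem theorem3p2 (R : realType) (d0 d : measure_display)
  (Omega0 : measurableType d0) (P0 : probability Omega0 R)
  (Q : {mfun Omega0 >-> offspring_law R})
  (Omega : measurableType d)
  (E : nat -> {mfun Omega >-> offspring_law R})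
  (Z : nat -> {mfun Omega >-> nat})
  (PP : nat -> probability Omega R)
  (hbpre : bpre_family P0 Q E Z PP)
  (hsuper : 0 < mean_X P0 Q)
  (hexp : exists s : R, (0 < s)%R /\ mgf_X P0 Q (- s)%R < +oo)
  (hneg : 0 < P0 [set w | X Q w < 0]) :
  (forall k : nat -> R,
     k n @[n --> \oo] --> +oo%R ->
     (forall eta : R, (0 < eta)%R ->
        (k n / expR (eta * n%:R))%R @[n --> \oo] --> (0 : R)%R) ->
     forall i : nat, ClI P0 Q Z PP i ->
       (n%:R^-1)%:E * lne (PP i [set w | (1 <= Z n w)%N /\ ((Z n w)%:R <= k n)%R])
         @[n --> \oo] --> (- varrho P0 Q Z PP)%:E)
  /\
  ((forall r : R, (0 < r)%R ->
      P0 [set w | exists z : int, X Q w = (r * z%:~R)%:E] < 1) ->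
   (exists c : R, (0 < c)%R /\
      {ae P0, forall w,
        second_moment (Q w) <= c%:E * (mean (Q w) + mean (Q w) ^+ 2)}) ->
   \int[PP 1%N]_w ((Z 1%N w)%:R * Num.max (ln (Z 1%N w)%:R) 0)%:E < +oo ->
   forall theta : R, (0 < theta)%R -> theta%:E <= mean_X P0 Q ->
   forall i : nat, ClI P0 Q Z PP i ->
     limn_esup (fun n : nat => (n%:R^-1)%:E *
       lne (PP i [set w | (1 <= Z n w)%N /\ ((Z n w)%:R <= expR (theta * n%:R))%R]))
     = - chi theta (varrho P0 Q Z PP) (Lambda P0 Q)).
Proof.
split; first by move=> k kinf ksub i Ci; exact: (subexponential_rate hbpre).
move=> _ [c0 [_ hsm]] hlog theta th0 _ i Ci.
apply: (lower_deviation hbpre hsuper hexp hneg _ (regular_ae hbpre hexp hlog hsm) th0 Ci).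
by rewrite le_max lexx orbT.
Qed.
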